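(* Let $\varepsilon>0$. For every fixed $t\in(0,T]$, $$S_{N,t}(u_\varepsilon)\xrightarrow[N\to\infty]{}\frac12(A_2-A_1)\,\varepsilon^{-1}\qquad\text{almost surely}.$$
   Context: Fix $T>0$. $\mathbb{T}=\mathbb{R}/\mathbb{Z}$ is the one-dimensional flat torus, identified with $[0,1)$ with periodic boundary conditions. $p_t(x)=\sum_{k\in\mathbb{Z}}\frac{1}{\sqrt{4\pi t}}e^{-(x-k)^2/(4t)}$ is the periodic heat kernel. $W$ is a space-time Gaussian white noise on $[0,T]\times\mathbb{T}$, i.e. a centered Gaussian family with $\mathbf{E}[W(A)W(B)]=\lambda(A\cap B)$ for Borel $A,B\subset[0,T]\times\mathbb{T}$, $\lambda$ being Lebesgue measure. Let $f(u)=u-u^3$. For $\varepsilon>0$, $u_\varepsilon$ is the unique mild solution, with zero initial condition, of the stochastic Allen--Cahn equation $\partial_tu_\varepsilon=\varepsilon\,\partial_x^2u_\varepsilon+f(u_\varepsilon)+\dot W$ on $[0,T]\times\mathbb{T}$, i.e. $$u_\varepsilon(t,x)=\int_0^t\!\int_{\mathbb{T}}p_{\varepsilon(t-s)}(x-y)f(u_\varepsilon(s,y))\,dy\,ds+\int_0^t\!\int_{\mathbb{T}}p_{\varepsilon(t-s)}(x-y)\,W(ds,dy);$$ it satisfies $\sup_{t\in[0,T],x\in\mathbb{T}}\mathbf{E}|u_\varepsilon(t,x)|^q<\infty$ for all $q\ge2$. Let $A_1<A_2$ with $[A_1,A_2]\subset\mathbb{T}$, and for $N\ge1$ let $x_i=A_1+i\frac{A_2-A_1}{N}$,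 $i=0,\dots,N$. The spatial quadratic variation of a random field $Z$ at time $t$ is $$S_{N,t}(Z)=\sum_{i=0}^{N-1}\bigl(Z(t,x_{i+1})-Z(t,x_i)\bigr)^2 .$$ *)

(* Defs.v *)
From HB Require Import structures.
From mathcomp Require Import all_boot all_order all_algebra.
From mathcomp Require Import all_classical all_reals all_analysis.
Import Order.TTheory GRing.Theory Num.Theory.
Import numFieldNormedType.Exports.

Set Implicit Arguments.
Unset Strict Implicit.
Unset Printing Implicit Defensive.

Local Open Scope classical_set_scope.
Local Open Scope ring_scope.

(* The torus R/Z is represented by its fundamental domain [0, 1). *)
Definition torus (R : realType) : set R := `[0, 1[%classic.
Arguments torus : clear implicits.

Notation plane R := (measurableTypeR R * measurableTypeR R)%type.

Definition spacetime (R : realType) (T : R) : set (plane R) :=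
  `[0, T]%classic `*` torus R.

Notation lambda2 R := (@lebesgue_measure R \x @lebesgue_measure R)%E.

(* Intended for t > 0; at t = 0 it evaluates to 0 because 0^-1 = 0.  The value
   at t = 0 only enters the space-time integrals below on a null set. *)
Definition heat_kernel (R : realType) (t x : R) : R :=
  fine (\esum_(k in [set: int])
    ((Num.sqrt (4 * pi * t))^-1 *
       expR (- (x - k%:~R) ^+ 2 / (4 * t)))%:E).

Definition reaction (R : realType) (v : R) : R := v - v ^+ 3.

Section noise.
Context d (Omega : measurableType d) (R : realType) (P : probability Omega R).
Implicit Types (W : set (plane R) -> Omega -> R) (D : set (plane R)).

(* The law delta_0 is stated separately: normal_prob 0 s is the centered normal
   law with standard deviation `|s| only when s != 0. *)
Definition centered_gaussian (X : Omega -> R) : Prop :=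
  measurable_fun [set: Omega] X /\
  ({ae P, forall w, X w = 0} \/
   exists2 s : R, s != 0 & forall A : set R, measurable A ->
     P (X @^-1` A) = normal_prob 0 s A).

(* A step function is given by a list of coefficients and sets (c_j, A_j),
   standing for sum_j c_j 1_{A_j}. *)
Definition step_on D (l : seq (R * set (plane R))) : Prop :=
  forall cA, cA \in l -> measurable cA.2 /\ cA.2 `<=` D.

Definition step_fun (l : seq (R * set (plane R))) (z : plane R) : R :=
  \sum_(cA <- l) cA.1 * \1_(cA.2) z.

Definition step_integral W (l : seq (R * set (plane R))) (w : Omega) : R :=
  \sum_(cA <- l) cA.1 * W cA.2 w.

(* W is only constrained on the Borel subsets of D. *)
Definition white_noise D W : Prop :=
  (forall l, step_on D l -> centered_gaussian (step_integral W l)) /\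
  (forall A B : set (plane R), measurable A -> A `<=` D -> measurable B -> B `<=` D ->
     ('E_P[W A \* W B] = (lambda2 R) (A `&` B)%classic)%E).

(* Z is (a version of) the integral over D of the deterministic integrand h
   against W: the L^2(P)-limit of the integrals of step functions converging to
   h in L^2(D).  By the isometry property of W, Z is determined up to
   P-null sets. *)
Definition wiener_integral W D (h : plane R -> R) (Z : Omega -> R) : Prop :=
  [/\ measurable_fun D h, measurable_fun [set: Omega] Z &
   exists l : nat -> seq (R * set (plane R)),
   [/\ forall n, step_on D (l n),
       (\int[lambda2 R]_(z in D) ((h z - step_fun (l n) z) ^+ 2)%:E)%E
         @[n --> \oo] --> 0%E &
       ('E_P[fun w => ((Z w - step_integral W (l n) w) ^+ 2)%R])%E
         @[n --> \oo] --> 0%E]].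

Definition mild_solution (T eps : R) W (u : R -> R -> Omega -> R) : Prop :=
  [/\ measurable_fun (spacetime T `*` [set: Omega])
        (fun z : plane R * Omega => u z.1.1 z.1.2 z.2),
      forall t x, `[0, T]%classic t -> torus R x ->
        exists2 Z : Omega -> R,
          wiener_integral W (spacetime t)
            (fun z => heat_kernel (eps * (t - z.1)) (x - z.2)) Z &
          {ae P, forall w,
            (lambda2 R).-integrable (spacetime t)
              (fun z => (heat_kernel (eps * (t - z.1)) (x - z.2) *
                         reaction (u z.1 z.2 w))%:E) /\
            u t x w =
              \int[lebesgue_measure]_(s in `[0, t]%classic)
                \int[lebesgue_measure]_(y in torus R)
                  (heat_kernel (eps * (t - s)) (x - y) * reaction (u s y w))
              + Z w} &
      forall q : R, 2 <= q ->
        (ereal_sup [set 'E_P[fun w => (`|u z.1 z.2 w| `^ q)%R]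
                   | z in spacetime T] < +oo)%E].

End noise.

Definition quad_var (R : realType) (Omega : Type) (A1 A2 : R) (N : nat) (t : R)
    (Z : R -> R -> Omega -> R) (w : Omega) : R :=
  let x (i : nat) := A1 + i%:R * ((A2 - A1) / N%:R) in
  \sum_(0 <= i < N) (Z t (x i.+1) w - Z t (x i) w) ^+ 2.

(* Main.v *)
From HB Require Import structures.
Require Import Defs.
From mathcomp Require Import all_boot all_order all_algebra.
From mathcomp Require Import all_classical all_reals all_analysis.
From mathcomp Require Import measurable_realfun lebesgue_integral_nonneg ring lra zify.
Import Order.TTheory GRing.Theory Num.Theory.
Import numFieldNormedType.Exports.

Set Implicit Arguments.
Unset Strict Implicit.
Unset Printing Implicit Defensive.

Local Open Scope classical_set_scope.
Local Open Scope ring_scope.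

(** The solution splits as [u = V + Z], with [Z] the Wiener integral of the
kernel [K_x (s, y) = p_(eps (t - s)) (x - y)] over [[0, t]] times the torus
and [V] the drift, the integral of [K_x] against [F = u - u ^ 3].  On a grid
[x_i] of mesh [h], the increments of both are governed by the functions
[e_i = K_(x_(i+1)) - K_(x_i)] of L2: those of [Z] are the Wiener integrals of
the [e_i], those of [V] are the inner products [<e_i, F>].

Everything rests on the Gram matrix of the [e_i].  By the semigroup property,
[<K_x, K_x'>] is the sum over integers [k] of [q (x - x' - k)], where [q] is
the integral over [s] in [[0, t[] of the Gauss kernel of the line at time
[2 eps (t - s)].  With [H (tau, z)] the solution of the heat equation started
from the positive part [z+], so that the time derivative of [H] is the Gauss
kernel, [q z = (H (2 eps t, z) - z+) / (2 eps)].  An entry [<e_i, e_j>] is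
minus a second difference of step [h] of the periodised [q].  The smooth part
[H] contributes [O(h ^ 2)], while the second difference of [z+] is the tent
[(h - |z|)+], which sees only [i = j].  Therefore [<e_i, e_i>] is
[h / (2 eps) + O(h ^ 2)] and the other entries are [O(h ^ 2)]
([increment_gram_bound], [grid_increment_gram]).

The squared increments of [Z] have expectations adding up to
[(A2 - A1) / (2 eps) + O(h)].  Their sum concentrates fast enough for almost
sure convergence.  Its variance is only [O(1/N)], which is not summable, so
fourth moments are used: the fourth central moment of the sum of the squares
is [O(1/N^2)] ([gaussian_qform4], [step_quadratic_variation4]), and a sequence
of nonnegative variables with summable expectations tends to 0 almost surely
([ae_cvg0_summable]).  The moment computation is a duality.  For [g] standard
Gaussian and independent of the vector [X], the average over [g] of
[<g, X> ^ 2k] is [(2k - 1)!! |X| ^ 2k]; exchanging the two averages turns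
[E (|X|^2 - tr G) ^ 4] into the same moment of [g G g - tr G], a quadratic form
in independent variables, and only the law of each single linear combination
of the [X_i] is involved.  As just the moments of order at most 8 of the
coordinates of [g] matter, [g] is taken discrete, with the nodes and weights
of the five-point Gauss-Hermite rule, so that the averages over [g] are finite
sums.

The drift is negligible: the row sums of the Gram matrix are [O(h)], so a
Bessel inequality bounds the sum of the [<e_i, F> ^ 2] by
[O(h)] times the squared norm of [F] ([bessel_row_sum],
[drift_quadratic_variation]), which is finite almost surely because [u] has
bounded moments ([reaction_L2]).  Mixed terms are absorbed by Cauchy-Schwarz
([cvg_sqr_sum_perturb]).  The same perturbation argument replaces each
Wiener integral by the integral of a step function close to it in L2
([wiener_quadratic_variation]), the only integrals whose law is given. *)

(** * The five-point Gauss-Hermite rule *)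

Section quadrature.
Variable R : realType.
Implicit Types f : R -> R.

Let r10 : R := Num.sqrt 10.
Let node1 : R := Num.sqrt (5 - r10).
Let node2 : R := Num.sqrt (5 + r10).

(** The Gauss-Hermite rule with five nodes: the roots of the Hermite polynomial
[y ^ 5 - 10 y ^ 3 + 15 y], weighted so that the rule integrates polynomials of
degree at most 9 exactly against the standard normal law. *)
Definition hermite5 f : R :=
  8 / 15 * f 0
  + (7 + 2 * Num.sqrt 10) / 60 * (f (Num.sqrt (5 - Num.sqrt 10)) + f (- Num.sqrt (5 - Num.sqrt 10)))
  + (7 - 2 * Num.sqrt 10) / 60 * (f (Num.sqrt (5 + Num.sqrt 10)) + f (- Num.sqrt (5 + Num.sqrt 10))).

Let r10_sqr : r10 ^+ 2 = 10.
Proof. by rewrite sqr_sqrtr. Qed.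

Let r10_ge0 : 0 <= r10. Proof. exact: sqrtr_ge0. Qed.

Let r10_bounds : 0 <= r10 <= 7 / 2.
Proof. by have := r10_ge0; have := r10_sqr; rewrite r10_ge0 /=; nra. Qed.

Let node1_sqr : node1 ^+ 2 = 5 - r10.
Proof. by case/andP: r10_bounds => ? ?; rewrite /node1 sqr_sqrtr//; lra. Qed.

Let node2_sqr : node2 ^+ 2 = 5 + r10.
Proof. by case/andP: r10_bounds => ? ?; rewrite /node2 sqr_sqrtr//; lra. Qed.

(** The weights are positive since [sqrt 10 < 7 / 2].  Positivity is what makes
the rule a probability measure, and so allows inequalities to be averaged. *)
Lemma hermite5_ge0 f : (forall y, 0 <= f y) -> 0 <= hermite5 f.
Proof.
move=> f0; rewrite /hermite5 -/r10.
case/andP: r10_bounds => ? ?.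
have h0 : 0 <= 8 / 15 :> R by lra.
have h1 : 0 <= (7 + 2 * r10) / 60 by lra.
have h2 : 0 <= (7 - 2 * r10) / 60 by lra.
by rewrite !addr_ge0// mulr_ge0// addr_ge0.
Qed.

(** Odd powers cancel between opposite nodes; on even powers both sides are
polynomials in [sqrt 10], reduced by [(sqrt 10) ^ 2 = 10].  The values 1, 3, 15
and 105 are the even moments of the standard normal law. *)
Lemma hermite5_poly (c0 c1 c2 c3 c4 c5 c6 c7 c8 : R) :
  hermite5 (fun y => c0 + c1 * y + c2 * y ^+ 2 + c3 * y ^+ 3 + c4 * y ^+ 4
    + c5 * y ^+ 5 + c6 * y ^+ 6 + c7 * y ^+ 7 + c8 * y ^+ 8)
  = c0 + c2 + 3 * c4 + 15 * c6 + 105 * c8.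
Proof.
rewrite /hermite5 -/r10 -/node1 -/node2.
have e1 (a b : R) : a ^+ 2 = b ->
  [/\ a ^+ 4 = b ^+ 2, a ^+ 6 = b ^+ 3 & a ^+ 8 = b ^+ 4].
  by move=> <-; split; ring.
have [p4 p6 p8] := e1 _ _ node1_sqr.
have [q4 q6 q8] := e1 _ _ node2_sqr.
set s := node1 in p4 p6 p8 *; set t := node2 in q4 q6 q8 *.
transitivity (8 / 15 * c0
  + (7 + 2 * r10) / 60 * (2 * (c0 + c2 * s ^+ 2 + c4 * s ^+ 4 + c6 * s ^+ 6 + c8 * s ^+ 8))
  + (7 - 2 * r10) / 60 * (2 * (c0 + c2 * t ^+ 2 + c4 * t ^+ 4 + c6 * t ^+ 6 + c8 * t ^+ 8))).
  by field.
rewrite p4 p6 p8 q4 q6 q8 node1_sqr node2_sqr.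
have r3 : r10 ^+ 3 = 10 * r10 by rewrite exprS r10_sqr; ring.
have r4 : r10 ^+ 4 = 100 by rewrite (exprM _ 2 2) r10_sqr; ring.
have r5 : r10 ^+ 5 = 100 * r10 by rewrite exprS r4; ring.
by field: r10_sqr r3 r4 r5.
Qed.

End quadrature.

(** * Quadratic forms in independent discrete Gaussian variables *)

Section discrete_gaussian.
Variable R : realType.
Implicit Types (g x d : nat -> R) (c : nat -> nat -> R) (F G : (nat -> R) -> R).

Definition upd g n (y : R) : nat -> R := fun i => if i == n then y else g i.

(** Expectation of [F] of [n] independent variables, each distributed on the
five Gauss-Hermite nodes; the coordinates from [n] on are 0. *)
Fixpoint dgauss n F : R :=
  if n is m.+1 then dgauss m (fun g => hermite5 (fun y => F (upd g m y)))
  else F (fun=> 0).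

Lemma eq_dgauss n F G : F =1 G -> dgauss n F = dgauss n G.
Proof. by move=> /funext ->. Qed.

Lemma hermite5D (f h : R -> R) a :
  hermite5 (fun y => a * f y + h y) = a * hermite5 f + hermite5 h.
Proof. by rewrite /hermite5; ring. Qed.

Lemma dgauss_lin n F G a :
  dgauss n (fun g => a * F g + G g) = a * dgauss n F + dgauss n G.
Proof.
elim: n F G => [//|n IH] F G /=; rewrite -IH; apply: eq_dgauss => g.
exact: (hermite5D (fun y => F (upd g n y)) (fun y => G (upd g n y))).
Qed.

Lemma dgauss_cst n a : dgauss n (fun=> a) = a.
Proof.
elim: n => [//|n IH] /=; rewrite -[RHS]IH; apply: eq_dgauss => g.
by rewrite /hermite5; field.
Qed.

Lemma dgaussD n F G : dgauss n (fun g => F g + G g) = dgauss n F + dgauss n G.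
Proof.
rewrite -[dgauss n F]mul1r -dgauss_lin; apply: eq_dgauss => g.
by rewrite mul1r.
Qed.

Lemma dgaussZ n F a : dgauss n (fun g => a * F g) = a * dgauss n F.
Proof.
rewrite -[RHS]addr0 -[X in _ + X](dgauss_cst n 0) -dgauss_lin.
by apply: eq_dgauss => g; rewrite addr0.
Qed.

Lemma dgauss_ge0 n F : (forall g, 0 <= F g) -> 0 <= dgauss n F.
Proof.
elim: n F => [|n IH] F F0 /=; first exact: F0.
by apply: IH => g; apply: hermite5_ge0.
Qed.

Lemma le_dgauss n F G : (forall g, F g <= G g) -> dgauss n F <= dgauss n G.
Proof.
move=> FG; rewrite -subr_ge0.
have -> : dgauss n G - dgauss n F = dgauss n (fun g => -1 * F g + G g).
  by rewrite dgauss_lin; ring.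
by apply: dgauss_ge0 => g; rewrite mulN1r addrC subr_ge0.
Qed.

Lemma sum_upd (h : nat -> R -> R) g n y :
  \sum_(i < n) h i (upd g n y i) = \sum_(i < n) h i (g i).
Proof. by apply: eq_bigr => i _; rewrite /upd ltn_eqF. Qed.

(** Integrating out the last coordinate of a function that is polynomial of
degree at most 8 in it: this reduces each moment below to a recursion on the
number of coordinates. *)
Lemma dgaussS n F (c0 c1 c2 c3 c4 c5 c6 c7 c8 : (nat -> R) -> R) :
  (forall g y, F (upd g n y) = c0 g + c1 g * y + c2 g * y ^+ 2 + c3 g * y ^+ 3
    + c4 g * y ^+ 4 + c5 g * y ^+ 5 + c6 g * y ^+ 6 + c7 g * y ^+ 7
    + c8 g * y ^+ 8) ->
  dgauss n.+1 F = dgauss n (fun g => c0 g + c2 g + 3 * c4 g + 15 * c6 g + 105 * c8 g).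
Proof.
move=> FE /=; apply: eq_dgauss => g; rewrite -(hermite5_poly (c0 g) (c1 g) _ (c3 g) _ (c5 g) _ (c7 g)).
by congr hermite5; apply: funext => y; rewrite FE.
Qed.

#[local] Arguments dgauss : simpl never.

Lemma dgauss0 F : dgauss 0 F = F (fun=> 0). Proof. by []. Qed.

Definition lin n x g := \sum_(i < n) x i * g i.

Lemma lin_upd n x g y : lin n.+1 x (upd g n y) = lin n x g + x n * y.
Proof.
rewrite /lin big_ord_recr/= (sum_upd (fun i z => x i * z)).
by rewrite /upd eqxx.
Qed.

(** A linear form in the discrete variables has the moments of a centered normal
variable of variance [s], up to order 8: the binomial expansion only involves
moments of order at most 8 of each coordinate. *)
Lemma dgauss_lin_moments n x (s := \sum_(i < n) x i ^+ 2) :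
  [/\ dgauss n (fun g => lin n x g ^+ 2) = s,
      dgauss n (fun g => lin n x g ^+ 4) = 3 * s ^+ 2,
      dgauss n (fun g => lin n x g ^+ 6) = 15 * s ^+ 3 &
      dgauss n (fun g => lin n x g ^+ 8) = 105 * s ^+ 4].
Proof.
rewrite /s {s}; elim: n => [|n [IH2 IH4 IH6 IH8]].
  by rewrite !big_ord0 !dgauss0 /lin big_ord0; split; ring.
rewrite big_ord_recr /=; set s := \sum_(i < n) _ in IH2 IH4 IH6 IH8 *.
set z := x n.
split.
- rewrite (@dgaussS n _ (fun g => lin n x g ^+ 2) (fun g => 2 * lin n x g * z)
    (fun=> z ^+ 2) (fun=> 0) (fun=> 0) (fun=> 0) (fun=> 0) (fun=> 0) (fun=> 0)).
    transitivity (dgauss n (fun g => 1 * lin n x g ^+ 2 + z ^+ 2)).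
      by apply: eq_dgauss => g; ring.
    by rewrite dgauss_lin dgauss_cst IH2; ring.
  by move=> g y; rewrite lin_upd -/z; ring.
- rewrite (@dgaussS n _ (fun g => lin n x g ^+ 4) (fun g => 4 * lin n x g ^+ 3 * z)
    (fun g => 6 * lin n x g ^+ 2 * z ^+ 2) (fun g => 4 * lin n x g * z ^+ 3)
    (fun=> z ^+ 4) (fun=> 0) (fun=> 0) (fun=> 0) (fun=> 0)).
    transitivity (dgauss n (fun g => 1 * lin n x g ^+ 4 +
        (6 * z ^+ 2 * lin n x g ^+ 2 + 3 * z ^+ 4))).
      by apply: eq_dgauss => g; ring.
    by rewrite !dgauss_lin dgauss_cst IH2 IH4; ring.
  by move=> g y; rewrite lin_upd -/z; ring.
- rewrite (@dgaussS n _ (fun g => lin n x g ^+ 6) (fun g => 6 * lin n x g ^+ 5 * z)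
    (fun g => 15 * lin n x g ^+ 4 * z ^+ 2) (fun g => 20 * lin n x g ^+ 3 * z ^+ 3)
    (fun g => 15 * lin n x g ^+ 2 * z ^+ 4) (fun g => 6 * lin n x g * z ^+ 5)
    (fun=> z ^+ 6) (fun=> 0) (fun=> 0)).
    transitivity (dgauss n (fun g => 1 * lin n x g ^+ 6 +
        (15 * z ^+ 2 * lin n x g ^+ 4 + (45 * z ^+ 4 * lin n x g ^+ 2 + 15 * z ^+ 6)))).
      by apply: eq_dgauss => g; ring.
    by rewrite !dgauss_lin dgauss_cst IH2 IH4 IH6; ring.
  by move=> g y; rewrite lin_upd -/z; ring.
- rewrite (@dgaussS n _ (fun g => lin n x g ^+ 8) (fun g => 8 * lin n x g ^+ 7 * z)
    (fun g => 28 * lin n x g ^+ 6 * z ^+ 2) (fun g => 56 * lin n x g ^+ 5 * z ^+ 3)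
    (fun g => 70 * lin n x g ^+ 4 * z ^+ 4) (fun g => 56 * lin n x g ^+ 3 * z ^+ 5)
    (fun g => 28 * lin n x g ^+ 2 * z ^+ 6) (fun g => 8 * lin n x g * z ^+ 7)
    (fun=> z ^+ 8)).
    transitivity (dgauss n (fun g => 1 * lin n x g ^+ 8 +
        (28 * z ^+ 2 * lin n x g ^+ 6 + (210 * z ^+ 4 * lin n x g ^+ 4 +
        (420 * z ^+ 6 * lin n x g ^+ 2 + 105 * z ^+ 8))))).
      by apply: eq_dgauss => g; ring.
    by rewrite !dgauss_lin dgauss_cst IH2 IH4 IH6 IH8; ring.
  by move=> g y; rewrite lin_upd -/z; ring.
Qed.

(** A quadratic form in the [g i], centered at its trace, splits into a diagonal
part, the sum of the independent centered variables [d i * (g i ^ 2 - 1)], and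
twice a strictly lower triangular part [tri_chaos]; both are martingales in
[n]. *)
Definition diag_chaos n d g := \sum_(i < n) d i * (g i ^+ 2 - 1).

Lemma diag_chaos_upd n d g y :
  diag_chaos n.+1 d (upd g n y) = diag_chaos n d g + d n * (y ^+ 2 - 1).
Proof.
rewrite /diag_chaos big_ord_recr/= (sum_upd (fun i z => d i * (z ^+ 2 - 1))).
by rewrite /upd eqxx.
Qed.

(** Here [y ^ 2 - 1] has moments 0, 2, 8 and 60 of orders 1 to 4.  Adding one
coordinate [z] to the fourth moment [m4] gives
[m4 + 12 z ^ 2 m2 + 60 z ^ 4], with [m2 = 2 s], which stays below
[60 (s + z ^ 2) ^ 2]. *)
Lemma dgauss_diag_chaos n d (s := \sum_(i < n) d i ^+ 2) :
  [/\ dgauss n (diag_chaos n d) = 0,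
      dgauss n (fun g => diag_chaos n d g ^+ 2) = 2 * s &
      dgauss n (fun g => diag_chaos n d g ^+ 4) <= 60 * s ^+ 2].
Proof.
rewrite /s {s}; elim: n => [|n [IH1 IH2 IH4]].
  by rewrite !big_ord0 !dgauss0 /diag_chaos big_ord0; split=> //; lra.
rewrite big_ord_recr /=; set s := \sum_(i < n) _ in IH2 IH4 *.
set z := d n.
have s0 : 0 <= s by apply: sumr_ge0 => i _; exact: sqr_ge0.
split.
- rewrite (@dgaussS n _ (fun g => diag_chaos n d g - z) (fun=> 0) (fun=> z)
    (fun=> 0) (fun=> 0) (fun=> 0) (fun=> 0) (fun=> 0) (fun=> 0)).
    by rewrite -[RHS]IH1; apply: eq_dgauss => g; ring.
  by move=> g y; rewrite diag_chaos_upd -/z; ring.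
- rewrite (@dgaussS n _ (fun g => (diag_chaos n d g - z) ^+ 2) (fun=> 0)
    (fun g => 2 * z * (diag_chaos n d g - z))
    (fun=> 0) (fun=> z ^+ 2) (fun=> 0) (fun=> 0) (fun=> 0) (fun=> 0)).
    transitivity (dgauss n (fun g => 1 * diag_chaos n d g ^+ 2 + 2 * z ^+ 2)).
      by apply: eq_dgauss => g; ring.
    by rewrite dgauss_lin dgauss_cst IH2; ring.
  by move=> g y; rewrite diag_chaos_upd -/z; ring.
- rewrite (@dgaussS n _ (fun g => (diag_chaos n d g - z) ^+ 4) (fun=> 0)
    (fun g => 4 * z * (diag_chaos n d g - z) ^+ 3)
    (fun=> 0) (fun g => 6 * z ^+ 2 * (diag_chaos n d g - z) ^+ 2) (fun=> 0)
    (fun g => 4 * z ^+ 3 * (diag_chaos n d g - z)) (fun=> 0) (fun=> z ^+ 4)).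
    apply: (@le_trans _ _ (dgauss n (fun g => 1 * diag_chaos n d g ^+ 4 +
        (12 * z ^+ 2 * diag_chaos n d g ^+ 2 +
          (32 * z ^+ 3 * diag_chaos n d g + 60 * z ^+ 4))))).
      by apply: le_dgauss => g; rewrite le_eqVlt; apply/orP; left; apply/eqP; ring.
    rewrite !dgauss_lin dgauss_cst IH1 IH2.
    have : 0 <= z ^+ 2 by exact: sqr_ge0.
    have -> : z ^+ 4 = (z ^+ 2) ^+ 2 by ring.
    set w := z ^+ 2 => w0.
    have ? : 0 <= w * s by exact: mulr_ge0.
    by nra.
  by move=> g y; rewrite diag_chaos_upd -/z; ring.
Qed.

Definition tri_chaos n c g := \sum_(i < n) g i * lin i (c i) g.

Lemma lin_upd_le n m x g y : (m <= n)%N -> lin m x (upd g n y) = lin m x g.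
Proof.
move=> mn; apply: eq_bigr => i _; congr (_ * _).
by rewrite /upd ltn_eqF// (leq_trans _ mn).
Qed.

Lemma tri_chaos_upd n c g y :
  tri_chaos n.+1 c (upd g n y) = tri_chaos n c g + y * lin n (c n) g.
Proof.
rewrite /tri_chaos big_ord_recr/= lin_upd_le//.
congr (_ + _); last by rewrite /upd eqxx.
apply: eq_bigr => i _; rewrite lin_upd_le; last exact/ltnW.
by rewrite /upd ltn_eqF.
Qed.

(** Write [a] for the form in [N] coordinates and [b] for the linear form that
multiplies the next coordinate.  The fourth moment grows from [a ^ 4] to
[a ^ 4 + 6 a ^ 2 b ^ 2 + 3 b ^ 4], and Young's inequality with weight [N] gives
the factor [1 + 3 / N], which matches the growth of [N ^ 4], and a term in
[b ^ 4], of order [M ^ 4 N ^ 3]. *)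
Lemma dgauss_tri_chaos n c (M : R) :
  (forall i j, (j < i < n)%N -> `|c i j| <= M) ->
  dgauss n (fun g => tri_chaos n c g ^+ 4) <= 18 * M ^+ 4 * n%:R ^+ 4.
Proof.
elim: n => [_|n IH cM].
  by rewrite dgauss0 /tri_chaos big_ord0; rewrite !expr0n/= mulr0.
rewrite (@dgaussS n _ (fun g => tri_chaos n c g ^+ 4)
  (fun g => 4 * tri_chaos n c g ^+ 3 * lin n (c n) g)
  (fun g => 6 * tri_chaos n c g ^+ 2 * lin n (c n) g ^+ 2)
  (fun g => 4 * tri_chaos n c g * lin n (c n) g ^+ 3)
  (fun g => lin n (c n) g ^+ 4) (fun=> 0) (fun=> 0) (fun=> 0) (fun=> 0)); last first.
  by move=> g y; rewrite tri_chaos_upd; ring.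
case: n => [|n] in IH cM *.
  rewrite dgauss0 /tri_chaos /lin !big_ord0 expr1n mulr1.
  by rewrite !expr0n/= !(mulr0, mul0r, addr0) mulr_ge0// exprn_even_ge0.
set N := n.+1 in IH cM *.
have N1 : 1 <= N%:R :> R by rewrite ler1n.
have [_ L4 _ _] := dgauss_lin_moments N (c N).
set s := \sum_(i < N) _ in L4.
have s0 : 0 <= s by apply: sumr_ge0 => i _; exact: sqr_ge0.
have sM : s <= M ^+ 2 * N%:R.
  rewrite mulrC -[N in leRHS]card_ord mulr_natl -sumr_const; apply: ler_sum => i _.
  rewrite -real_normK ?num_real// lerXn2r ?nnegrE//.
    by rewrite (le_trans (normr_ge0 (c N i)))// cM// ltn_ord ltnSn.
  by apply: cM; rewrite ltn_ord ltnSn.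
apply: (@le_trans _ _ (dgauss N (fun g => (1 + 3 / N%:R) * tri_chaos N c g ^+ 4
    + (3 * N%:R + 3) * lin N (c N) g ^+ 4))).
  apply: le_dgauss => g.
  set a := tri_chaos N c g; set b := lin N (c N) g.
  have : 0 <= 3 / N%:R * (a ^+ 2 - N%:R * b ^+ 2) ^+ 2.
    by rewrite mulr_ge0 ?sqr_ge0// divr_ge0.
  have -> : 3 / N%:R * (a ^+ 2 - N%:R * b ^+ 2) ^+ 2 =
     3 / N%:R * a ^+ 4 - 6 * a ^+ 2 * b ^+ 2 + 3 * N%:R * b ^+ 4.
    by field; rewrite pnatr_eq0.
  by lra.
rewrite dgauss_lin dgaussZ L4.
have {}IH : dgauss N (fun g => tri_chaos N c g ^+ 4) <= 18 * M ^+ 4 * N%:R ^+ 4.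
  by apply: IH => i j /andP[ji iN]; apply: cM; rewrite ji/= ltnW// ltnS.
have sM2 : s ^+ 2 <= M ^+ 4 * N%:R ^+ 2.
  have -> : M ^+ 4 * N%:R ^+ 2 = (M ^+ 2 * N%:R) ^+ 2 by ring.
  by rewrite lerXn2r ?nnegrE ?(le_trans s0 sM).
apply: (@le_trans _ _ ((1 + 3 / N%:R) * (18 * M ^+ 4 * N%:R ^+ 4) +
    (3 * N%:R + 3) * (3 * (M ^+ 4 * N%:R ^+ 2)))).
  by rewrite lerD// ler_wpM2l ?addr_ge0 ?mulr_ge0 ?invr_ge0// ler_wpM2l.
have -> : (1 + 3 / N%:R) * (18 * M ^+ 4 * N%:R ^+ 4) =
    M ^+ 4 * (18 * N%:R ^+ 4 + 54 * N%:R ^+ 3) by field; rewrite pnatr_eq0.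
have M4 : 0 <= M ^+ 4 by rewrite exprn_even_ge0.
rewrite -[N.+1%:R]natr1; set k := N%:R in N1 *.
have -> : (3 * k + 3) * (3 * (M ^+ 4 * k ^+ 2)) = M ^+ 4 * ((3 * k + 3) * (3 * k ^+ 2)) by ring.
have -> : 18 * M ^+ 4 * (k + 1) ^+ 4 = M ^+ 4 * (18 * (k + 1) ^+ 4) by ring.
rewrite -mulrDr ler_wpM2l//.
have k0 : 0 <= k by lra.
have k2 : 0 <= k ^+ 2 by exact: sqr_ge0.
have k3 : 0 <= k ^+ 3 by exact: exprn_ge0.
by lra.
Qed.

End discrete_gaussian.

(** * Exchanging the quadrature with an integral *)

Section quadratic_form.
Context d (T : measurableType d) (R : realType) (mu : {measure set T -> \bar R}).
Local Notation L1 f := (mu.-integrable [set: T] (EFin \o f)).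

Lemma integrable_comb D (f h : T -> R) a : measurable D ->
  mu.-integrable D (EFin \o f) -> mu.-integrable D (EFin \o h) ->
  mu.-integrable D (EFin \o (fun w => a * f w + h w)).
Proof.
by move=> mD If Ih; have := integrableD mD (integrableZl mD a If) Ih.
Qed.

Lemma Rintegral_comb D (f h : T -> R) a : measurable D ->
  mu.-integrable D (EFin \o f) -> mu.-integrable D (EFin \o h) ->
  \int[mu]_(w in D) (a * f w + h w) =
    a * \int[mu]_(w in D) f w + \int[mu]_(w in D) h w.
Proof.
move=> mD If Ih; rewrite RintegralD//; last first.
  by have := integrableZl mD a If.
by rewrite RintegralZl.
Qed.

(** The form of the rule as a finite weighted sum, for which linearity of the
integral is an induction. *)
Lemma hermite5E : { s : seq (R * R) | forall f,
  hermite5 f = \sum_(p <- s) p.1 * f p.2 }.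
Proof.
exists [:: (8 / 15, 0);
  ((7 + 2 * Num.sqrt 10) / 60, Num.sqrt (5 - Num.sqrt 10));
  ((7 + 2 * Num.sqrt 10) / 60, - Num.sqrt (5 - Num.sqrt 10));
  ((7 - 2 * Num.sqrt 10) / 60, Num.sqrt (5 + Num.sqrt 10));
  ((7 - 2 * Num.sqrt 10) / 60, - Num.sqrt (5 + Num.sqrt 10))].
by move=> h; rewrite !big_cons big_nil /hermite5 /=; ring.
Qed.

Lemma integral_hermite5 (F : R -> T -> R) : (forall y, L1 (F y)) ->
  L1 (fun w => hermite5 (F^~ w)) /\
  \int[mu]_w hermite5 (F^~ w) = hermite5 (fun y => \int[mu]_w F y w).
Proof.
move=> IF; have [s sE] := hermite5E; rewrite sE.
have -> : (fun w => hermite5 (F^~ w)) = fun w => \sum_(p <- s) p.1 * F p.2 w.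
  by apply: funext => w; rewrite sE.
elim: s {sE} => [|p s [IH1 IH2]].
  rewrite big_nil.
  have -> : (fun w => \sum_(p <- [::]) p.1 * F p.2 w) = cst 0 :> (T -> R).
    by apply: funext => w; rewrite big_nil.
  by split; [exact: integrable0|rewrite Rintegral_cst// mul0r].
have -> : (fun w => \sum_(p <- p :: s) p.1 * F p.2 w) =
    fun w => p.1 * F p.2 w + \sum_(p <- s) p.1 * F p.2 w.
  by apply: funext => w; rewrite big_cons.
rewrite big_cons -IH2; split; first exact: integrable_comb.
by rewrite Rintegral_comb.
Qed.

Lemma integral_dgauss n (F : (nat -> R) -> T -> R) : (forall g, L1 (F g)) ->
  L1 (fun w => dgauss n (F^~ w)) /\
  \int[mu]_w dgauss n (F^~ w) = dgauss n (fun g => \int[mu]_w F g w).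
Proof.
elim: n F => [|n IH] F IF; first by split => //; exact: IF.
have IF' g : L1 (fun w => hermite5 (fun y => F (upd g n y) w)).
  exact: (integral_hermite5 (fun y => IF (upd g n y))).1.
have [I1 I2] := IH _ IF'; split; first exact: I1.
rewrite /= -/(dgauss n) I2; apply: eq_dgauss => g.
exact: (integral_hermite5 (fun y => IF (upd g n y))).2.
Qed.

End quadratic_form.

(** * Fourth central moment of a sum of squares of Gaussian variables *)

Section gaussian_quadratic_form.
Context d (T : measurableType d) (R : realType) (P : probability T R).
Local Notation L1 f := (P.-integrable [set: T] (EFin \o f)).

(** The even moments of a centered normal variable of variance [v].  Order 8 is
that of the fourth power of a square. *)
Definition gaussian_moments (Y : T -> R) (v : R) :=
  [/\ L1 (fun w => Y w ^+ 2) /\ \int[P]_w (Y w ^+ 2) = v,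
      L1 (fun w => Y w ^+ 4) /\ \int[P]_w (Y w ^+ 4) = 3 * v ^+ 2,
      L1 (fun w => Y w ^+ 6) /\ \int[P]_w (Y w ^+ 6) = 15 * v ^+ 3 &
      L1 (fun w => Y w ^+ 8) /\ \int[P]_w (Y w ^+ 8) = 105 * v ^+ 4].

Definition qform n (c : nat -> nat -> R) (g : nat -> R) :=
  \sum_(i < n) \sum_(j < n) c i j * (g i * g j).

Lemma qformE n c g : (forall i j, c i j = c j i) ->
  qform n c g - \sum_(i < n) c i i =
  diag_chaos n (fun i => c i i) g + 2 * tri_chaos n c g.
Proof.
move=> cC; rewrite /qform /diag_chaos /tri_chaos.
elim: n => [|n IH]; first by rewrite !big_ord0; ring.
rewrite big_ord_recr/=; under eq_bigr do rewrite big_ord_recr/=.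
rewrite big_split/= big_ord_recr/= [X in _ - X]big_ord_recr/=.
rewrite [X in _ = X + _]big_ord_recr/= [X in _ = _ + 2 * X]big_ord_recr/=.
have -> : \sum_(i < n) c i n * (g i * g n) = g n * lin n (c n) g.
  by rewrite /lin mulr_sumr; apply: eq_bigr => i _; rewrite (cC i n); ring.
have -> : \sum_(i < n) c n i * (g n * g i) = g n * lin n (c n) g.
  by rewrite /lin mulr_sumr; apply: eq_bigr => i _; ring.
move: IH; set A := \sum_(i < n) \sum_(j < n) _; set B := \sum_(i < n) c i i.
set C := \sum_(i < n) c i i * _; set D := \sum_(i < n) _ => IH.
transitivity ((A - B) + (2 * (g n * lin n (c n) g) + c n n * (g n * g n) - c n n)).
  by ring.
by rewrite IH; ring.
Qed.

(** The duality: [(|X|^2 - t) ^ 4] is a combination of the powers [|X| ^ 2k],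
which are the averages over [g] of the even powers of [<g, X>] divided by
[(2k - 1)!!]; this is the integrand [F g].  Integrating over the probability
space first, the powers of [<g, X>] become those of the quadratic form [c] at
[g], up to the same factors, and the combination closes up to
[(qform n c g - t) ^ 4]. *)
Lemma gaussian_qform4 n (X : nat -> T -> R) (c : nat -> nat -> R) (M : R) :
  (forall i j, c i j = c j i) ->
  (forall i j, (j < i < n)%N -> `|c i j| <= M) ->
  (forall g, gaussian_moments (fun w => lin n (X^~ w) g) (qform n c g)) ->
  L1 (fun w => (\sum_(i < n) X i w ^+ 2 - \sum_(i < n) c i i) ^+ 4) /\
  \int[P]_w ((\sum_(i < n) X i w ^+ 2 - \sum_(i < n) c i i) ^+ 4) <=
    480 * (\sum_(i < n) c i i ^+ 2) ^+ 2 + 2304 * M ^+ 4 * n%:R ^+ 4.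
Proof.
move=> cC cM gX; set t := \sum_(i < n) c i i.
pose F (g : nat -> R) w := 105^-1 * lin n (X^~ w) g ^+ 8 +
  (- (4 * t / 15) * lin n (X^~ w) g ^+ 6 +
    (2 * t ^+ 2 * lin n (X^~ w) g ^+ 4 +
      (- (4 * t ^+ 3) * lin n (X^~ w) g ^+ 2 + t ^+ 4))).
have QF w : (\sum_(i < n) X i w ^+ 2 - t) ^+ 4 = dgauss n (F^~ w).
  rewrite !dgauss_lin dgauss_cst.
  have [-> -> -> ->] := dgauss_lin_moments n (X^~ w).
  by set s := \sum_(i < n) _; field.
have cst_int a : L1 (fun=> a) by exact: finite_measure_integrable_cst.
have IF g : L1 (F g).
  have [[? _] [? _] [? _] [? _]] := gX g.
  by do 4 apply: integrable_comb => //.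
have [I1 I2] := integral_dgauss n IF.
rewrite (funext QF : (fun w => _) = _); split; first exact: I1.
rewrite I2; under eq_dgauss => g.
  have [[J2 E2] [J4 E4] [J6 E6] [J8 E8]] := gX g.
  rewrite /F !Rintegral_comb; try by do ?apply: integrable_comb.
  rewrite E2 E4 E6 E8 Rintegral_cst// (_ : fine _ = 1); last first.
    by have /(congr1 (@fine R)) := @probability_setT _ _ _ P.
  rewrite mulr1.
  rewrite (_ : _ + _ = (qform n c g - t) ^+ 4); last by field.
  rewrite qformE//.
  over.
set dg := diag_chaos n _; set tr := tri_chaos n _.
apply: (@le_trans _ _ (dgauss n (fun g => 8 * dg g ^+ 4 + 128 * tr g ^+ 4))).
  apply: le_dgauss => g; set a := dg g; set b := tr g.
  (* (a + b') ^ 4 <= 8 (a ^ 4 + b' ^ 4) with b' = 2 b: the difference factors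
     through (a - b') ^ 2. *)
  rewrite -subr_ge0; have : 0 <= (a - 2 * b) ^+ 2 * (7 * a ^+ 2 + 10 * (a * (2 * b)) + 7 * (2 * b) ^+ 2).
    rewrite mulr_ge0 ?sqr_ge0//.
    rewrite (_ : _ + _ = 5 * (a + 2 * b) ^+ 2 + 2 * a ^+ 2 + 2 * (2 * b) ^+ 2); last by ring.
    by rewrite !addr_ge0// mulr_ge0 ?sqr_ge0.
  rewrite (_ : _ * _ = 8 * a ^+ 4 + 128 * b ^+ 4 - (a + 2 * b) ^+ 4); last by ring.
  by [].
rewrite dgaussD !dgaussZ.
have [_ _ h1] := dgauss_diag_chaos n (fun i => c i i).
have h2 := dgauss_tri_chaos cM.
rewrite -/dg in h1; rewrite -/tr in h2.
by lra.
Qed.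

End gaussian_quadratic_form.

(** * Derivatives of real functions *)

Section calculus.
Variable R : realType.
Implicit Types (F f : R -> R) (a b x : R).

Lemma is_derive_continuous F f x : is_derive x 1 F (f x) -> {for x, continuous F}.
Proof. by move=> h; apply: differentiable_continuous; apply/derivable1_diffP. Qed.

Lemma is_derive_oo_LRcontinuous F f a b :
  (forall x, is_derive x 1 F (f x)) -> derivable_oo_LRcontinuous F a b.
Proof.
move=> dF; have cF x : {for x, continuous F} := is_derive_continuous (dF x).
split.
- by move=> x _; apply: ex_derive.
- exact: cvg_at_right_filter (cF a).
- exact: cvg_at_left_filter (cF b).
Qed.

Lemma is_derive_exprn n x :
  is_derive x 1 (fun y : R => y ^+ n) (n%:R * x ^+ n.-1).
Proof.
have -> : (fun y : R => y ^+ n) = (id : R -> R) ^+ n.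
  by apply: funext => y; rewrite exprfctE.
apply: (is_derive_eq (is_deriveX n (is_derive_id x 1))).
by rewrite /GRing.scale/= mulr1.
Qed.

End calculus.

(** * Moments of the normal law *)

Section normal_moments.
Variables (R : realType) (s : R).
Hypothesis s0 : s != 0.
Local Notation mu := (@lebesgue_measure R).
Local Notation p := (normal_pdf 0 s).

(** The normal law is defined by its density; the passage from integrals against
the law to integrals against the density goes through the Radon-Nikodym
derivative, almost everywhere equal to the density. *)
Lemma integral_normal_prob (f : measurableTypeR R -> \bar R) :
  measurable_fun setT f -> (forall x, 0 <= f x)%E ->
  (\int[normal_prob 0 s]_x f x = \int[mu]_x (f x * (p x)%:E))%E.
Proof.
move=> mf f0.
have dom := normal_prob_dominates 0 s.
rewrite -(Radon_Nikodym_SigmaFinite.change_of_variables dom f0 measurableT mf).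
have mp : measurable_fun setT (fun x => (p x)%:E).
  by apply/measurable_EFinP; exact: measurable_normal_pdf.
have iRN := Radon_Nikodym_SigmaFinite.f_integrable dom.
apply: ge0_ae_eq_integral => //=.
- by apply: emeasurable_funM => //; exact: measurable_int iRN.
- exact: emeasurable_funM.
- by move=> x _; rewrite mule_ge0// Radon_Nikodym_SigmaFinite.f_ge0.
- by move=> x _; rewrite mule_ge0// lee_fin normal_pdf_ge0.
apply: ae_eqe_mul2l; apply: integral_ae_eq => // E _ mE.
by rewrite -Radon_Nikodym_SigmaFinite.f_integral.
Qed.

(** Gaussian integration by parts starts from this antiderivative of
[x * p x]. *)
Lemma is_derive_normal_pdf (x : R) :
  is_derive x 1 (fun x => - s ^+ 2 * p x) (x * p x).
Proof.
rewrite normal_pdfE// /normal_fun.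
set c := normal_peak s.
apply: is_derive_eq.
rewrite /GRing.scale/= !subr0.
by field.
Qed.

Lemma continuous_normal_term k : continuous (fun x : R => x ^+ k * p x).
Proof.
move=> x; apply: cvgM; first exact: exprn_continuous.
exact: continuous_normal_pdf.
Qed.

Lemma measurable_normal_term k : measurable_fun setT (fun x : R => (x ^+ k * p x)%:E).
Proof.
apply/measurable_EFinP; apply: measurable_funM; first exact: measurable_funX.
exact: measurable_normal_pdf.
Qed.

Lemma normal_term_even_ge0 k x : 0 <= x ^+ k.*2 * p x.
Proof. by rewrite mulr_ge0 ?normal_pdf_ge0// exprn_even_ge0// odd_double. Qed.

Let B (n : nat) : set R := `[- n.+1%:R, n.+1%:R].

Let I k (n : nat) := (\int[mu]_(x in B n) (x ^+ k.*2 * p x)%:E)%E.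

Let I_fin k n : I k n \is a fin_num.
Proof.
apply: integrable_fin_num; first exact: measurable_itv.
apply: (@continuous_compact_integrable _ (fun x => x ^+ k.*2 * p x)).
  exact: segment_compact.
by apply: continuous_subspaceT; exact: continuous_normal_term.
Qed.

Let I_cvg k : I k n @[n --> \oo] --> (\int[mu]_x (x ^+ k.*2 * p x)%:E)%E.
Proof.
have -> : [set: R] = \bigcup_n B n.
  apply/seteqP; split=> // x _.
  have [n xn] : exists n, `|x| < n%:R by exists (Num.bound `|x|); exact: archi_boundP.
  exists n => //=; rewrite /B/= in_itv/= -ler_norml (le_trans (ltW xn))// ler_nat.
  exact: leqnSn.
apply: ge0_nondecreasing_set_cvg_integral => //.
- apply/nondecreasing_seqP => n; rewrite subsetEset.
  move=> x; rewrite /B/= !in_itv/= -!ler_norml => /le_trans; apply.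
  by rewrite ler_nat.
- by move=> n; exact: measurable_itv.
- by move=> n; apply: measurable_funTS; exact: measurable_normal_term.
- by move=> n x _; rewrite lee_fin normal_term_even_ge0.
Qed.

(** Integration by parts over [[- (n + 1), n + 1]], keeping the boundary term. *)
Let I_rec k n : (I k.+1 n + (2 * s ^+ 2 * n.+1%:R ^+ k.*2.+1 * p n.+1%:R)%:E =
  ((k.*2.+1)%:R * s ^+ 2)%:E * I k n)%E.
Proof.
pose F (x : R) := x ^+ k.*2.+1.
pose f (x : R) := k.*2.+1%:R * x ^+ k.*2.
have dF (x : R) : is_derive x 1 F (f x).
  exact: is_derive_exprn.
have dG (y : R) := is_derive_normal_pdf y.
have cg : continuous (fun x : R => x * p x).
  by move=> x; exact: (@continuous_normal_term 1 x).
have cf : continuous f.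
  by move=> x; apply: cvgM; [exact: cvg_cst|exact: exprn_continuous].
have ab : - n.+1%:R < n.+1%:R :> R by rewrite -subr_gt0 opprK addr_gt0.
have := @integration_by_parts R F (fun x => - s ^+ 2 * p x) f
  (fun x => x * p x) _ _ ab (continuous_subspaceT cf)
  (is_derive_oo_LRcontinuous _ _ dF) (fun x _ => etrans (derive1E _ _) (@derive_val _ _ _ _ _ _ _ (dF x)))
  (continuous_subspaceT cg) (is_derive_oo_LRcontinuous _ _ dG)
  (fun x _ => etrans (derive1E _ _) (@derive_val _ _ _ _ _ _ _ (dG x))).
rewrite -/(B n).
have -> : (\int[mu]_(x in B n) (F x * (x * p x))%:E = I k.+1 n)%E.
  by rewrite /I; apply: eq_integral => x _; rewrite /F doubleS !exprS; congr EFin; ring.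
have -> : (\int[mu]_(x in B n) (f x * (- s ^+ 2 * p x))%:E =
    (- (k.*2.+1%:R * s ^+ 2))%:E * I k n)%E.
  rewrite -integralZl; [|exact: measurable_itv|]; last first.
    apply: (@continuous_compact_integrable _ (fun x => x ^+ k.*2 * p x)).
      exact: segment_compact.
    by apply: continuous_subspaceT; exact: continuous_normal_term.
  by apply: eq_integral => x _; rewrite /f -EFinM; congr EFin; ring.
rewrite -(fineK (I_fin k n)) -(fineK (I_fin k.+1 n)) -!EFinM -!EFinD => -[->].
have pN : p (- n.+1%:R) = p n.+1%:R.
  by rewrite normal_pdfE// /normal_fun !subr0 sqrrN.
have FN : F (- n.+1%:R) = - F n.+1%:R.
  by rewrite /F exprNn -signr_odd/= odd_double/= expr1 mulN1r.
by congr EFin; rewrite pN FN /F; ring.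
Qed.

(** The exponential beats any power: the series of [expR] bounds [(expR y)^-1] by
a multiple of [y ^ - (k + 1)]. *)
Let boundary_cvg0 k : (2 * s ^+ 2 * n.+1%:R ^+ k.*2.+1 * p n.+1%:R)%:E @[n --> \oo] --> 0%E.
Proof.
pose C := 2 * s ^+ 2 * normal_peak s * ((k.+1)`!%:R * (2 * s ^+ 2) ^+ k.+1).
apply/fine_cvgP; split; first exact: nearW.
apply: (@squeeze_cvgr _ _ _ _ (fun=> 0) (fun n => C * n.+1%:R^-1)); last 2 first.
- exact: cvg_cst.
- rewrite -[X in _ --> X](mulr0 C); apply: cvgMr; exact: cvg_harmonic.
apply: nearW => n /=.
have s2 : 0 < s ^+ 2 by rewrite exprn_even_gt0.
apply/andP; split.
  apply: mulr_ge0; last exact: normal_pdf_ge0.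
  by apply: mulr_ge0; [apply: mulr_ge0 => //; exact: ltW|exact: exprn_ge0].
set N : R := n.+1%:R; have N0 : 0 < N by rewrite ltr0n.
rewrite normal_pdfE// /normal_fun subr0 mulNr expRN.
set y := N ^+ 2 / _.
have y0 : 0 < y by rewrite divr_gt0 ?exprn_gt0// pmulrn_lgt0.
have yk : y ^+ k.+1 / (k.+1)`!%:R <= expR y.
  by rewrite (le_trans _ (expR_ge1Dxn k (ltW y0)))// lerDr.
have yk0 : 0 < y ^+ k.+1 / (k.+1)`!%:R by rewrite divr_gt0 ?exprn_gt0// ltr0n fact_gt0.
have key : (expR y)^-1 <= (k.+1)`!%:R * (2 * s ^+ 2) ^+ k.+1 * (N ^+ k.*2.+2)^-1.
  rewrite (le_trans (_ : _ <= (y ^+ k.+1 / (k.+1)`!%:R)^-1))//.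
    by rewrite lef_pV2 ?posrE ?expR_gt0.
  rewrite invf_div /y expr_div_n invf_div mulrA (mulr_natl (s ^+ 2)).
  by rewrite -exprM mulnC muln2 doubleS.
have c0 : 0 <= 2 * s ^+ 2 * N ^+ k.*2.+1 * normal_peak s.
  apply: mulr_ge0; last exact: normal_peak_ge0.
  by apply: mulr_ge0; [apply: mulr_ge0 => //; exact: ltW|exact/exprn_ge0/ltW].
rewrite mulrA (le_trans (ler_wpM2l c0 key))// /C [N ^+ k.*2.+2]exprS.
rewrite le_eqVlt; apply/orP; left; apply/eqP.
set q := _ ^+ k.+1; set r := N ^+ _; set t := _`!%:R; set m := normal_peak s.
by field; rewrite /r expf_neq0 gt_eqF.
Qed.

Lemma normal_moment_rec k :
  (\int[mu]_x (x ^+ k.*2 * p x)%:E < +oo)%E ->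
  (\int[mu]_x (x ^+ k.+1.*2 * p x)%:E =
  (k.*2.+1%:R * s ^+ 2)%:E * \int[mu]_x (x ^+ k.*2 * p x)%:E)%E.
Proof.
move=> fin.
have fink : (\int[mu]_x (x ^+ k.*2 * p x)%:E)%E \is a fin_num.
  rewrite ge0_fin_numE//; apply: integral_ge0 => x _.
  by rewrite lee_fin normal_term_even_ge0.
have h1 : (I k.+1 n + (2 * s ^+ 2 * n.+1%:R ^+ k.*2.+1 * p n.+1%:R)%:E)%E @[n --> \oo]
    --> (\int[mu]_x (x ^+ k.+1.*2 * p x)%:E + 0)%E.
  by apply: cvgeD; [rewrite fin_num_adde_defl|exact: I_cvg|exact: boundary_cvg0].
have h2 : ((k.*2.+1%:R * s ^+ 2)%:E * I k n)%E @[n --> \oo]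
    --> ((k.*2.+1%:R * s ^+ 2)%:E * \int[mu]_x (x ^+ k.*2 * p x)%:E)%E.
  by apply: cvgeZl => //; exact: I_cvg.
rewrite adde0 in h1.
rewrite (funext (I_rec k) : (fun n => _) = _) in h1.
by apply: cvg_unique h1 h2.
Qed.

Lemma normal_moments :
  [/\ (\int[normal_prob 0 s]_x (x ^+ 2)%:E = (s ^+ 2)%:E)%E,
   (\int[normal_prob 0 s]_x (x ^+ 4)%:E = (3 * (s ^+ 2) ^+ 2)%:E)%E,
   (\int[normal_prob 0 s]_x (x ^+ 6)%:E = (15 * (s ^+ 2) ^+ 3)%:E)%E &
   (\int[normal_prob 0 s]_x (x ^+ 8)%:E = (105 * (s ^+ 2) ^+ 4)%:E)%E].
Proof.
have E k : (\int[normal_prob 0 s]_x (x ^+ k.*2)%:E = \int[mu]_x (x ^+ k.*2 * p x)%:E)%E.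
  rewrite integral_normal_prob; first by under eq_integral do rewrite -EFinM.
    by apply/measurable_EFinP; exact: measurable_funX.
  by move=> x; rewrite lee_fin exprn_even_ge0// odd_double.
have M0 : (\int[mu]_x (x ^+ 0.*2 * p x)%:E)%E = 1%E.
  by under eq_integral do rewrite expr0 mul1r; rewrite integral_normal_pdf.
have M1 := @normal_moment_rec 0; rewrite M0 ltry in M1.
have {}M1 := M1 isT; rewrite mule1 in M1.
have M2 := @normal_moment_rec 1; rewrite M1 ltry -EFinM in M2.
have {}M2 := M2 isT.
have M3 := @normal_moment_rec 2; rewrite M2 ltry -EFinM in M3.
have {}M3 := M3 isT.
have M4 := @normal_moment_rec 3; rewrite M3 ltry -EFinM in M4.
have {}M4 := M4 isT.
have [E1 E2 E3 E4] : [/\ _, _, _ & _] := And4 (E 1) (E 2) (E 3) (E 4).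
rewrite M1 in E1; rewrite M2 in E2; rewrite M3 in E3; rewrite M4 in E4.
split; [rewrite [LHS]E1|rewrite [LHS]E2|rewrite [LHS]E3|rewrite [LHS]E4];
  rewrite /double/=;
  by congr EFin; ring.
Qed.

End normal_moments.

(** * Moments of centered Gaussian variables *)

Section gaussian_variables.
Context d (T : measurableType d) (R : realType) (P : probability T R).
Local Notation L1 f := (P.-integrable [set: T] (EFin \o f)).

Lemma ge0_integrable_fin d' (S : measurableType d') (mu : {measure set S -> \bar R})
    (D : set S) (f : S -> R) (r : R) :
  measurable D -> measurable_fun D f -> (forall w, D w -> 0 <= f w) ->
  (\int[mu]_(w in D) (f w)%:E = r%:E)%E ->
  mu.-integrable D (EFin \o f) /\ \int[mu]_(w in D) f w = r.
Proof.
move=> mD mf f0 fr; split; last by rewrite /Rintegral fr.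
apply/integrableP; split; first exact/measurable_EFinP.
under eq_integral => w /[!inE] Dw do rewrite /= ger0_norm ?f0//.
by rewrite fr ltry.
Qed.

(** The law is given by its values on sets, so the moments come from the
push-forward formula; the degenerate case has all moments 0. *)
Lemma centered_gaussian_moments (Y : T -> R) : centered_gaussian P Y ->
  gaussian_moments P Y (\int[P]_w (Y w ^+ 2)).
Proof.
move=> [mY [Y0|[s s0 YN]]].
  have E k : (\int[P]_w (Y w ^+ k.+1)%:E = 0%:E)%E.
    rewrite (ae_eq_integral (cst 0%E))//=; first by rewrite integral0.
    - by apply/measurable_EFinP; exact: measurable_funX.
    - by apply: filterS Y0 => w /= -> _; rewrite expr0n.
  have H k : ~~ odd k.+1 -> L1 (fun w => Y w ^+ k.+1) /\ \int[P]_w (Y w ^+ k.+1) = 0.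
    move=> ko; apply: ge0_integrable_fin => //; first exact: measurable_funX.
    by move=> w _; rewrite exprn_even_ge0.
  have [H2 E2] := H 1 isT; rewrite E2.
  have [H4 E4] := H 3 isT; have [H6 E6] := H 5 isT; have [H8 E8] := H 7 isT.
  by split; split => //; rewrite ?E4 ?E6 ?E8; ring.
have E k : ~~ odd k -> (\int[P]_w (Y w ^+ k)%:E = \int[normal_prob 0 s]_x (x ^+ k)%:E)%E.
  move=> ko.
  pose Y' : T -> measurableTypeR R := Y.
  have mY' : measurable_fun setT Y' by exact: mY.
  have me : measurable_fun setT (fun x : measurableTypeR R => (x ^+ k)%:E).
    by apply/measurable_EFinP; exact: measurable_funX.
  rewrite -[LHS](@ge0_integral_pushforward _ _ _ (measurableTypeR R) R Y' mY' P setT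
    (fun x => (x ^+ k)%:E) measurableT me); last first.
    by move=> x _; rewrite lee_fin exprn_even_ge0.
  by apply: eq_measure_integral => A mA _; exact: YN.
have [N2 N4 N6 N8] := normal_moments s0.
have H k r : ~~ odd k -> (\int[normal_prob 0 s]_x (x ^+ k)%:E = r%:E)%E ->
   L1 (fun w => Y w ^+ k) /\ \int[P]_w (Y w ^+ k) = r.
  move=> ko Nr; apply: ge0_integrable_fin => //; first exact: measurable_funX.
    by move=> w _; rewrite exprn_even_ge0.
  by rewrite E.
have [H2 E2] := H 2 _ isT N2; rewrite E2.
by split; [split|exact: H 4 _ isT N4|exact: H 6 _ isT N6|exact: H 8 _ isT N8].
Qed.

End gaussian_variables.

(** * Square integrable functions *)

Section square_integrable.
Context d (T : measurableType d) (R : realType) (mu : {measure set T -> \bar R}).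
Variable D : set T.
Hypothesis mD : measurable D.

Lemma integrable_sqr_mul (f g : T -> R) :
  measurable_fun D f -> measurable_fun D g ->
  mu.-integrable D (EFin \o (fun x => f x ^+ 2)) ->
  mu.-integrable D (EFin \o (fun x => g x ^+ 2)) ->
  mu.-integrable D (EFin \o (fun x => f x * g x)).
Proof.
move=> mf mg f2 g2; have fg2 := integrable_comb 1 mD f2 g2.
apply: (le_integrable mD _ _ fg2).
  by apply/measurable_EFinP; exact: measurable_funM.
move=> x _; rewrite /= lee_fin mul1r [leRHS]ger0_norm ?addr_ge0 ?sqr_ge0//.
rewrite normrM -(real_normK (num_real (f x))) -(real_normK (num_real (g x))).
by have := sqr_ge0 (`|f x| - `|g x|); have := normr_ge0 (f x); have := normr_ge0 (g x); nra.
Qed.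

Lemma integrable_sqr_comb (f g : T -> R) a :
  measurable_fun D f -> measurable_fun D g ->
  mu.-integrable D (EFin \o (fun x => f x ^+ 2)) ->
  mu.-integrable D (EFin \o (fun x => g x ^+ 2)) ->
  mu.-integrable D (EFin \o (fun x => (a * f x + g x) ^+ 2)).
Proof.
move=> mf mg f2 g2; have fg := integrable_sqr_mul mf mg f2 g2.
have -> : (fun x => (a * f x + g x) ^+ 2) =
    (fun x => a ^+ 2 * f x ^+ 2 + (2 * a * (f x * g x) + g x ^+ 2)).
  by apply: funext => x; ring.
by do 2 apply: integrable_comb => //.
Qed.

End square_integrable.

(** * The isometry of white noise on step functions *)

Section isometry.
Context d (Omega : measurableType d) (R : realType) (P : probability Omega R).
Variables (W : set (plane R) -> Omega -> R) (D : set (plane R)).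
Hypotheses (mD : measurable D) (D_fin : (lambda2 R D < +oo)%E).
Hypothesis W_noise : white_noise P D W.
Local Notation L1 f := (P.-integrable [set: Omega] (EFin \o f)).

Lemma step_integral_gaussian l : step_on D l ->
  gaussian_moments P (step_integral W l) (\int[P]_w (step_integral W l w ^+ 2)).
Proof. by move=> /W_noise.1 /centered_gaussian_moments. Qed.

Lemma step_integral_measurable l : step_on D l ->
  measurable_fun setT (step_integral W l).
Proof. by move=> /W_noise.1 []. Qed.

Lemma step_integral_sqr l : step_on D l -> L1 (fun w => step_integral W l w ^+ 2).
Proof. by move=> /step_integral_gaussian [[]]. Qed.

Lemma step_on_cons c l : step_on D (c :: l) ->
  [/\ measurable c.2, c.2 `<=` D & step_on D l].
Proof.
move=> h; have [m s] := h c (mem_head _ _); split=> // c' c'l.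
by apply: h; rewrite inE c'l orbT.
Qed.

Lemma step_integral_cons c l w :
  step_integral W (c :: l) w = c.1 * W c.2 w + step_integral W l w.
Proof. by rewrite /step_integral big_cons. Qed.

Lemma step_fun_cons c (l : seq (R * set (plane R))) z :
  step_fun (c :: l) z = c.1 * \1_(c.2) z + step_fun l z.
Proof. by rewrite /step_fun big_cons. Qed.

Lemma noise_step A : measurable A -> A `<=` D -> step_on D [:: (1, A)].
Proof. by move=> mA AD c; rewrite inE => /eqP ->. Qed.

Lemma noise_L2 A : measurable A -> A `<=` D ->
  measurable_fun setT (W A) /\ L1 (fun w => W A w ^+ 2).
Proof.
move=> mA AD; have h := noise_step mA AD.
have -> : W A = step_integral W [:: (1, A)].
  by apply: funext => w; rewrite /step_integral big_seq1 mul1r.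
by split; [exact: step_integral_measurable|exact: step_integral_sqr].
Qed.

Lemma step_fun_measurable l : step_on D l -> measurable_fun setT (step_fun l).
Proof.
elim: l => [|c l IH] h.
  have -> : step_fun [::] = cst 0 :> (plane R -> R).
    by apply: funext => z; rewrite /step_fun big_nil.
  exact: measurable_cst.
have [mc _ /IH ml] := step_on_cons h.
rewrite (funext (step_fun_cons c l)).
by apply: measurable_funD => //; apply: measurable_funM => //; exact: measurable_indic.
Qed.

Let mu := lambda2 R.

Lemma indic_L2 A : measurable A -> A `<=` D ->
  mu.-integrable D (EFin \o (fun z => \1_A z ^+ 2)).
Proof.
move=> mA AD.
have -> : (fun z => \1_A z ^+ 2) = \1_A :> (plane R -> R).
  by apply: funext => z; rewrite indicE; case: (_ \in _); rewrite ?expr1n ?expr0n.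
apply/integrableP; split.
  by apply/measurable_EFinP; apply: measurable_funTS; exact: measurable_indic.
under eq_integral do rewrite /= ger0_norm//.
rewrite integral_indic// (le_lt_trans _ D_fin)// le_measure ?inE//.
exact: measurableI.
Qed.

Lemma step_fun_L2 l : step_on D l ->
  mu.-integrable D (EFin \o (fun z => step_fun l z ^+ 2)).
Proof.
elim: l => [|c l IH] h.
  have -> : (fun z => step_fun [::] z ^+ 2) = cst 0 :> (plane R -> R).
    by apply: funext => z; rewrite /step_fun big_nil expr0n.
  exact: integrable0.
have [mc cD lD] := step_on_cons h.
have -> : (fun z => step_fun (c :: l) z ^+ 2) = (fun z => (c.1 * \1_(c.2) z + step_fun l z) ^+ 2).
  by apply: funext => z; rewrite step_fun_cons.
apply: integrable_sqr_comb => //.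
- by apply: measurable_funTS; exact: step_fun_measurable.
- exact: indic_L2.
- exact: IH.
Qed.

(** The isometry on indicators is the covariance of the noise; it extends to
step functions by bilinearity, one argument at a time. *)
Lemma noise_cov A B : measurable A -> A `<=` D -> measurable B -> B `<=` D ->
  \int[P]_w (W A w * W B w) = \int[mu]_(z in D) (\1_A z * \1_B z).
Proof.
move=> mA AD mB BD; rewrite /Rintegral.
have -> : (\int[P]_w (W A w * W B w)%:E = mu (A `&` B))%E.
  rewrite /mu -(W_noise.2 A B mA AD mB BD) expectation.unlock.
  by apply: eq_integral.
congr fine; transitivity (\int[mu]_(z in D) (\1_(A `&` B) z)%:E)%E.
  rewrite integral_indic; [|exact: mD|exact: measurableI].
  by rewrite (setIidl (_ : A `&` B `<=` D))// => z [/AD].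
by apply: eq_integral => z _; rewrite indicI.
Qed.

Lemma noise_step_cov A l : measurable A -> A `<=` D -> step_on D l ->
  \int[P]_w (W A w * step_integral W l w) = \int[mu]_(z in D) (\1_A z * step_fun l z).
Proof.
move=> mA AD; have [mWA WA2] := noise_L2 mA AD.
elim: l => [|c l IH] h.
  under eq_Rintegral do rewrite /step_integral big_nil mulr0.
  under [RHS]eq_Rintegral do rewrite /step_fun big_nil mulr0.
  by rewrite !Rintegral_cst// !mul0r.
have [mc cD lD] := step_on_cons h.
have [mWc Wc2] := noise_L2 mc cD.
under eq_Rintegral do rewrite step_integral_cons mulrDr mulrCA.
under [RHS]eq_Rintegral do rewrite step_fun_cons mulrDr mulrCA.
rewrite !Rintegral_comb//.
- by rewrite IH// noise_cov.
- by apply: integrable_sqr_mul => //; exact: indic_L2.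
- apply: integrable_sqr_mul => //; [|exact: indic_L2|exact: step_fun_L2].
  by apply: measurable_funTS; exact: step_fun_measurable.
- exact: integrable_sqr_mul.
- by apply: integrable_sqr_mul => //; [exact: step_integral_measurable|exact: step_integral_sqr].
Qed.

Lemma step_isometry l l' : step_on D l -> step_on D l' ->
  \int[P]_w (step_integral W l w * step_integral W l' w) =
  \int[mu]_(z in D) (step_fun l z * step_fun l' z).
Proof.
move=> + l'D; elim: l => [|c l IH] h.
  under eq_Rintegral do rewrite /step_integral big_nil mul0r.
  under [RHS]eq_Rintegral do rewrite /step_fun big_nil mul0r.
  by rewrite !Rintegral_cst// !mul0r.
have [mc cD lD] := step_on_cons h.
have [mWc Wc2] := noise_L2 mc cD.
under eq_Rintegral do rewrite step_integral_cons mulrDl -mulrA.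
under [RHS]eq_Rintegral do rewrite step_fun_cons mulrDl -mulrA.
have ms k : step_on D k -> measurable_fun D (step_fun k).
  by move=> kD; apply: measurable_funTS; exact: step_fun_measurable.
rewrite !Rintegral_comb//.
- by rewrite IH// noise_step_cov.
- apply: integrable_sqr_mul => //; [exact: ms|exact: indic_L2|exact: step_fun_L2].
- apply: integrable_sqr_mul => //; [exact: ms|exact: ms|exact: step_fun_L2|exact: step_fun_L2].
- by apply: integrable_sqr_mul => //; [exact: step_integral_measurable|exact: step_integral_sqr].
- by apply: integrable_sqr_mul => //; [exact: step_integral_measurable|exact: step_integral_measurable|exact: step_integral_sqr|exact: step_integral_sqr].
Qed.

End isometry.

(** * Sums over the integers *)

Section esum_int.
Variable R : realType.

(** Enumerates the integers as 0, -1, 1, -2, 2, ..., to read sums over the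
integers as series. *)
Definition int_enum (n : nat) : int := if odd n then Negz n./2 else Posz n./2.

Definition int_index (z : int) : nat :=
  match z with Posz m => m.*2 | Negz m => m.*2.+1 end.

Lemma int_enumK : cancel int_enum int_index.
Proof.
move=> n; rewrite /int_enum /int_index -[RHS]odd_double_half.
by case: (odd n).
Qed.

Lemma int_indexK : cancel int_index int_enum.
Proof.
by case=> m; rewrite /int_enum /int_index /= ?odd_double/= ?doubleK ?uphalf_double.
Qed.

Lemma esum_int (a : int -> \bar R) : (forall k, 0 <= a k)%E ->
  (\esum_(k in [set: int]) a k = \sum_(n <oo) a (int_enum n))%E.
Proof.
move=> a0; rewrite nneseries_esumT; last by move=> n; exact: a0.
apply: reindex_esum; split => //.
- by move=> x y _ _; exact: (can_inj int_enumK).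
- by move=> z _; exists (int_index z) => //; exact: int_indexK.
Qed.

Lemma esum_int_shift (a : int -> \bar R) (h h' : int -> int) :
  cancel h h' -> cancel h' h ->
  (\esum_(k in [set: int]) a k = \esum_(k in [set: int]) a (h k))%E.
Proof.
move=> hK h'K; apply: reindex_esum; split => //.
- by move=> x y _ _; exact: (can_inj hK).
- by move=> z _; exists (h' z).
Qed.

Lemma esum_swap (a : int -> int -> \bar R) : (forall k l, 0 <= a k l)%E ->
  (\esum_(k in [set: int]) \esum_(l in [set: int]) a k l =
   \esum_(l in [set: int]) \esum_(k in [set: int]) a k l)%E.
Proof.
move=> a0; rewrite !esum_esum//.
apply: (reindex_esum _ _ (fun p : int * int => (p.2, p.1))); split => //.
- by move=> [x y] [x' y'] _ _ /= [-> ->].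
- by move=> [x y] _; exists (y, x).
Qed.

Lemma esumZ_int (a : int -> \bar R) (r : R) : (forall k, 0 <= a k)%E -> 0 <= r ->
  (\esum_(k in [set: int]) (r%:E * a k) = r%:E * \esum_(k in [set: int]) a k)%E.
Proof.
move=> a0 r0; rewrite !esum_int//; last by move=> k; rewrite mule_ge0.
by rewrite nneseriesZl.
Qed.

Lemma integral_esum_int d (T : measurableType d) (mu : {measure set T -> \bar R})
    (D : set T) (f : int -> T -> \bar R) : measurable D ->
  (forall k, measurable_fun D (f k)) -> (forall k x, 0 <= f k x)%E ->
  (\int[mu]_(x in D) (\esum_(k in [set: int]) f k x) =
   \esum_(k in [set: int]) \int[mu]_(x in D) f k x)%E.
Proof.
move=> mD mf f0; rewrite esum_int; last by move=> k; exact: integral_ge0.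
under eq_integral do rewrite esum_int//.
by rewrite integral_nneseries.
Qed.

Lemma measurable_esum_int d (T : measurableType d) (D : set T)
   (f : int -> T -> \bar R) :
  (forall k, measurable_fun D (f k)) -> (forall k x, 0 <= f k x)%E ->
  measurable_fun D (fun x => \esum_(k in [set: int]) f k x)%E.
Proof.
move=> mf f0; under eq_fun do rewrite esum_int//.
apply: ge0_emeasurable_sum => //.
Qed.

(** Together with a shift of each unit interval, this unfolds an integral over
the torus of a periodised function into an integral over the line. *)
Lemma integral_unit_intervals (f : R -> \bar R) :
  measurable_fun [set: measurableTypeR R] f -> (forall x, 0 <= f x)%E ->
  (\int[@lebesgue_measure R]_x f x =
   \esum_(k in [set: int]) \int[@lebesgue_measure R]_(x in `[k%:~R, (k + 1)%:~R[%classic) f x)%E.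
Proof.
move=> mf f0; rewrite esum_int; last by move=> k; exact: integral_ge0.
have UT : \bigcup_n `[(int_enum n)%:~R, (int_enum n + 1)%:~R[%classic = [set: R].
  apply/seteqP; split=> // x _; exists (int_index (Num.floor x)) => //=.
  rewrite int_indexK in_itv/=.
  by rewrite floor_le floorD1_gt.
rewrite -UT ge0_integral_bigcup//.
- by rewrite UT.
- apply/trivIsetP => i j _ _ ij; apply/seteqP; split=> // x /=.
  rewrite !in_itv/= => -[/andP[a b] /andP[c e]].
  move/eqP: ij; apply; apply: (can_inj int_enumK).
  have h1 : (int_enum i < int_enum j + 1)%R by rewrite -(ltr_int R); exact: le_lt_trans a e.
  have h2 : (int_enum j < int_enum i + 1)%R by rewrite -(ltr_int R); exact: le_lt_trans c b.
  by apply/eqP; rewrite eq_le -!ltzD1 h1 h2.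
Qed.

End esum_int.

(** * The Gauss kernel on the line *)

Section gauss_kernel.
Variable R : realType.
Implicit Types (tau x y a b : R).
Local Notation mu := (@lebesgue_measure R).

Definition gauss_kernel tau x : R :=
  (Num.sqrt (4 * pi * tau))^-1 * expR (- x ^+ 2 / (4 * tau)).

Definition heat_sum tau x : \bar R :=
  \esum_(k in [set: int]) (gauss_kernel tau (x - k%:~R))%:E.

Lemma gauss_kernel_ge0 tau x : 0 <= gauss_kernel tau x.
Proof. by rewrite mulr_ge0// ?invr_ge0 ?expR_ge0. Qed.

Lemma continuous_gauss_kernel tau : continuous (gauss_kernel tau).
Proof.
move=> x; apply: cvgM; first exact: cvg_cst.
apply: (cvg_comp _ expR); last exact: continuous_expR.
apply: cvgM; last exact: cvg_cst.
by apply: (@cvgN _ R^o); exact: exprn_continuous.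
Qed.

(** Completing the square: the product is a normal density in [y], centered at
the midpoint, up to a factor independent of [y]. *)
Lemma gauss_kernel_mul tau a b y : 0 < tau ->
  gauss_kernel tau (a - y) * gauss_kernel tau (b - y) =
  gauss_kernel (2 * tau) (a - b) * normal_pdf ((a + b) / 2) (Num.sqrt tau) y.
Proof.
move=> t0; have s0 : Num.sqrt tau != 0 by rewrite gt_eqF// sqrtr_gt0.
rewrite normal_pdfE// /normal_peak /normal_fun /gauss_kernel sqr_sqrtr ?ltW//.
rewrite mulrACA [RHS]mulrACA -!expRD -!invfM; congr (_^-1 * expR _).
  rewrite -expr2 sqr_sqrtr ?mulr_ge0 ?pi_ge0 ?ltW// -sqrtrM; last first.
    by rewrite !mulr_ge0 ?pi_ge0// ltW.
  rewrite (_ : 4 * pi * (2 * tau) * (tau * pi *+ 2) = (4 * pi * tau) ^+ 2); last by ring.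
  by rewrite sqrtr_sqr ger0_norm// !mulr_ge0 ?pi_ge0// ltW.
by field; rewrite gt_eqF.
Qed.

Lemma gauss_kernel_convolution tau a b : 0 < tau ->
  (\int[mu]_y (gauss_kernel tau (a - y) * gauss_kernel tau (b - y))%:E =
   (gauss_kernel (2 * tau) (a - b))%:E)%E.
Proof.
move=> t0; under eq_integral do rewrite gauss_kernel_mul// EFinM.
rewrite integralZl//; last exact: integrable_normal_pdf.
by rewrite integral_normal_pdf mule1.
Qed.

Lemma absz_int_enum n : n%:R / 2 <= `|(int_enum n)%:~R| :> R.
Proof.
rewrite -intr_norm -abszE -pmulrn /int_enum -{1}(odd_double_half n).
set m := n./2; rewrite natrD -muln2 natrM.
case: (odd n) => /=; first by rewrite -[m.+1]addn1 natrD; lra.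
by lra.
Qed.

(** A geometric bound suffices for summability, so the quadratic exponent is
simply bounded below by a linear one. *)
Lemma gauss_kernel_le tau x n : 0 < tau -> `|x| <= 2 ->
  gauss_kernel tau (x - (int_enum n)%:~R) <=
  (Num.sqrt (4 * pi * tau))^-1 * expR tau^-1 * expR (- (16 * tau)^-1) ^+ n.
Proof.
move=> t0 x2; rewrite /gauss_kernel -[leRHS]mulrA ler_wpM2l ?invr_ge0//.
rewrite -expRM_natl -expRD ler_expR.
set k : R := (int_enum n)%:~R.
have k1 : `|k| <= k ^+ 2.
  rewrite /k -rmorphXn/= -intr_norm ler_int.
  rewrite -[leRHS]ger0_norm ?sqr_ge0// normrX.
  by case: `|int_enum n| => -[|m] //; rewrite expr2 ler_peMr.
have kn := absz_int_enum n; rewrite -/k in kn.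
have x4 : x ^+ 2 <= 4.
  by rewrite -real_normK ?num_real//; have := normr_ge0 x; nra.
have h : n%:R / 4 - 4 <= (x - k) ^+ 2.
  by have := sqr_ge0 (2 * x - k); nra.
rewrite (_ : tau^-1 + _ = (4 - n%:R / 4) / (4 * tau)); last by field; rewrite gt_eqF.
by rewrite ler_wpM2r ?invr_ge0 ?mulr_ge0 ?(ltW t0)//; lra.
Qed.

(** A bound uniform in [x] for periodised functions dominated by a translate of
the Gauss kernel.  The translate may depend on [k]: below it is an
intermediate point of a mean value theorem.  Each term is below a geometric
sequence, since the exponent is at most linear in the index of [k]. *)
Lemma heat_sum_bound tau : 0 < tau ->
  exists2 C, 0 <= C & forall h : int -> R -> R,
  (forall x k, `|x| <= 1 -> exists y, `|y| <= 2 /\ 0 <= h k x <= gauss_kernel tau (y - k%:~R)) ->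
  forall x, `|x| <= 1 -> (\esum_(k in [set: int]) (h k x)%:E <= C%:E)%E.
Proof.
move=> t0.
set A := (Num.sqrt (4 * pi * tau))^-1 * expR tau^-1.
set q := expR (- (16 * tau)^-1).
have A0 : 0 <= A by rewrite mulr_ge0 ?invr_ge0 ?expR_ge0.
have q0 : 0 < q by exact: expR_gt0.
have q1 : q < 1 by rewrite expR_lt1 oppr_lt0 invr_gt0 mulr_gt0.
exists (A / (1 - q)); first by rewrite divr_ge0// subr_ge0 ltW.
move=> h hk x x1; rewrite esum_int; last first.
  by move=> k; have [y [_ /andP[h0 _]]] := hk x k x1; rewrite lee_fin.
apply: lime_le.
  apply: is_cvg_nneseries => n _ _.
  by have [y [_ /andP[h0 _]]] := hk x (int_enum n) x1; rewrite lee_fin.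
apply: nearW => n; rewrite sumEFin lee_fin.
apply: (@le_trans _ _ (series (geometric A q) n)).
  apply: ler_sum => i _.
  have [y [y2 /andP[_ /le_trans]]] := hk x (int_enum i) x1; apply.
  exact: gauss_kernel_le.
by apply: geometric_le_lim => //; rewrite gtr0_norm.
Qed.

Lemma heat_kernelE tau x : 0 < tau -> `|x| <= 1 ->
  (heat_kernel tau x)%:E = heat_sum tau x.
Proof.
move=> t0 x1; rewrite /heat_kernel fineK// ge0_fin_numE; last first.
  by apply: esum_ge0 => k _; rewrite lee_fin; exact: gauss_kernel_ge0.
have [C C0 hC] := heat_sum_bound t0.
rewrite (le_lt_trans (hC (fun k y => gauss_kernel tau (y - k%:~R)) _ x x1)) ?ltry//.
move=> y k y1; exists y; rewrite gauss_kernel_ge0 lexx; split => //.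
by rewrite (le_trans y1)// ler1n.
Qed.

Lemma integral_shift_unit (f : R -> R) (k : int) : continuous f -> (forall y, 0 <= f y) ->
  (\int[mu]_(y in `[0%R, 1%R[) (f (y + k%:~R))%:E =
   \int[mu]_(y in `[k%:~R, (k + 1)%:~R[%classic) (f y)%:E)%E.
Proof.
move=> cf f0.
have mf : measurable_fun [set: R] f by exact: continuous_measurable_fun.
have csh : continuous (fun y : R => f (y + k%:~R)).
  move=> y; apply: (cvg_comp (fun y : R => y + k%:~R) f); last exact: cf.
  by apply: cvgD; [exact: cvg_id|exact: cvg_cst].
have msh : measurable_fun [set: R] (fun y : R => f (y + k%:~R)).
  exact: continuous_measurable_fun.
rewrite integral_itv_bndo_bndc; last by apply/measurable_EFinP/measurable_funTS.
rewrite integral_itv_bndo_bndc; last by apply/measurable_EFinP/measurable_funTS.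
have dF (y : R) : is_derive y 1 (fun y : R => y + k%:~R) ((fun=> 1) y).
  by apply: is_derive_eq; rewrite addr0.
have dFE : (fun y : R => y + k%:~R)^`()%classic = cst 1.
  by apply: funext => y; rewrite derive1E; exact: derive_val.
have := @integration_by_substitution_increasing R (fun y => y + k%:~R) f 0 1 ler01.
rewrite add0r (addrC 1) intrD => ->.
- by apply: eq_integral => y _ /=; rewrite dFE/= mulr1.
- by move=> x y _ _; rewrite ltrD2r.
- by rewrite dFE => y _; exact: cvg_cst.
- by rewrite dFE; exact: is_cvg_cst.
- by rewrite dFE; exact: is_cvg_cst.
- exact: (is_derive_oo_LRcontinuous _ _ dF).
- exact: continuous_subspaceT.
Qed.

End gauss_kernel.

(** * The semigroup property on the torus *)

Section torus_semigroup.
Variable R : realType.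
Implicit Types (tau x y : R).
Local Notation mu := (@lebesgue_measure R).

Lemma torus_dist x y : torus R x -> torus R y -> `|x - y| <= 1.
Proof. by rewrite /torus/= !in_itv/= ler_norml => /andP[? ?] /andP[? ?]; apply/andP; split; lra. Qed.

Lemma measurable_torus : measurable (torus R).
Proof. exact: measurable_itv. Qed.

(** Setting the summation indices to [k] and [k - m] moves the shift by [k]
onto [y], which is what the unfolding needs. *)
Lemma heat_kernel_mulE tau x x' y : 0 < tau ->
  torus R x -> torus R x' -> torus R y ->
  (heat_kernel tau (x - y) * heat_kernel tau (x' - y))%:E =
  \esum_(m in [set: int]) \esum_(k in [set: int])
    (gauss_kernel tau (x - (y + k%:~R)) *
     gauss_kernel tau (x' + m%:~R - (y + k%:~R)))%:E.
Proof.
move=> t0 xT x'T yT.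
have g0 z : (0 <= (gauss_kernel tau z)%:E)%E by rewrite lee_fin gauss_kernel_ge0.
have p'0 : 0 <= heat_kernel tau (x' - y).
  by apply: fine_ge0; apply: esum_ge0 => k _; rewrite lee_fin; exact: gauss_kernel_ge0.
rewrite esum_swap; last by move=> k m; rewrite lee_fin mulr_ge0 ?gauss_kernel_ge0.
rewrite mulrC EFinM (heat_kernelE t0 (torus_dist xT yT)) -esumZ_int//.
apply: eq_esum => k _; rewrite muleC (heat_kernelE t0 (torus_dist x'T yT)).
rewrite -esumZ_int ?gauss_kernel_ge0//.
rewrite (@esum_int_shift R _ (fun m => k - m) (fun m => k - m)); last 2 first.
- by move=> m; rewrite subKr.
- by move=> m; rewrite subKr.
apply: eq_esum => m _; rewrite -EFinM; congr ((gauss_kernel _ _ * gauss_kernel _ _)%:E).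
  by ring.
by rewrite intrB; ring.
Qed.

Lemma torus_semigroup tau x x' : 0 < tau -> torus R x -> torus R x' ->
  (\int[mu]_(y in torus R) (heat_kernel tau (x - y) * heat_kernel tau (x' - y))%:E =
   heat_sum (2 * tau) (x - x'))%E.
Proof.
move=> t0 xT x'T.
pose f (m : int) (y : R) := gauss_kernel tau (x - y) * gauss_kernel tau (x' + m%:~R - y).
have f0 m y : 0 <= f m y by rewrite mulr_ge0 ?gauss_kernel_ge0.
have cg c : continuous (fun y : R => gauss_kernel tau (c - y)).
  move=> y; apply: (cvg_comp (fun y : R => c - y) (gauss_kernel tau)).
    by apply: cvgB; [exact: cvg_cst|exact: cvg_id].
  exact: continuous_gauss_kernel.
have cf m : continuous (f m) by move=> y; apply: cvgM; exact: cg.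
have mf m : measurable_fun [set: R] (f m) by exact: continuous_measurable_fun.
have mfs m k : measurable_fun (torus R) (fun y => (f m (y + k%:~R))%:E).
  have cs : continuous (fun y : R => f m (y + k%:~R)).
    move=> y; apply: (cvg_comp (fun y : R => y + k%:~R) (f m)); last exact: cf.
    by apply: cvgD; [exact: cvg_id|exact: cvg_cst].
  by apply/measurable_EFinP; apply: measurable_funTS; exact: continuous_measurable_fun.
transitivity (\int[mu]_(y in torus R) (\esum_(m in [set: int]) \esum_(k in [set: int])
    (f m (y + k%:~R))%:E))%E.
  by apply: eq_integral => y /[!inE] yT; exact: heat_kernel_mulE.
rewrite integral_esum_int; last 3 first.
- exact: measurable_torus.
- move=> m; apply: measurable_esum_int; first by move=> k; exact: mfs.
  by move=> k y; rewrite lee_fin.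
- by move=> m y; apply: esum_ge0 => k _; rewrite lee_fin.
rewrite /heat_sum; apply: eq_esum => m _.
rewrite integral_esum_int; last 3 first.
- exact: measurable_torus.
- by move=> k; exact: mfs.
- by move=> k y; rewrite lee_fin.
transitivity (\int[mu]_y (f m y)%:E)%E; last first.
  by rewrite gauss_kernel_convolution//; congr (gauss_kernel _ _)%:E; ring.
have mfm : measurable_fun [set: measurableTypeR R] (fun y => (f m y)%:E).
  by apply/measurable_EFinP; exact: mf.
rewrite (integral_unit_intervals mfm); last by move=> y; rewrite lee_fin.
by apply: eq_esum => k _; apply: integral_shift_unit.
Qed.

End torus_semigroup.

(** * The heat flow started from the positive part *)

Section heat_potential.
Variable R : realType.
Implicit Types (tau x y z h w : R).
Local Notation mu := (@lebesgue_measure R).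

Definition normal_cdf w : R := \int[mu]_(y in `]-oo, w]) normal_pdf 0 1 y.

Lemma normal_cdfE w : (normal_cdf w)%:E = normal_prob (0 : R) 1 `]-oo, w].
Proof.
rewrite /normal_cdf /Rintegral fineK//; apply: integrable_fin_num => //.
by apply: integrableS (integrable_normal_pdf 0 1).
Qed.

Lemma is_derive_normal_cdf w : is_derive w 1 normal_cdf (normal_pdf 0 1 w).
Proof.
have wu : w < w + 1 by rewrite ltrDl.
have int : mu.-integrable [set` Interval -oo%O (BRight (w + 1))] (EFin \o normal_pdf 0 1).
  by apply: integrableS (integrable_normal_pdf 0 1).
have [d e] := continuous_FTC1 wu int (ltNyr _) (@continuous_normal_pdf R 0 1 (oner_neq0 R) w).
by split; [exact: d|rewrite -derive1E; exact: e].
Qed.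

Let idTR : measurableTypeR R -> R := idfun.

#[local] HB.instance Definition _ :=
  @isMeasurableFun.Build _ _ _ _ idTR (@measurable_id _ _ setT).

Let normal_cdf_cdf w : (normal_cdf w)%:E = cdf (idTR : {RV (normal_prob (0:R) 1) >-> R}) w.
Proof. by rewrite normal_cdfE /cdf. Qed.

Lemma normal_cdf_cvgy (u : R ^nat) : u n @[n --> \oo] --> +oo%R ->
  normal_cdf (u n) @[n --> \oo] --> (1 : R).
Proof.
move=> uy; suff h : (normal_cdf (u n))%:E @[n --> \oo] --> 1%E by exact: (fine_cvg h).
rewrite (funext (fun n => normal_cdf_cdf (u n)) : (fun n => _) = _).
have := cvg_cdfy1 (idTR : {RV (normal_prob (0:R) 1) >-> R}).
by move/cvge_pinftyP => /(_ _ uy).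
Qed.

Lemma normal_cdf_cvgNy (u : R ^nat) : u n @[n --> \oo] --> +oo%R ->
  normal_cdf (- u n) @[n --> \oo] --> (0 : R).
Proof.
move=> uy; suff h : (normal_cdf (- u n))%:E @[n --> \oo] --> 0%E by exact: (fine_cvg h).
rewrite (funext (fun n => normal_cdf_cdf (- u n)) : (fun n => _) = _).
have := cvg_cdfNy0 (idTR : {RV (normal_prob (0:R) 1) >-> R}).
rewrite cvgNy_compNP => h.
exact: ((@cvge_pinftyP R (cdf (idTR : {RV (normal_prob (0:R) 1) >-> R}) \o -%R) 0%E).1 h _ uy).
Qed.

(** The expectation of the positive part of [z + sqrt (2 tau) N], with [N]
standard normal.  It solves the heat equation with initial value [z+], whose
second derivative is a Dirac mass: its second space derivative and its time
derivative are both the Gauss kernel. *)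
Definition heat_potential tau z : R :=
  z * normal_cdf (z / Num.sqrt (2 * tau)) +
  Num.sqrt tau / Num.sqrt pi * expR (- z ^+ 2 / (4 * tau)).

Let normal_pdf_gauss tau z : 0 < tau ->
  normal_pdf 0 1 (z / Num.sqrt (2 * tau)) =
  Num.sqrt (2 * tau) * gauss_kernel tau z.
Proof.
move=> t0; rewrite normal_pdfE ?oner_neq0// /normal_peak /normal_fun /gauss_kernel.
rewrite mulrA; congr (_ * expR _).
  rewrite expr1n mul1r (_ : 4 * pi * tau = (2 * tau) * (pi *+ 2)); last by ring.
  have t2 : 0 < 2 * tau by rewrite mulr_gt0.
  by rewrite (sqrtrM _ (ltW t2)) invfM mulVKf// gt_eqF// sqrtr_gt0.
rewrite subr0 expr_div_n sqr_sqrtr ?mulr_ge0 ?ltW// expr1n.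
by field; rewrite gt_eqF.
Qed.

Lemma is_derive_heat_potential_cdf tau z : 0 < tau ->
  is_derive z 1 (fun z => normal_cdf (z / Num.sqrt (2 * tau))) (gauss_kernel tau z).
Proof.
move=> t0; have s0 : Num.sqrt (2 * tau) != 0 by rewrite gt_eqF// sqrtr_gt0 mulr_gt0.
have d1 := is_derive_normal_cdf (z / Num.sqrt (2 * tau)).
have d2 : is_derive z 1 (fun z : R => z / Num.sqrt (2 * tau)) (Num.sqrt (2 * tau))^-1.
  by apply: is_derive_eq; rewrite /GRing.scale/= !mulr0 add0r mulr1.
have d := @is_derive1_comp _ normal_cdf (fun z : R => z / Num.sqrt (2 * tau)) z _ _ d1 d2.
suff <- : normal_pdf 0 1 (z / Num.sqrt (2 * tau)) * (Num.sqrt (2 * tau))^-1 =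
  gauss_kernel tau z by exact: d.
by rewrite normal_pdf_gauss// mulrAC divff// mul1r.
Qed.

Let expR_gauss tau z : 0 < tau ->
  Num.sqrt tau / Num.sqrt pi * expR (- z ^+ 2 / (4 * tau)) =
  2 * tau * gauss_kernel tau z.
Proof.
move=> t0; rewrite /gauss_kernel mulrA; congr (_ * _).
have sp : Num.sqrt pi != 0 :> R by rewrite gt_eqF// sqrtr_gt0 pi_gt0.
have st : Num.sqrt tau != 0 by rewrite gt_eqF// sqrtr_gt0.
rewrite (_ : 4 * pi * tau = 2 ^+ 2 * (pi * tau)); last by ring.
rewrite sqrtrM ?exprn_ge0// sqrtr_sqr ger0_norm// sqrtrM ?pi_ge0//.
by rewrite -{2}(sqr_sqrtr (ltW t0)); field; rewrite sp st.
Qed.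

Lemma is_derive_heat_potential tau z : 0 < tau ->
  is_derive z 1 (heat_potential tau) (normal_cdf (z / Num.sqrt (2 * tau))).
Proof.
move=> t0; have d := is_derive_heat_potential_cdf z t0.
have d2 : is_derive z 1 (fun z => expR (- z ^+ 2 / (4 * tau)))
    (- (2 * z / (4 * tau)) * expR (- z ^+ 2 / (4 * tau))).
  by apply: is_derive_eq; rewrite /GRing.scale/=; ring.
apply: is_derive_eq; rewrite /GRing.scale/=.
have := expR_gauss z t0; set e := expR _ => e1.
rewrite (_ : Num.sqrt tau / Num.sqrt pi * (- (2 * z / (4 * tau)) * e) =
   - (2 * z / (4 * tau)) * (Num.sqrt tau / Num.sqrt pi * e)); last by ring.
by rewrite e1; field; rewrite gt_eqF.
Qed.

Lemma is_derive_time_heat_potential tau z : 0 < tau ->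
  is_derive tau 1 (fun tau => heat_potential tau z) (gauss_kernel tau z).
Proof.
move=> t0.
have st0 : 0 < Num.sqrt tau by rewrite sqrtr_gt0.
have sp : Num.sqrt pi != 0 :> R by rewrite gt_eqF// sqrtr_gt0 pi_gt0.
have s0 : 0 < Num.sqrt (2 * tau) by rewrite sqrtr_gt0 mulr_gt0.
have dt := is_derive1_sqrt t0.
have d2t : is_derive tau 1 (fun tau : R => Num.sqrt (2 * tau)) (Num.sqrt (2 * tau))^-1.
  have d1 : is_derive tau 1 (fun tau : R => 2 * tau) 2.
    by apply: is_derive_eq; rewrite /GRing.scale/= mulr1.
  have t2 : 0 < 2 * tau by rewrite mulr_gt0.
  have d := @is_derive1_comp _ _ (fun tau : R => 2 * tau) tau _ _ (is_derive1_sqrt t2) d1.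
  suff <- : (2 * Num.sqrt (2 * tau))^-1 * 2 = (Num.sqrt (2 * tau))^-1 by exact: d.
  by rewrite invfM mulrAC mulVf ?mul1r.
have dq : is_derive tau 1 (fun tau : R => z / Num.sqrt (2 * tau))
   (- z / (2 * tau * Num.sqrt (2 * tau))).
  have dV := @is_deriveV _ (fun tau : R => Num.sqrt (2 * tau)) tau _ 1 (lt0r_neq0 s0) d2t.
  apply: is_derive_eq; rewrite /GRing.scale/= sqr_sqrtr ?mulr_ge0 ?ltW//.
  by field; rewrite !gt_eqF.
have dc : is_derive tau 1 (fun tau : R => normal_cdf (z / Num.sqrt (2 * tau)))
   (- z / (2 * tau) * gauss_kernel tau z).
  have d := @is_derive1_comp _ normal_cdf (fun tau : R => z / Num.sqrt (2 * tau)) tau _ _ (is_derive_normal_cdf _) dq.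
  suff <- : normal_pdf 0 1 (z / Num.sqrt (2 * tau)) * (- z / (2 * tau * Num.sqrt (2 * tau))) =
    - z / (2 * tau) * gauss_kernel tau z by exact: d.
  by rewrite normal_pdf_gauss//; field; rewrite !gt_eqF.
have t4 : 4 * tau != 0 by rewrite gt_eqF// mulr_gt0.
have d4 : is_derive tau 1 (fun tau : R => 4 * tau) 4.
  by apply: is_derive_eq; rewrite /GRing.scale/= mulr1.
have dV4 := @is_deriveV _ (fun tau : R => 4 * tau) tau _ 1 t4 d4.
have de : is_derive tau 1 (fun tau => expR (- z ^+ 2 / (4 * tau)))
    (z ^+ 2 / (4 * tau ^+ 2) * expR (- z ^+ 2 / (4 * tau))).
  by apply: is_derive_eq; rewrite /GRing.scale/=; field; rewrite gt_eqF.
apply: is_derive_eq; rewrite /GRing.scale/=.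
have := expR_gauss z t0; set e := expR _ => e1.
move: e1; set G := gauss_kernel tau z; set s := Num.sqrt tau; set p := Num.sqrt pi => e1.
have ts : tau = s ^+ 2 by rewrite sqr_sqrtr// ltW.
have s1 : s != 0 by rewrite gt_eqF.
have -> : e = 2 * s * G * p.
  transitivity (p / s * (s / p * e)); first by field; rewrite s1 sp.
  by rewrite e1 ts; field.
by rewrite ts mulr0; field; rewrite s1 sp.
Qed.

(** The initial condition, along the times [c / (n + 2) ^ 2], for which
[sqrt tau] is explicit. *)
Lemma heat_potential_cvg0 c z : 0 < c ->
  heat_potential (c / n.+2%:R ^+ 2) z @[n --> \oo] --> Num.max z 0.
Proof.
move=> c0.
have sE n : Num.sqrt (c / n.+2%:R ^+ 2) = Num.sqrt c / n.+2%:R.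
  by rewrite sqrtrM ?ltW// sqrtrV ?exprn_ge0// sqrtr_sqr ger0_norm.
have h0 : (Num.sqrt c / Num.sqrt pi / n.+2%:R) @[n --> \oo] --> (0 : R).
  rewrite -(mulr0 (Num.sqrt c / Num.sqrt pi)); apply: cvgMr.
  by have := @cvg_harmonic R; rewrite -(cvg_shiftS (@harmonic R)).
have h1 : (Num.sqrt (c / n.+2%:R ^+ 2) / Num.sqrt pi *
    expR (- z ^+ 2 / (4 * (c / n.+2%:R ^+ 2)))) @[n --> \oo] --> (0 : R).
  apply: squeeze_cvgr (cvg_cst 0) h0; apply: nearW => n.
  rewrite mulr_ge0 ?expR_ge0 ?mulr_ge0 ?invr_ge0 ?sqrtr_ge0//= sE [X in X * _]mulrAC.
  rewrite ler_piMr ?mulr_ge0 ?invr_ge0 ?sqrtr_ge0//.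
  rewrite -[leRHS]expR0 ler_expR mulNr oppr_le0 mulr_ge0 ?sqr_ge0// invr_ge0.
  by rewrite mulr_ge0// divr_ge0 ?(ltW c0)// exprn_ge0.
rewrite -[X in _ --> X]addr0; apply: cvgD; last exact: h1.
have uE n : z / Num.sqrt (2 * (c / n.+2%:R ^+ 2)) = z / Num.sqrt (2 * c) * n.+2%:R.
  rewrite mulrA sqrtrM ?mulr_ge0 ?(ltW c0)// sqrtrV ?exprn_ge0// sqrtr_sqr ger0_norm//.
  by rewrite invfM invrK mulrA.
under eq_fun do rewrite uE.
have s0 : 0 < Num.sqrt (2 * c) by rewrite sqrtr_gt0 mulr_gt0.
have lim a : 0 < a -> (a / Num.sqrt (2 * c) * n.+2%:R) @[n --> \oo] --> +oo%R.
  move=> a0; apply/cvgryPge => A.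
  have r0 : 0 < a / Num.sqrt (2 * c) by rewrite divr_gt0.
  exists (Num.truncn (A / (a / Num.sqrt (2 * c)))).+1 => // n /= nA.
  rewrite mulrC -ler_pdivrMr//.
  by rewrite (le_trans (ltW (truncnS_gt _)))// ler_nat (leq_trans nA)// !leqW.
case: (boolP (z < 0)) => z0.
  have <- : z * 0 = Num.max z 0 by rewrite mulr0 max_r// ltW.
  apply: cvgMr; have := @normal_cdf_cvgNy _ (lim (- z) _); rewrite oppr_gt0 => /(_ z0).
  by under eq_fun do rewrite mulNr mulNr opprK.
rewrite -leNgt in z0.
have <- : z * 1 = Num.max z 0 by rewrite mulr1 max_l.
move: z0; rewrite le_eqVlt => /predU1P[<-|z0].
  by rewrite mul0r; under eq_fun do rewrite mul0r; exact: cvg_cst.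
by apply: cvgMr; exact: normal_cdf_cvgy (lim _ z0).
Qed.

End heat_potential.

(** * Time integral of the Gauss kernel and second differences *)

Section time_integral.
Variable R : realType.
Implicit Types (tau x y z h w : R).
Local Notation mu := (@lebesgue_measure R).

Lemma continuous_time_gauss_kernel (k t z s : R) : 0 < k -> s < t ->
  {for s, continuous (fun s => gauss_kernel (k * (t - s)) z)}.
Proof.
move=> k0 st.
have p0 : 0 < k * (t - s) by rewrite mulr_gt0// subr_gt0.
have lin : is_derive s 1 (fun s : R => k * (t - s)) ((fun=> - k) s).
  by apply: is_derive_eq; rewrite /GRing.scale/=; ring.
apply: (@continuous_comp _ _ _ (fun s : R => k * (t - s)) (fun tau => gauss_kernel tau z)).
  exact: is_derive_continuous lin.
have q0 : 4 * pi * (k * (t - s)) > 0 by rewrite mulr_gt0// mulr_gt0// pi_gt0.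
apply: cvgM.
  apply: cvgV; first by rewrite gt_eqF// sqrtr_gt0.
  apply: (cvg_comp (fun x => 4 * pi * x) Num.sqrt); last exact: sqrt_continuous.
  by apply: cvgM; [exact: cvg_cst|exact: cvg_id].
apply: (cvg_comp _ expR); last exact: continuous_expR.
apply: cvgM; first exact: cvg_cst.
apply: cvgV; first by rewrite gt_eqF// mulr_gt0.
by apply: cvgM; [exact: cvg_cst|exact: cvg_id].
Qed.

Lemma measurable_time_gauss_kernel (k t z : R) : 0 < k ->
  measurable_fun `[0, t[ (fun s => gauss_kernel (k * (t - s)) z).
Proof.
move=> k0; apply: subspace_continuous_measurable_fun; first exact: measurable_itv.
apply: continuous_in_subspaceT => x; rewrite inE/= in_itv/= => /andP[_ xt].
exact: continuous_time_gauss_kernel.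
Qed.

(** The fundamental theorem of calculus on [[0, b n]], away from the singular
time [t], followed by monotone convergence. *)
Lemma time_integral_gauss_kernel (k t z : R) : 0 < k -> 0 < t ->
  (\int[mu]_(s in `[0%R, t[) (gauss_kernel (k * (t - s)) z)%:E =
  ((heat_potential (k * t) z - Num.max z 0) / k)%:E)%E.
Proof.
move=> k0 t0; pose f s := gauss_kernel (k * (t - s)) z.
pose F s := - heat_potential (k * (t - s)) z / k.
pose b n := t - t / n.+2%:R ^+ 2.
have n2 n : 0 < n.+2%:R ^+ 2 :> R by rewrite exprn_gt0.
have bt n : b n < t by rewrite /b ltrBlDr ltrDl divr_gt0.
have b0 n : 0 < b n.
  rewrite subr_gt0 ltr_pdivrMr// ltr_pMr// -natrX ltr1n.
  by rewrite expnS expn1 mulSn.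
have pos s : s < t -> 0 < k * (t - s) by move=> st; rewrite mulr_gt0// subr_gt0.
have lin (s : R) : is_derive s 1 (fun s : R => k * (t - s)) (- k).
  by apply: is_derive_eq; rewrite /GRing.scale/=; ring.
have dF (s : R) : s < t -> is_derive s 1 F (f s).
  move=> st.
  have d := @is_derive1_comp _ (fun tau => heat_potential tau z) (fun s : R => k * (t - s)) s _ _
    (is_derive_time_heat_potential z (pos _ st)) (lin s).
  have dc : is_derive s 1 (fun s => - k^-1 * heat_potential (k * (t - s)) z)
     (- k^-1 * (gauss_kernel (k * (t - s)) z * - k)).
    have d' : is_derive s 1 (fun s => heat_potential (k * (t - s)) z)
      (gauss_kernel (k * (t - s)) z * - k) := d.
    by apply: is_derive_eq; rewrite /GRing.scale/=.
  have -> : F = (fun s => - k^-1 * heat_potential (k * (t - s)) z).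
    by apply: funext => x; rewrite /F mulrC mulrN mulNr.
  by apply: is_derive_eq; rewrite /f; field; rewrite gt_eqF.
have cf s : s < t -> {for s, continuous f} := @continuous_time_gauss_kernel k t z s k0.
have cfb n : {within `[0, b n], continuous f}.
  apply: continuous_in_subspaceT => x; rewrite inE/= in_itv/= => /andP[_ xb].
  by apply: cf; exact: le_lt_trans xb (bt n).
have In n : (\int[mu]_(s in `[0%R, b n]) (f s)%:E = (F (b n) - F 0)%:E)%E.
  rewrite (@continuous_FTC2 R f F 0 (b n) (b0 n) (cfb n)) ?EFinB//.
    split.
    - move=> x; rewrite in_itv/= => /andP[_ xb].
      by apply: (@ex_derive _ _ _ _ _ _ _ (dF x (lt_trans xb (bt n)))).
    - exact: cvg_at_right_filter (is_derive_continuous (dF 0 t0)).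
    - exact: cvg_at_left_filter (is_derive_continuous (dF _ (bt n))).
  move=> x; rewrite in_itv/= => /andP[_ xb].
  by rewrite derive1E; exact: (@derive_val _ _ _ _ _ _ _ (dF x (lt_trans xb (bt n)))).
have U : \bigcup_n `[0, b n]%classic = `[0, t[%classic.
  apply/seteqP; split => x /=.
    by move=> [n _ /=]; rewrite !in_itv/= => /andP[-> /le_lt_trans]; apply.
  rewrite in_itv/= => /andP[x0 xt].
  exists (Num.truncn (t / (t - x))) => //=; rewrite in_itv/= x0/= /b.
  rewrite lerBrDr -lerBrDl ler_pdivrMr// mulrC -ler_pdivrMr ?subr_gt0//.
  apply: (@le_trans _ _ (Num.truncn (t / (t - x))).+1%:R); first exact/ltW/truncnS_gt.
  by rewrite -natrX ler_nat expnS expn1 (leq_trans (leqnSn _))// leq_pmulr.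
have mf n : measurable_fun `[0, b n] f.
  by apply: subspace_continuous_measurable_fun => //; exact: cfb.
rewrite -U.
have c1 : (\int[mu]_(s in `[0%R, b n]) (f s)%:E)%E @[n --> \oo] -->
    (\int[mu]_(s in \bigcup_n `[0%R, b n]%classic) (f s)%:E)%E.
  apply: ge0_nondecreasing_set_cvg_integral => //.
  - apply/nondecreasing_seqP => n; rewrite subsetEset => x /=.
    rewrite !in_itv/= => /andP[-> /le_trans]; apply.
    rewrite /b lerD2l lerN2 ler_wpM2l ?(ltW t0)// lef_pV2 ?posrE//.
    by rewrite lerXn2r ?nnegrE// ler_nat.
  - by move=> n; apply/measurable_EFinP; exact: mf.
  - by move=> n x _; rewrite lee_fin gauss_kernel_ge0.
have c2 : (F (b n) - F 0)%:E @[n --> \oo] --> ((heat_potential (k * t) z - Num.max z 0) / k)%:E.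
  apply: cvg_EFin; first exact: nearW.
  rewrite /comp/= /F subr0 mulrBl.
  have -> : heat_potential (k * t) z / k - Num.max z 0 / k =
    - Num.max z 0 / k - - heat_potential (k * t) z / k by rewrite !mulNr opprK addrC.
  apply: cvgB; last exact: cvg_cst.
  apply: cvgMl; apply: cvgN.
  rewrite (_ : (fun n => _) = (fun n => heat_potential (k * t / n.+2%:R ^+ 2) z)).
    exact: (@heat_potential_cvg0 R (k * t) z (mulr_gt0 k0 t0)).
  by apply: funext => n; rewrite /b opprB addrC subrK mulrA.
apply: cvg_unique c1 _ => //.
by rewrite (funext In : (fun n => _) = _).
Qed.

Definition D2 (f : R -> R) h w : R := f (w + h) + f (w - h) - 2 * f w.

(** Two mean values of the first derivative and one of the second. *)
Lemma D2_heat_potential tau h w : 0 < tau -> 0 < h ->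
  exists y, `|y - w| <= h /\
    0 <= D2 (heat_potential tau) h w <= 2 * h ^+ 2 * gauss_kernel tau y.
Proof.
move=> t0 h0.
pose phi z := normal_cdf (z / Num.sqrt (2 * tau)).
have dH x := is_derive_heat_potential x t0.
have dP x := is_derive_heat_potential_cdf x t0.
have mvt (f df : R -> R) a b : (forall x : R, is_derive x 1 f (df x)) -> a < b ->
    exists2 c, a < c < b & f b - f a = df c * (b - a).
  move=> df' ab; have [c cab e] := MVT ab (fun x _ => df' x)
    (continuous_subspaceT (fun x => is_derive_continuous (df' x))).
  by exists c => //; move: cab; rewrite in_itv.
have [c1 /andP[h1 h2] e1] := mvt _ phi w (w + h) dH (ltr_pwDr h0 (lexx w)).
have wh : w - h < w by rewrite ltrBlDr ltrDl.
have [c2 /andP[h3 h4] e2] := mvt _ phi (w - h) w dH wh.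
have [c3 /andP[h5 h6] e3] := mvt phi _ c2 c1 dP (lt_trans h4 h1).
exists c3; split; first by rewrite ler_norml; apply/andP; split; lra.
have E : D2 (heat_potential tau) h w = h * (gauss_kernel tau c3 * (c1 - c2)).
  rewrite -e3 /D2.
  transitivity ((heat_potential tau (w + h) - heat_potential tau w) -
   (heat_potential tau w - heat_potential tau (w - h))); first by ring.
  by rewrite e1 e2; ring.
have g0 := gauss_kernel_ge0 tau c3.
rewrite E; apply/andP; split.
  by rewrite mulr_ge0 ?(ltW h0)// mulr_ge0 ?subr_ge0//; lra.
rewrite (_ : 2 * h ^+ 2 * gauss_kernel tau c3 = h * (gauss_kernel tau c3 * (2 * h))); last by ring.
by rewrite ler_wpM2l ?(ltW h0)// ler_wpM2l//; lra.
Qed.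

Lemma D2_heat_sum_bound tau : 0 < tau -> exists2 C, 0 <= C & forall h x,
  0 < h -> h <= 1 -> `|x| <= 1 ->
  (\esum_(k in [set: int]) (D2 (heat_potential tau) h (x - k%:~R))%:E <= (C * h ^+ 2)%:E)%E.
Proof.
move=> t0; have [C C0 HC] := heat_sum_bound t0.
exists (2 * C); first by rewrite mulr_ge0.
move=> h x h0 h1 x1.
have hh : 0 < 2 * h ^+ 2 by rewrite mulr_gt0// exprn_gt0.
pose g (k : int) y := D2 (heat_potential tau) h (y - k%:~R) / (2 * h ^+ 2).
have hg y k : `|y| <= 1 -> exists y', `|y'| <= 2 /\ 0 <= g k y <= gauss_kernel tau (y' - k%:~R).
  move=> y1; have [c [ch /andP[c1 c2]]] := D2_heat_potential (y - k%:~R) t0 h0.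
  exists (c + k%:~R); split; last first.
    rewrite addrK divr_ge0 ?(ltW hh)//= ler_pdivrMr// mulrC//.
  move: ch y1; rewrite !ler_norml => /andP[a1 a2] /andP[a3 a4]; apply/andP; split; lra.
have := HC g hg x x1.
have -> : (\esum_(k in [set: int]) (D2 (heat_potential tau) h (x - k%:~R))%:E =
    (2 * h ^+ 2)%:E * \esum_(k in [set: int]) (g k x)%:E)%E.
  rewrite -esumZ_int ?(ltW hh)//; last first.
    by move=> k; have [? [_ /andP[? _]]] := hg x k x1; rewrite lee_fin.
  by apply: eq_esum => k _; rewrite -EFinM /g mulrC divfK// gt_eqF.
move=> le; rewrite (_ : 2 * C * h ^+ 2 = 2 * h ^+ 2 * C); last by ring.
by rewrite [leRHS]EFinM lee_wpmul2l// lee_fin ltW.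
Qed.

End time_integral.

(** * Inner products of the heat kernels *)

Section kernel_gram.
Variables (R : realType) (eps t : R).
Hypotheses (eps0 : 0 < eps) (t0 : 0 < t).
Implicit Types (x y z h w : R).
Local Notation mu := (@lebesgue_measure R).
Local Notation D := (spacetime t).

Definition mild_kernel x (z : plane R) : R := heat_kernel (eps * (t - z.1)) (x - z.2).

Lemma measurable_spacetime : measurable (spacetime t).
Proof. by apply: measurableX; exact: measurable_itv. Qed.

Lemma heat_kernel_ge0 tau x : 0 <= heat_kernel tau x.
Proof. by apply: fine_ge0; apply: esum_ge0 => k _; rewrite lee_fin; exact: gauss_kernel_ge0. Qed.

(** The integral over [[0, t[] of the Gauss kernel at the times
[2 eps (t - s)]: the profile of the covariance, with a corner at 0 coming from
the positive part. *)
Definition kernel_potential z : R :=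
  (heat_potential (2 * eps * t) z - Num.max z 0) / (2 * eps).

Let e2 : 0 < 2 * eps. Proof. by rewrite mulr_gt0. Qed.

Lemma kernel_potential_ge0 z : 0 <= kernel_potential z.
Proof.
rewrite -lee_fin /kernel_potential -time_integral_gauss_kernel//.
by apply: integral_ge0 => s _; rewrite lee_fin gauss_kernel_ge0.
Qed.

Definition periodic_potential w : \bar R :=
  \esum_(k in [set: int]) (kernel_potential (w - k%:~R))%:E.

(** Integrate over space first, by the semigroup property, then over time, term
by term in the sum over the periods. *)
Lemma mild_kernel_inner x x' : torus R x -> torus R x' ->
  measurable_fun D (mild_kernel x) -> measurable_fun D (mild_kernel x') ->
  (\int[lambda2 R]_(z in D) (mild_kernel x z * mild_kernel x' z)%:E =
   periodic_potential (x - x'))%E.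
Proof.
move=> xT x'T mx mx'.
pose f (z : plane R) : \bar R := (mild_kernel x z * mild_kernel x' z)%:E.
have mf : measurable_fun D f by apply/measurable_EFinP; exact: measurable_funM.
have mfD : measurable_fun setT (f \_ D).
  by apply/(measurable_restrictT f) => //; exact: measurable_spacetime.
have fD0 (z : plane R) : (0 <= (f \_ D) z)%E.
  by apply: erestrict_ge0 => z' _; rewrite lee_fin mulr_ge0 ?heat_kernel_ge0.
rewrite integral_mkcond fubini_tonelli1//.
have FE : fubini_F mu (f \_ D) = (fun s => \int[mu]_(y in torus R) f (s, y))%E \_ `[0, t].
  apply: funext => s; rewrite /fubini_F patchE; case: ifPn => st.
    rewrite [RHS]integral_mkcond; apply: eq_integral => y _.
    rewrite !patchE; congr (if _ then _ else _).
    apply/idP/idP; rewrite !inE /spacetime/=; first by case.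
    by move=> yT; split => //; exact: set_mem st.
  apply: integral0_eq => y _; rewrite patchE ifF//.
  by apply/negbTE/negP; rewrite inE => -[/= st' _]; move/negP: st; apply; exact: mem_set.
have mF := measurable_fun_fubini_tonelli_F (m2 := mu) _ mfD fD0.
rewrite FE -integral_mkcond -integral_itv_bndo_bndc; last first.
  apply: (@measurable_funS _ _ _ _ `[0, t]%classic) => //.
    by move=> s /=; rewrite !in_itv/= => /andP[-> /ltW ->].
  by apply/(measurable_restrictT _ _).2; [exact: measurable_itv|rewrite -FE].
transitivity (\int[mu]_(s in `[0%R, t[) heat_sum (2 * eps * (t - s)) (x - x'))%E.
  apply: eq_integral => s; rewrite inE/= in_itv/= => /andP[s0 st].
  by rewrite /f /mild_kernel/= torus_semigroup ?mulrA// mulr_gt0// subr_gt0.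
rewrite integral_esum_int; [|exact: measurable_itv| |]; last 2 first.
- by move=> k; apply/measurable_EFinP; exact: measurable_time_gauss_kernel.
- by move=> k s; rewrite lee_fin gauss_kernel_ge0.
by apply: eq_esum => k _; rewrite time_integral_gauss_kernel.
Qed.

Lemma D2_max h w : 0 < h -> D2 (fun z => Num.max z 0) h w = Num.max (h - `|w|) 0.
Proof.
move=> h0; rewrite /D2 /Num.max.
by case: (ltrP w 0) => w0; [rewrite ltr0_norm//|rewrite ger0_norm//];
  repeat (match goal with |- context [if ?a < ?b then _ else _] => case: (ltrP a b) => ? end); lra.
Qed.

Lemma D2_kernel_potential h w :
  D2 kernel_potential h w =
  (D2 (heat_potential (2 * eps * t)) h w - D2 (fun z => Num.max z 0) h w) / (2 * eps).
Proof. by rewrite /D2 /kernel_potential; field; rewrite gt_eqF. Qed.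

(** The second difference of the covariance, written without subtraction since
the sums take extended real values: a periodised tent of width [h], and a
smooth remainder. *)
Lemma periodic_potential_D2 h w : 0 < h ->
  (periodic_potential (w + h) + periodic_potential (w - h) +
    \esum_(k in [set: int]) (Num.max (h - `|w - k%:~R|) 0 / (2 * eps))%:E =
   2%:E * periodic_potential w +
    \esum_(k in [set: int]) (D2 (heat_potential (2 * eps * t)) h (w - k%:~R) / (2 * eps))%:E)%E.
Proof.
move=> h0; have tau0 : 0 < 2 * eps * t by rewrite mulr_gt0.
have q0 z : (0 <= (kernel_potential z)%:E)%E by rewrite lee_fin kernel_potential_ge0.
have m0 k : (0 <= (Num.max (h - `|w - k%:~R|) 0 / (2 * eps))%:E)%E.
  by rewrite lee_fin divr_ge0 ?(ltW e2)// le_max lexx orbT.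
have d0 k : (0 <= (D2 (heat_potential (2 * eps * t)) h (w - k%:~R) / (2 * eps))%:E)%E.
  rewrite lee_fin divr_ge0 ?(ltW e2)//.
  by have [? [_ /andP[]]] := D2_heat_potential (w - k%:~R) tau0 h0.
rewrite -esumZ_int// -!esumD//; last 2 first.
- by move=> k _; rewrite mule_ge0.
- by move=> k _; rewrite adde_ge0.
apply: eq_esum => k _; rewrite -EFinM -!EFinD; congr EFin.
have := D2_kernel_potential h (w - k%:~R); rewrite D2_max// {1}/D2 => e.
have -> : w + h - k%:~R = w - k%:~R + h by ring.
have -> : w - h - k%:~R = w - k%:~R - h by ring.
move: e; set A := kernel_potential _; set B := kernel_potential _; set C := kernel_potential _.
by rewrite mulrBl => e; lra.
Qed.

End kernel_gram.

(** * Gram matrix of the kernel increments *)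

Section increment_gram.
Variables (R : realType) (eps t : R).
Hypotheses (eps0 : 0 < eps) (t0 : 0 < t).
Implicit Types (x y h w : R).
Local Notation D := (spacetime t).
Local Notation K := (mild_kernel eps t).
Local Notation L1 f := ((lambda2 R).-integrable D (EFin \o f)).

Hypothesis K_meas : forall x, torus R x -> measurable_fun D (K x).
Hypothesis K_L2 : forall x, torus R x -> L1 (fun z => K x z ^+ 2).

Let mD : measurable D. Proof. exact: measurable_spacetime. Qed.

Definition kernel_increment h x (z : plane R) := K (x + h) z - K x z.

Lemma kernel_prod_integrable x x' : torus R x -> torus R x' -> L1 (fun z => K x z * K x' z).
Proof.
move=> xT x'T; apply: integrable_sqr_mul => //;
  [exact: K_meas|exact: K_meas|exact: K_L2|exact: K_L2].
Qed.

Lemma kernel_innerE x x' : torus R x -> torus R x' ->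
  periodic_potential eps t (x - x') = (\int[lambda2 R]_(z in D) (K x z * K x' z))%:E.
Proof.
move=> xT x'T; rewrite -mild_kernel_inner//; [|exact: K_meas|exact: K_meas].
by rewrite /Rintegral fineK//; apply: integrable_fin_num => //; exact: kernel_prod_integrable.
Qed.

Let bilinear_aux (a b c d : R) : -1 * b + (-1 * c + (1 * a + d)) = a - b - c + d.
Proof. by ring. Qed.

Let balance_aux (i1 i2 i3 i4 g r S : R) : g = i1 - i2 - i3 + i4 -> i4 = i1 ->
  i2 + i3 + r = 2 * i4 + S -> g = r - S.
Proof. by lra. Qed.

Lemma increment_innerE h x x' :
  torus R x -> torus R (x + h) -> torus R x' -> torus R (x' + h) ->
  \int[lambda2 R]_(z in D) (kernel_increment h x z * kernel_increment h x' z) =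
  \int[lambda2 R]_(z in D) (K (x + h) z * K (x' + h) z)
  - \int[lambda2 R]_(z in D) (K (x + h) z * K x' z)
  - \int[lambda2 R]_(z in D) (K x z * K (x' + h) z)
  + \int[lambda2 R]_(z in D) (K x z * K x' z).
Proof.
move=> xT xhT x'T x'hT.
have i1 := kernel_prod_integrable xhT x'hT; have i2 := kernel_prod_integrable xhT x'T.
have i3 := kernel_prod_integrable xT x'hT; have i4 := kernel_prod_integrable xT x'T.
transitivity (\int[lambda2 R]_(z in D) (-1 * (K (x + h) z * K x' z) +
   (-1 * (K x z * K (x' + h) z) + (1 * (K (x + h) z * K (x' + h) z) + K x z * K x' z)))).
  apply: eq_Rintegral => z _; rewrite /kernel_increment.
  by move: (K _ z) (K _ z) (K _ z) (K _ z) => a b c d; ring.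
rewrite [LHS]Rintegral_comb; [|exact: mD|exact: i2|]; last by do 2 apply: integrable_comb => //.
rewrite Rintegral_comb; [|exact: mD|exact: i3|]; last by apply: integrable_comb.
rewrite Rintegral_comb; [|exact: mD|exact: i1|exact: i4].
exact: bilinear_aux.
Qed.

(** The inner product of two increments is minus a second difference of the
covariance, hence a periodised tent over [2 eps] minus a remainder [S] of order
[h ^ 2].  At distance 0 the tent has height [h] at the period [k = 0] and
vanishes at the others as [h <= 1]; at distance at least [h], measured on the
torus, it vanishes altogether. *)
Lemma increment_gram_bound : exists2 C, 0 <= C & forall h x x',
  0 < h -> h <= 1 ->
  torus R x -> torus R (x + h) -> torus R x' -> torus R (x' + h) ->
  let g := \int[lambda2 R]_(z in D) (kernel_increment h x z * kernel_increment h x' z) in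
  (x = x' -> `|g - h / (2 * eps)| <= C * h ^+ 2) /\
  ((forall k : int, h <= `|x - x' - k%:~R|) -> `|g| <= C * h ^+ 2).
Proof.
have tau0 : 0 < 2 * eps * t by rewrite mulr_gt0// mulr_gt0.
have e2 : 0 < 2 * eps by rewrite mulr_gt0.
have [C C0 HC] := D2_heat_sum_bound tau0.
exists (C / (2 * eps)); first by rewrite divr_ge0// ltW.
move=> h x x' h0 h1 xT xhT x'T x'hT g.
have [S S0 SE] : exists2 S : R, 0 <= S <= C / (2 * eps) * h ^+ 2 &
    (\esum_(k in [set: int]) (D2 (heat_potential (2 * eps * t)) h (x - x' - k%:~R) / (2 * eps))%:E)%E = S%:E.
  have d0 k : 0 <= D2 (heat_potential (2 * eps * t)) h (x - x' - k%:~R).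
    by have [? [_ /andP[]]] := D2_heat_potential (x - x' - k%:~R) tau0 h0.
  have s0 : (0 <= \esum_(k in [set: int]) (D2 (heat_potential (2 * eps * t)) h (x - x' - k%:~R))%:E)%E.
    by apply: esum_ge0 => k _; rewrite lee_fin.
  have sC := HC h (x - x') h0 h1 (torus_dist xT x'T).
  have -> : (\esum_(k in [set: int]) (D2 (heat_potential (2 * eps * t)) h (x - x' - k%:~R) / (2 * eps))%:E =
     (2 * eps)^-1%:E * \esum_(k in [set: int]) (D2 (heat_potential (2 * eps * t)) h (x - x' - k%:~R))%:E)%E.
    rewrite -esumZ_int//; last by rewrite invr_ge0 ltW.
    by apply: eq_esum => k _; rewrite -EFinM mulrC.
  move: s0 sC; case: (\esum_(k in _) _)%E => // s; rewrite !lee_fin => s0 sC.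
  exists ((2 * eps)^-1 * s); last by rewrite EFinM.
  rewrite mulr_ge0 ?invr_ge0 ?(ltW e2)//= [leRHS](_ : _ = (2 * eps)^-1 * (C * h ^+ 2)); last by ring.
  by rewrite ler_wpM2l// invr_ge0 ltW.
have [i1 [i2 [i3 [i4 [p1 p2 p3 p4 gE]]]]] : exists i1 i2 i3 i4 : R,
    [/\ periodic_potential eps t (x + h - (x' + h)) = i1%:E,
        periodic_potential eps t (x + h - x') = i2%:E,
        periodic_potential eps t (x - (x' + h)) = i3%:E,
        periodic_potential eps t (x - x') = i4%:E & g = i1 - i2 - i3 + i4].
  do 4 eexists; split; [exact: kernel_innerE xhT x'hT|exact: kernel_innerE xhT x'T|
    exact: kernel_innerE xT x'hT|exact: kernel_innerE xT x'T|].
  exact: increment_innerE xT xhT x'T x'hT.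
move: g gE => g gE.
have main (r : R) : (\esum_(k in [set: int]) (Num.max (h - `|x - x' - k%:~R|) 0 / (2 * eps))%:E)%E = r%:E ->
    g = r - S.
  move=> rE; have := periodic_potential_D2 eps0 t0 (x - x') h0; rewrite rE SE.
  have -> : x - x' + h = x + h - x' by ring.
  have -> : x - x' - h = x - (x' + h) by ring.
  rewrite p2 p3 p4 -EFinM -!EFinD => -[e3].
  have e1 : i4 = i1.
    by move: p1; rewrite (_ : x + h - (x' + h) = x - x') ?p4 => [[]|]; last by ring.
  exact: balance_aux gE e1 e3.
case/andP: S0 => S0 S1; split.
  move=> xx'; rewrite (main (h / (2 * eps))).
    by rewrite addrAC subrr add0r normrN ger0_norm.
  rewrite xx' subrr.
  have -> : (h / (2 * eps))%:E = (\esum_(k in [set 0%R : int]) (h / (2 * eps))%:E)%E.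
    by rewrite esum_set1// lee_fin divr_ge0 ?ltW.
  rewrite [RHS]esum_mkcond; apply: eq_esum => k _.
  rewrite sub0r normrN; case: ifPn.
    by rewrite inE/= => ->; rewrite normr0 subr0 max_l// ltW.
  move=> k0; rewrite max_r ?mul0r// subr_le0 (le_trans h1)//.
  rewrite -intr_norm ler1z; apply: contraNT k0; rewrite -ltNge => k1.
  rewrite inE/=; apply/eqP; rewrite -normr_eq0.
  by move: k1; case: `|k| (normr_ge0 k) => // -[].
move=> sep; rewrite (main 0); first by rewrite sub0r normrN ger0_norm.
by apply: esum1 => k _; rewrite max_r ?mul0r// subr_le0.
Qed.

End increment_gram.

(** * A Bessel inequality for almost orthogonal families *)

Section bessel.
Context d (T : measurableType d) (R : realType) (mu : {measure set T -> \bar R}).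
Variable D : set T.
Hypothesis mD : measurable D.
Local Notation L1 f := (mu.-integrable D (EFin \o f)).
Local Notation inner f g := (\int[mu]_(z in D) (f z * g z)).

Lemma integrable_lincomb n (c : nat -> R) (f : nat -> T -> R) : (forall i, L1 (f i)) ->
  L1 (fun z => \sum_(i < n) c i * f i z).
Proof.
move=> If; elim: n => [|n IH].
  under eq_fun do rewrite big_ord0; exact: integrable0.
under eq_fun do rewrite big_ord_recr/= addrC; exact: integrable_comb.
Qed.

Lemma Rintegral_lincomb n (c : nat -> R) (f : nat -> T -> R) : (forall i, L1 (f i)) ->
  \int[mu]_(z in D) (\sum_(i < n) c i * f i z) = \sum_(i < n) c i * \int[mu]_(z in D) f i z.
Proof.
move=> If; elim: n => [|n IH].
  under eq_Rintegral do rewrite big_ord0.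
  by rewrite big_ord0 Rintegral_cst// mul0r.
under eq_Rintegral do rewrite big_ord_recr/= addrC.
rewrite Rintegral_comb//; last exact: integrable_lincomb.
by rewrite IH big_ord_recr/= addrC.
Qed.

(** Schur's test: [c i c j <= (c i ^ 2 + c j ^ 2) / 2]. *)
Lemma quadratic_row_sum_le n (c : nat -> R) (G : nat -> nat -> R) rho :
  (forall i j, G i j = G j i) ->
  (forall i, (i < n)%N -> \sum_(j < n) `|G i j| <= rho) ->
  \sum_(i < n) c i * \sum_(j < n) c j * G i j <= rho * \sum_(i < n) c i ^+ 2.
Proof.
move=> GC Grho.
apply: (@le_trans _ _ (\sum_(i < n) \sum_(j < n) (2^-1 * (`|G i j| * c i ^+ 2) + 2^-1 * (`|G i j| * c j ^+ 2)))).
  apply: ler_sum => i _; rewrite mulr_sumr; apply: ler_sum => j _.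
  have a := ler_norm (c i * (c j * G i j)); apply: le_trans a _.
  rewrite !normrM -(real_normK (num_real (c i))) -(real_normK (num_real (c j))).
  move: `|c i| `|c j| `|G i j| (normr_ge0 (G i j)) => a b g g0.
  by have := mulr_ge0 g0 (sqr_ge0 (a - b)); lra.
under eq_bigr do rewrite big_split/=.
rewrite big_split/= [X in _ + X]exchange_big/=.
have -> : \sum_(j < n) \sum_(i < n) 2^-1 * (`|G i j| * c j ^+ 2) =
   \sum_(i < n) \sum_(j < n) 2^-1 * (`|G i j| * c i ^+ 2).
  by apply: eq_bigr => i _; apply: eq_bigr => j _; rewrite GC.
rewrite -big_split/= mulr_sumr; apply: ler_sum => i _.
rewrite -big_split/=.
have -> : \sum_(j < n) (2^-1 * (`|G i j| * c i ^+ 2) + 2^-1 * (`|G i j| * c i ^+ 2)) =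
   (\sum_(j < n) `|G i j|) * c i ^+ 2.
  by rewrite mulr_suml; apply: eq_bigr => j _; lra.
by rewrite ler_wpM2r ?sqr_ge0// Grho.
Qed.

(** With [c i = <e i, F>] and [S] the sum of the [c i e i], expand
[0 <= |F - S / rho| ^ 2].  Schur's test bounds [|S| ^ 2] by
[rho] times the sum of the [c i ^ 2], and [<S, F>] is that sum. *)
Lemma bessel_row_sum n (e : nat -> T -> R) (F : T -> R) rho : 0 < rho ->
  (forall i, measurable_fun D (e i)) -> (forall i, L1 (fun z => e i z ^+ 2)) ->
  measurable_fun D F -> L1 (fun z => F z ^+ 2) ->
  (forall i, (i < n)%N -> \sum_(j < n) `|inner (e i) (e j)| <= rho) ->
  \sum_(i < n) (inner (e i) F) ^+ 2 <= rho * \int[mu]_(z in D) (F z ^+ 2).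
Proof.
move=> rho0 me e2 mF F2 Grho.
pose c i := inner (e i) F; pose G i j := inner (e i) (e j).
have eF i : L1 (fun z => e i z * F z) by exact: integrable_sqr_mul.
have ee i j : L1 (fun z => e i z * e j z) by exact: integrable_sqr_mul.
pose S z := \sum_(i < n) c i * e i z.
have SF : L1 (fun z => S z * F z).
  have -> : (fun z => S z * F z) = (fun z => \sum_(i < n) c i * (e i z * F z)).
    by apply: funext => z; rewrite /S mulr_suml; apply: eq_bigr => i _; rewrite mulrA.
  exact: (@integrable_lincomb n c (fun i z => e i z * F z)).
have SFE : inner S F = \sum_(i < n) c i ^+ 2.
  transitivity (\int[mu]_(z in D) (\sum_(i < n) c i * (e i z * F z))).
    by apply: eq_Rintegral => z _; rewrite /S mulr_suml; apply: eq_bigr => i _; rewrite mulrA.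
  by rewrite (@Rintegral_lincomb n c (fun i z => e i z * F z))//; apply: eq_bigr => i _; rewrite expr2.
have Se j : L1 (fun z => e j z * S z).
  have -> : (fun z => e j z * S z) = (fun z => \sum_(i < n) c i * (e j z * e i z)).
    by apply: funext => z; rewrite /S mulr_sumr; apply: eq_bigr => i _; rewrite mulrCA.
  exact: (@integrable_lincomb n c (fun i z => e j z * e i z)).
have SeE j : inner (e j) S = \sum_(i < n) c i * G j i.
  transitivity (\int[mu]_(z in D) (\sum_(i < n) c i * (e j z * e i z))).
    by apply: eq_Rintegral => z _; rewrite /S mulr_sumr; apply: eq_bigr => i _; rewrite mulrCA.
  by rewrite (@Rintegral_lincomb n c (fun i z => e j z * e i z)).
have S2 : L1 (fun z => S z ^+ 2).
  have -> : (fun z => S z ^+ 2) = (fun z => \sum_(i < n) c i * (e i z * S z)).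
    by apply: funext => z; rewrite expr2 {1}/S mulr_suml; apply: eq_bigr => i _; rewrite mulrA.
  exact: (@integrable_lincomb n c (fun i z => e i z * S z)).
have S2E : \int[mu]_(z in D) (S z ^+ 2) = \sum_(i < n) c i * \sum_(j < n) c j * G i j.
  transitivity (\int[mu]_(z in D) (\sum_(i < n) c i * (e i z * S z))).
    by apply: eq_Rintegral => z _; rewrite expr2 {1}/S mulr_suml; apply: eq_bigr => i _; rewrite mulrA.
  by rewrite (@Rintegral_lincomb n c (fun i z => e i z * S z))//; apply: eq_bigr => i _; rewrite SeE.
have pos : 0 <= \int[mu]_(z in D) ((F z - rho^-1 * S z) ^+ 2).
  by apply: Rintegral_ge0 => z _; exact: sqr_ge0.
have posE : \int[mu]_(z in D) ((F z - rho^-1 * S z) ^+ 2) =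
    - (2 / rho) * inner S F + (rho^-1 ^+ 2 * \int[mu]_(z in D) (S z ^+ 2) +
     \int[mu]_(z in D) (F z ^+ 2)).
  rewrite -!Rintegral_comb//; last exact: integrable_comb.
  by apply: eq_Rintegral => z _; move: (F z) (S z) => a b; ring.
have key := @quadratic_row_sum_le n c G rho _ Grho.
rewrite posE SFE S2E in pos.
have {}key : \sum_(i < n) c i * \sum_(j < n) c j * G i j <= rho * \sum_(i < n) c i ^+ 2.
  by apply: key => i j; apply: eq_Rintegral => z _; rewrite mulrC.
move: pos key; move: (\int[mu]_(z in D) _) (\sum_(i < n) c i * _) => f q.
move: (\sum_(i < n) c i ^+ 2) => s pos key.
have r1 : 0 < rho^-1 by rewrite invr_gt0.
have k2 : rho^-1 ^+ 2 * q <= rho^-1 * s.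
  have := ler_wpM2l (ltW (exprn_gt0 2 r1)) key.
  by rewrite mulrA expr2 divfK// gt_eqF.
have : 0 <= f - s / rho by lra.
by rewrite subr_ge0 ler_pdivrMr// mulrC.
Qed.

End bessel.

(** * Almost sure convergence from summable expectations *)

Section almost_sure.
Context d (T : measurableType d) (R : realType) (mu : {measure set T -> \bar R}).

Lemma sum_inv_sqr_le n : \sum_(0 <= i < n) (i.+1%:R ^- 2) <= 2 :> R.
Proof.
suff : \sum_(0 <= i < n) (i.+1%:R ^- 2) <= 2 - 2 / n.+1%:R :> R.
  by move=> /le_trans; apply; rewrite lerBlDr lerDl divr_ge0.
elim: n => [|n IH]; first by rewrite big_nil divr1 subrr.
rewrite big_nat_recr//= -[leRHS](subrK (2 - 2 / n.+1%:R)) addrC lerD//.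
rewrite -[n.+2%:R]natr1; have : 1 <= n.+1%:R :> R by rewrite ler1n.
move: n.+1%:R => k k1.
have -> : 2 - 2 / (k + 1) - (2 - 2 / k) = k^-1 * (2 / (k + 1)) by field; lra.
have k0 : 0 < k by lra.
rewrite -exprVn expr2 ler_wpM2l// ?invr_ge0 ?(ltW k0)//.
by rewrite ler_pdivlMr ?addr_gt0// mulrDr mulVf ?gt_eqF// mulr1; move: (k1); rewrite -invf_le1//; lra.
Qed.

(** The sum over [N] has a finite integral, so it is finite almost everywhere
and its terms tend to 0. *)
Lemma ae_cvg0_summable (Y : nat -> T -> R) (C : R) :
  (forall N, measurable_fun setT (Y N)) -> (forall N w, 0 <= Y N w) -> 0 <= C ->
  (forall N, \int[mu]_w (Y N w)%:E <= (C * N.+1%:R ^- 2)%:E)%E ->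
  {ae mu, forall w, Y N w @[N --> \oo] --> (0 : R)}.
Proof.
move=> mY Y0 C0 YC.
pose S w := (\sum_(N <oo) (Y N w)%:E)%E.
have mS : measurable_fun setT S.
  apply: ge0_emeasurable_sum => N; first by move=> w _ _; rewrite lee_fin.
  by move=> _; apply/measurable_EFinP.
have S0 w : (0 <= S w)%E by apply: nneseries_ge0 => N _ _; rewrite lee_fin.
have iS : mu.-integrable setT S.
  apply/integrableP; split => //.
  under eq_integral do rewrite gee0_abs//.
  rewrite /S integral_nneseries//; last 2 first.
  - by move=> N; apply/measurable_EFinP.
  - by move=> N w _; rewrite lee_fin.
  apply: (@le_lt_trans _ _ (C * 2)%:E); last exact: ltry.
  apply: lime_le.
    by apply: is_cvg_nneseries => N _ _; apply: integral_ge0 => w _; rewrite lee_fin.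
  apply: nearW => n.
  apply: (@le_trans _ _ (\sum_(0 <= N < n) (C * N.+1%:R ^- 2)%:E)%E).
    by apply: lee_sum => N _.
  by rewrite sumEFin lee_fin -mulr_sumr ler_wpM2l// sum_inv_sqr_le.
have := integrable_ae measurableT iS; apply: filterS => w /(_ I) Sfin.
apply: cvg_series_cvg_0; apply: nondecreasing_is_cvgn.
  by apply/nondecreasing_seqP => n; rewrite seriesSr lerDl.
exists (fine (S w)) => _ [n _ <-].
rewrite -lee_fin fineK// /series/= -sumEFin.
by apply: nneseries_lim_ge => N _ _; rewrite lee_fin.
Qed.

End almost_sure.

(** * Iterated integrals over space-time *)

Section plane_fubini.
Variables (R : realType) (t : R).
Local Notation mu := (@lebesgue_measure R).
Local Notation D := (spacetime t).

(** The drift is an iterated integral, whereas the L2 estimates concern the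
product measure. *)
Lemma iterated_Rintegral (f : plane R -> R) :
  (lambda2 R).-integrable D (EFin \o f) ->
  \int[mu]_(s in `[0, t]) \int[mu]_(y in torus R) f (s, y) =
  \int[lambda2 R]_(z in D) f z.
Proof.
move=> If; have mD : measurable D := measurable_spacetime t.
pose g := (EFin \o f) \_ D.
have Ig : (lambda2 R).-integrable setT g by apply/(integrable_mkcond _ mD).
have FE s : s \in `[0, t]%classic -> fubini_F mu g s = (\int[mu]_(y in torus R) (f (s, y))%:E)%E.
  move=> st; rewrite /fubini_F [RHS]integral_mkcond; apply: eq_integral => y _.
  rewrite /g !patchE; congr (if _ then _ else _).
  apply/idP/idP; rewrite !inE /spacetime/=; first by case.
  by move=> yT; split => //; exact: set_mem st.
have F0 s : s \notin `[0, t]%classic -> fubini_F mu g s = 0%E.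
  move=> st; apply: integral0_eq => y _; rewrite /g patchE ifF//.
  by apply/negbTE/negP; rewrite inE => -[/= st' _]; move/negP: st; apply; exact: mem_set.
have mI : measurable (`[0, t]%classic : set (measurableTypeR R)) by exact: measurable_itv.
have IF : mu.-integrable setT (fubini_F mu g) := integrable_fubini_F Ig.
rewrite /Rintegral; congr fine.
transitivity (\int[mu]_(s in `[0%R, t]) fubini_F mu g s)%E.
  apply: ae_eq_integral => //.
  - have := measurable_funTS (D := `[0, t]%classic) (measurable_int _ IF).
    move=> mF; apply/measurable_EFinP.
    apply: (eq_measurable_fun (fine \o fubini_F mu g)).
      by move=> s st; rewrite /= FE.
    by apply: measurableT_comp => //; exact: fine_measurable.
  - exact: measurable_funTS (measurable_int _ IF).
  - have := integrable_ae measurableT IF; apply: filterS => s /(_ I) fs st.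
    by rewrite -FE ?fineK//; exact: mem_set.
transitivity (\int[mu]_s fubini_F mu g s)%E; last first.
  by rewrite (integral12_prod_meas1 Ig) [RHS]integral_mkcond.
rewrite [LHS]integral_mkcond; apply: eq_integral => s _; rewrite patchE.
by case: ifPn => // st; rewrite F0.
Qed.

End plane_fubini.

(** * Sigma-finiteness of the Lebesgue measure of the plane *)

Section plane_measure.
Variable R : realType.

Lemma plane_sigma_finite : sigma_finite setT (lambda2 R).
Proof.
have /sigma_finiteP[F [TF ndF Foo]] := sigma_finiteT (@lebesgue_measure R).
exists (fun n => F n `*` F n).
  rewrite -setXTT TF predeqE => -[x y]; split.
    move=> [/= [n _ Fnx] [k _ Gky]]; exists (maxn n k) => //; split.
    - by move: x Fnx; exact/subsetPset/ndF/leq_maxl.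
    - by move: y Gky; exact/subsetPset/ndF/leq_maxr.
  by move=> [n _ []/= ? ?]; split; exists n.
move=> k; have [mF ?] := Foo k.
split; first exact: measurableX.
rewrite [X in (X < _)%E](_ : _ = @lebesgue_measure R (F k) * @lebesgue_measure R (F k))%E.
  by rewrite lte_mul_pinfty// ge0_fin_numE.
exact: (product_measure1E _ _ mF mF).
Qed.
Let plane_mixin := Measure_isSigmaFinite.Build _ _ _ (lambda2 R) plane_sigma_finite.
(** The Lebesgue measure of the plane, with the sigma-finiteness that Fubini on
the product with the probability space asks for. *)
Definition plane_measure : {sigma_finite_measure set (plane R) -> \bar R} :=
  HB.pack (lambda2 R) plane_mixin.

End plane_measure.

(** * The reaction term is square integrable *)

Section reaction_L2.
Context d (Omega : measurableType d) (R : realType) (P : probability Omega R).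
Variables (T : R) (u : R -> R -> Omega -> R).
Local Notation D := (spacetime T).
Hypothesis T0 : 0 < T.
Hypothesis mu : measurable_fun (D `*` [set: Omega])
  (fun z : plane R * Omega => u z.1.1 z.1.2 z.2).
Hypothesis u_moments : forall q : R, 2 <= q ->
  (ereal_sup [set 'E_P[fun w => (`|u z.1 z.2 w| `^ q)%R] | z in D] < +oo)%E.

Let mD : measurable D. Proof. exact: measurable_spacetime. Qed.

Lemma spacetime_fin : (lambda2 R D < +oo)%E.
Proof.
have mA : measurable (`[0, T]%classic : set (measurableTypeR R)) := measurable_itv _.
have mB : measurable (torus R : set (measurableTypeR R)) := measurable_itv _.
have -> : lambda2 R D = (@lebesgue_measure R `[0%R, T]%classic * @lebesgue_measure R (torus R))%E.
  exact: (product_measure1E _ _ mA mB).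
by rewrite /torus !lebesgue_measure_itv/= !lte_fin T0 ltr01 -!EFinD -EFinM ltry.
Qed.

Lemma time_space_section_measurable w : measurable_fun D (fun z : plane R => u z.1 z.2 w).
Proof.
have := mu.
have mDT : measurable (D `*` [set: Omega]) by apply: measurableX.
move=> /(measurable_restrictT _ mDT) mr.
have mp : measurable_fun [set: plane R] (fun z : plane R => (z, w)) := pair2_measurable w.
have := measurableT_comp mr mp => mc.
apply: (eq_measurable_fun _ _ (measurable_funTS mc)) => z zD.
rewrite /= patchE ifT//; apply/mem_set; split => //=; exact: set_mem zD.
Qed.

Let G (p : plane R * Omega) : \bar R := ((reaction (u p.1.1 p.1.2 p.2)) ^+ 2)%:E.

(** By Tonelli, it suffices that the second moment of [f (u)] is bounded over
space-time; as [(a - a ^ 3) ^ 2 <= 2 a ^ 2 + 2 a ^ 6], the moments of order 2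
and 6 of [u] do it. *)
Lemma reaction_L2 : {ae P, forall w,
  (lambda2 R).-integrable D (EFin \o (fun z : plane R => reaction (u z.1 z.2 w) ^+ 2))}.
Proof.
have mDT : measurable (D `*` [set: Omega]) by apply: measurableX.
have mr : measurable_fun [set: R] (@reaction R).
  by apply: measurable_funB => //; exact: measurable_funX.
have mG : measurable_fun (D `*` [set: Omega]) G.
  apply/measurable_EFinP; apply: measurable_funX.
  exact: (measurableT_comp mr mu).
pose g := G \_ (D `*` [set: Omega]).
have mg : measurable_fun setT g by apply/(measurable_restrictT _ mDT).
have g0 p : (0 <= g p)%E.
  by apply: erestrict_ge0 => q _; rewrite lee_fin sqr_ge0.
have moment (q : nat) : (2 <= q)%N -> exists2 M : R, 0 <= M & forall z : plane R, D z ->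
    (\int[P]_w (`|u z.1 z.2 w| ^+ q)%:E <= M%:E)%E.
  move=> q2; have := u_moments (q := q%:R); rewrite ler_nat => /(_ q2).
  move: (ereal_sup_ubound).
  set S := [set _ | _ in _] => ub Sy.
  exists (Num.max (fine (ereal_sup S)) 0); first by rewrite le_max lexx orbT.
  move=> z zD; have : S ('E_P[fun w => (`|u z.1 z.2 w| `^ q%:R)%R])%E by exists z.
  move=> /ub; rewrite expectation.unlock.
  under eq_integral do rewrite powR_mulrn//.
  move=> h; apply: (le_trans h); move: Sy; case: (ereal_sup S) => [s| |]//= _.
    by rewrite lee_fin le_max lexx.
  by rewrite leNye.
have [M2 M20 h2] := moment 2%N isT; have [M6 M60 h6] := moment 6%N isT.
have inner z : (\int[P]_w g (z, w) <= ((2 * M2 + 2 * M6)%:E * (\1_D z)%:E))%E.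
  rewrite indicE; case: (boolP (z \in D)) => zD; last first.
    rewrite mule0 integral0_eq// => w _; rewrite /g patchE ifN//.
    by apply: contra zD; rewrite !inE => -[].
  have {}zD := set_mem zD; rewrite mule1.
  have mz : measurable_fun setT (fun w => u z.1 z.2 w).
    have mp : measurable_fun [set: Omega] (fun w : Omega => (z, w)) := pair1_measurable z.
    have := measurableT_comp ((measurable_restrictT _ mDT).1 mu) mp.
    apply: eq_measurable_fun => w _.
    by rewrite /= patchE ifT//; apply/mem_set.
  apply: (@le_trans _ _ (\int[P]_w (2%:E * (`|u z.1 z.2 w| ^+ 2)%:E + 2%:E * (`|u z.1 z.2 w| ^+ 6)%:E))%E).
    apply: ge0_le_integral => //.
    - exact: (measurable_fun_pair2 z mg).
    - apply: emeasurable_funD; apply: emeasurable_funM => //; apply/measurable_EFinP;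
        apply: measurable_funX; exact: measurableT_comp.
    - move=> w _; rewrite /g patchE; case: ifPn => _; last first.
        by rewrite -!EFinM -EFinD lee_fin addr_ge0// mulr_ge0.
      rewrite /G/= -!EFinM -EFinD lee_fin /reaction.
      move: (u _ _ _) => a.
      have -> : `|a| ^+ 6 = a ^+ 6 by rewrite -normrX ger0_norm// exprn_even_ge0.
      rewrite real_normK ?num_real//.
      have -> : a ^+ 6 = (a ^+ 3) ^+ 2 by rewrite -exprM.
      by have := sqr_ge0 (a + a ^+ 3); lra.
  have mpow k : measurable_fun setT (fun w => (`|u z.1 z.2 w| ^+ k)%:E).
    by apply/measurable_EFinP; apply: measurable_funX; exact: measurableT_comp.
  have m2pow k : measurable_fun setT (fun w => (2%:E * (`|u z.1 z.2 w| ^+ k)%:E)%E).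
    exact: emeasurable_funM.
  have p0 k w : (0 <= (`|u z.1 z.2 w| ^+ k)%:E)%E by rewrite lee_fin.
  have p20 k w : (0 <= 2%:E * (`|u z.1 z.2 w| ^+ k)%:E)%E by rewrite mule_ge0.
  rewrite (ge0_integralD _ measurableT (fun w _ => p20 2%N w) (m2pow 2%N)
    (fun w _ => p20 6%N w) (m2pow 6%N)).
  rewrite (ge0_integralZl _ measurableT (mpow 2%N))//.
  rewrite (ge0_integralZl _ measurableT (mpow 6%N))//.
  have -> : (2 * M2 + 2 * M6)%:E = (2%:E * M2%:E + 2%:E * M6%:E)%E by [].
  by rewrite leeD// lee_wpmul2l// ?h2 ?h6.
have fin : (\int[P]_w \int[lambda2 R]_z g (z, w) < +oo)%E.
  have m1D : measurable_fun setT (fun z : plane R => (\1_D z)%:E : \bar R).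
    by apply/measurable_EFinP; exact: measurable_indic.
  have swap : (\int[lambda2 R]_z \int[P]_w g (z, w) =
      \int[P]_w \int[lambda2 R]_z g (z, w))%E.
    exact: (@fubini_tonelli _ _ _ _ _ (plane_measure R) P g mg g0).
  rewrite -[X in (X < _)%E]swap.
  apply: (@le_lt_trans _ _ (\int[lambda2 R]_z ((2 * M2 + 2 * M6)%:E * (\1_D z)%:E))%E).
    apply: ge0_le_integral => //.
    - by move=> z _; apply: integral_ge0.
    - exact: (@measurable_fun_fubini_tonelli_F _ _ _ _ _ P g mg g0).
    - exact: emeasurable_funM.
  rewrite (ge0_integralZl _ measurableT m1D)//; last first.
    by rewrite lee_fin addr_ge0// mulr_ge0.
  rewrite integral_indic; [|exact: measurableT|exact: mD].
  rewrite setIT lte_mul_pinfty//; first by rewrite lee_fin addr_ge0// mulr_ge0.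
  exact: spacetime_fin.
have mH : measurable_fun setT (fubini_G (lambda2 R) g).
  exact: (@measurable_fun_fubini_tonelli_G _ _ _ _ _ (plane_measure R) g mg g0).
have IH : P.-integrable setT (fubini_G (lambda2 R) g).
  apply/integrableP; split; first exact: mH.
  under eq_integral do rewrite gee0_abs ?integral_ge0//.
  exact: fin.
have := integrable_ae measurableT IH; apply: filterS => w /(_ I) wfin.
have mw := time_space_section_measurable w.
apply/integrableP; split.
  apply/measurable_EFinP; apply: measurable_funX; exact: (measurableT_comp mr mw).
rewrite integral_mkcond.
move: wfin; rewrite ge0_fin_numE; last by apply: integral_ge0.
apply: le_lt_trans; rewrite /fubini_G le_eqVlt; apply/orP; left; apply/eqP.
apply: eq_integral => z _; rewrite /g !patchE.
case: (boolP (z \in D)) => zD.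
  rewrite ifT; last by apply/mem_set; split => //=; exact: set_mem zD.
  by rewrite /= ger0_norm ?sqr_ge0.
by rewrite ifN//; apply: contra zD; rewrite !inE => -[].
Qed.

End reaction_L2.

(** * Linear combinations of step functions *)

Section step_algebra.
Context d (Omega : measurableType d) (R : realType).
Implicit Types (l : seq (R * set (plane R))) (W : set (plane R) -> Omega -> R).

Definition scale_step (a : R) l := [seq (a * c.1, c.2) | c <- l].

Lemma scale_step_on D a l : step_on D l -> step_on D (scale_step a l).
Proof. by move=> lD c /mapP[c' /lD h ->]. Qed.

Lemma cat_step_on D l l' : step_on D l -> step_on D l' -> step_on D (l ++ l').
Proof. by move=> lD l'D c; rewrite mem_cat => /orP[/lD|/l'D]. Qed.

Lemma scale_step_integral W a l w :
  step_integral W (scale_step a l) w = a * step_integral W l w.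
Proof.
rewrite /step_integral big_map mulr_sumr; apply: eq_bigr => c _.
by rewrite mulrA.
Qed.

Lemma cat_step_integral W l l' w :
  step_integral W (l ++ l') w = step_integral W l w + step_integral W l' w.
Proof. by rewrite /step_integral big_cat. Qed.

Lemma scale_step_fun a l z : step_fun (scale_step a l) z = a * step_fun l z.
Proof.
rewrite /step_fun big_map mulr_sumr; apply: eq_bigr => c _.
by rewrite mulrA.
Qed.

Lemma cat_step_fun l l' z : step_fun (l ++ l') z = step_fun l z + step_fun l' z.
Proof. by rewrite /step_fun big_cat. Qed.

Fixpoint lin_step (n : nat) (L : nat -> seq (R * set (plane R))) (g : nat -> R) :=
  if n is m.+1 then lin_step m L g ++ scale_step (g m) (L m) else [::].

Lemma lin_step_on D n L g : (forall i, step_on D (L i)) -> step_on D (lin_step n L g).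
Proof.
move=> LD; elim: n => [|n IH] /=; first by move=> c; rewrite in_nil.
by apply: cat_step_on => //; exact: scale_step_on.
Qed.

Lemma lin_step_integral W n L g w :
  step_integral W (lin_step n L g) w = lin n (fun i => step_integral W (L i) w) g.
Proof.
rewrite /lin; elim: n => [|n IH] /=.
  by rewrite big_ord0 /step_integral big_nil.
by rewrite cat_step_integral IH scale_step_integral big_ord_recr/= [g n * _]mulrC.
Qed.

Definition diff_step l l' := l ++ scale_step (- 1) l'.

Lemma diff_step_on D l l' : step_on D l -> step_on D l' -> step_on D (diff_step l l').
Proof. by move=> lD l'D; apply: cat_step_on => //; exact: scale_step_on. Qed.

Lemma diff_step_integral W l l' w :
  step_integral W (diff_step l l') w = step_integral W l w - step_integral W l' w.
Proof. by rewrite cat_step_integral scale_step_integral mulN1r. Qed.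

Lemma diff_step_fun l l' z : step_fun (diff_step l l') z = step_fun l z - step_fun l' z.
Proof. by rewrite cat_step_fun scale_step_fun mulN1r. Qed.

End step_algebra.

(** * Quadratic variation of step integrals *)

Section step_quadratic_variation.
Context d (Omega : measurableType d) (R : realType) (P : probability Omega R).
Variables (W : set (plane R) -> Omega -> R) (D : set (plane R)).
Hypotheses (mD : measurable D) (D_fin : (lambda2 R D < +oo)%E).
Hypothesis W_noise : white_noise P D W.
Local Notation L1 f := (P.-integrable [set: Omega] (EFin \o f)).

Definition step_gram (L : nat -> seq (R * set (plane R))) i j : R :=
  \int[lambda2 R]_(z in D) (step_fun (L i) z * step_fun (L j) z).

(** A linear combination of step integrals is a step integral, hence Gaussian;
its variance is the Gram quadratic form by the isometry. *)
Lemma lin_step_moments L n g : (forall i, step_on D (L i)) ->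
  gaussian_moments P (fun w => lin n (fun i => step_integral W (L i) w) g)
    (qform n (step_gram L) g).
Proof.
move=> LD; pose X i w := step_integral W (L i) w.
have E : (fun w => lin n (fun i => step_integral W (L i) w) g) =
    step_integral W (lin_step n L g).
  by apply: funext => w; rewrite lin_step_integral.
have XX i j : L1 (fun w => X i w * X j w).
  apply: integrable_sqr_mul => //; [exact: (step_integral_measurable W_noise)|
    exact: (step_integral_measurable W_noise)|exact: (step_integral_sqr W_noise)|
    exact: (step_integral_sqr W_noise)].
have -> : qform n (step_gram L) g = \int[P]_w (step_integral W (lin_step n L g) w ^+ 2).
  rewrite /qform.
  transitivity (\int[P]_w (\sum_(i < n) g i * (\sum_(j < n) g j * (X i w * X j w)))).
    rewrite (@Rintegral_lincomb _ _ _ P setT measurableT n g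
      (fun i w => \sum_(j < n) g j * (X i w * X j w))); last first.
      by move=> i; exact: (@integrable_lincomb _ _ _ P setT measurableT n g
        (fun j w => X i w * X j w)).
    apply: eq_bigr => i _.
    rewrite (@Rintegral_lincomb _ _ _ P setT measurableT n g (fun j w => X i w * X j w))//.
    rewrite mulr_sumr; apply: eq_bigr => j _.
    rewrite /step_gram -(step_isometry mD D_fin W_noise)//.
    by rewrite mulrC -mulrA.
  apply: eq_Rintegral => w _; rewrite -E expr2 {1}/lin mulr_suml; apply: eq_bigr => i _.
  rewrite /lin !mulr_sumr; apply: eq_bigr => j _.
  by rewrite /X; ring.
by rewrite E; apply: (step_integral_gaussian W_noise); exact: lin_step_on.
Qed.

Lemma step_quadratic_variation4 L n M : (forall i, step_on D (L i)) ->
  (forall i j, (j < i < n)%N -> `|step_gram L i j| <= M) ->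
  L1 (fun w => (\sum_(i < n) step_integral W (L i) w ^+ 2 - \sum_(i < n) step_gram L i i) ^+ 4) /\
  \int[P]_w ((\sum_(i < n) step_integral W (L i) w ^+ 2 - \sum_(i < n) step_gram L i i) ^+ 4) <=
    480 * (\sum_(i < n) step_gram L i i ^+ 2) ^+ 2 + 2304 * M ^+ 4 * n%:R ^+ 4.
Proof.
move=> LD cM.
have sym i j : step_gram L i j = step_gram L j i.
  by rewrite /step_gram; apply: eq_Rintegral => z _; rewrite mulrC.
exact: (@gaussian_qform4 _ _ _ P n (fun i => step_integral W (L i)) (step_gram L) M
  sym cM (fun g => lin_step_moments n g LD)).
Qed.

End step_quadratic_variation.

(** * Continuity of the inner product *)

Section L2_approximation.
Context d (T : measurableType d) (R : realType) (mu : {measure set T -> \bar R}).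
Variable D : set T.
Hypothesis mD : measurable D.
Local Notation L1 f := (mu.-integrable D (EFin \o f)).
Local Notation L2 f := (measurable_fun D f /\ L1 (fun z => f z ^+ 2)).
Local Notation nrm2 f := (\int[mu]_(z in D) (f z ^+ 2)).

(** With [p = a - a'] and [q = b - b'], the difference is
[p q - p b - a q]; Young's inequality with a small weight [eta] on [a] and [b]
bounds it by squares, of which only those of [p] and [q] carry the large
constant [k]. *)
Lemma L2_approx_inner (tol B : R) : 0 < tol -> 0 <= B ->
  exists2 delta, 0 < delta & forall a b a' b' : T -> R, L2 a -> L2 b -> L2 a' -> L2 b' ->
  nrm2 a <= B -> nrm2 b <= B ->
  nrm2 (fun z => a z - a' z) <= delta -> nrm2 (fun z => b z - b' z) <= delta ->
  `|\int[mu]_(z in D) (a' z * b' z) - \int[mu]_(z in D) (a z * b z)| <= tol.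
Proof.
move=> tol0 B0; pose eta := tol / (2 * B + 2).
have eta0 : 0 < eta by rewrite divr_gt0//; lra.
pose k := eta^-1 / 2 + 2^-1.
have k0 : 0 < k by rewrite /k addr_gt0// divr_gt0// invr_gt0.
exists (tol / (4 * k)); first by rewrite divr_gt0// mulr_gt0.
move=> a b a' b' [ma a2] [mb b2] [ma' a'2] [mb' b'2] aB bB pd qd.
have p2 : L1 (fun z => (a z - a' z) ^+ 2).
  have := integrable_sqr_comb mD (- 1) ma' ma a'2 a2.
  by under eq_fun do rewrite mulN1r addrC.
have q2 : L1 (fun z => (b z - b' z) ^+ 2).
  have := integrable_sqr_comb mD (- 1) mb' mb b'2 b2.
  by under eq_fun do rewrite mulN1r addrC.
have ab' : L1 (fun z => a' z * b' z) by exact: integrable_sqr_mul.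
have ab : L1 (fun z => a z * b z) by exact: integrable_sqr_mul.
have iN : L1 (fun z => a' z * b' z - a z * b z).
  have := integrable_comb (- 1) mD ab ab'.
  by under eq_fun do rewrite mulN1r addrC.
rewrite -RintegralB//.
apply: le_trans (le_normr_Rintegral _ iN) _ => //.
apply: (@le_trans _ _ (\int[mu]_(z in D) (k * (a z - a' z) ^+ 2 + (k * (b z - b' z) ^+ 2 +
   (eta / 2 * a z ^+ 2 + (eta / 2 * b z ^+ 2 + 0)))))).
  apply: le_Rintegral => //.
  - by have := integrable_norm iN.
  - do 4 apply: integrable_comb => //; exact: integrable0.
  move=> z _; move: (a z) (b z) (a' z) (b' z) => x y x' y'.
  have -> : x' * y' - x * y = - ((x - x') * y) - x * (y - y') + (x - x') * (y - y') by ring.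
  move: (x - x') (y - y') => p q.
  have young (r s : R) : `|r * s| <= eta^-1 / 2 * r ^+ 2 + eta / 2 * s ^+ 2.
    rewrite normrM -[r ^+ 2]real_normK ?num_real// -[s ^+ 2]real_normK ?num_real//.
    move: `|r| `|s| => {}r {}s.
    have : 0 <= eta^-1 / 2 * (r - eta * s) ^+ 2 by rewrite mulr_ge0 ?sqr_ge0// divr_ge0// invr_ge0 ltW.
    have -> : eta^-1 / 2 * (r - eta * s) ^+ 2 = eta^-1 / 2 * r ^+ 2 + eta / 2 * s ^+ 2 - r * s.
      by field; rewrite gt_eqF.
    by rewrite subr_ge0.
  have h1 := young p y; have h2 := young q x.
  have h3 : `|p * q| <= 2^-1 * p ^+ 2 + 2^-1 * q ^+ 2.
    rewrite normrM -[p ^+ 2]real_normK ?num_real// -[q ^+ 2]real_normK ?num_real//.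
    by have := sqr_ge0 (`|p| - `|q|); lra.
  have h4 := ler_normD (- (p * y) - x * q) (p * q).
  have h5 := ler_normB (- (p * y)) (x * q).
  rewrite normrN in h5; rewrite (mulrC x q) in h4 h5 *.
  by rewrite /k; lra.
rewrite !Rintegral_comb//; try by do ?[apply: integrable_comb => //|exact: integrable0].
rewrite Rintegral_cst// mul0r.
move: aB bB pd qd; move: (nrm2 a) (nrm2 b) (nrm2 (fun z => a z - a' z)) (nrm2 (fun z => b z - b' z)).
move=> A2 B2 P2 Q2 hA hB hP hQ.
have e1 : k * (tol / (4 * k)) = tol / 4 by field; rewrite gt_eqF.
have e2 : k * P2 <= tol / 4 by rewrite -e1 ler_wpM2l// ltW.
have e3 : k * Q2 <= tol / 4 by rewrite -e1 ler_wpM2l// ltW.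
have e4 : eta * B <= tol / 2.
  rewrite /eta mulrAC ler_pdivrMr; last lra.
  have : 0 <= tol * B by rewrite mulr_ge0// ltW.
  by lra.
have e5 : eta / 2 * A2 <= eta * B / 2.
  by rewrite mulrAC ler_wpM2r// ler_wpM2l// ltW.
have e6 : eta / 2 * B2 <= eta * B / 2.
  by rewrite mulrAC ler_wpM2r// ler_wpM2l// ltW.
by lra.
Qed.

End L2_approximation.

(** * Perturbation of sums of squares *)

Section limits.
Variable R : realType.

(** Young's inequality [2 |a b| <= th a ^ 2 + b ^ 2 / th]; the weight is free so
that it can be sent to 0 with the second sum. *)
Lemma sqr_sum_perturb (N : nat) (a b : nat -> R) (th : R) : 0 < th ->
  `|\sum_(i < N) (a i + b i) ^+ 2 - \sum_(i < N) a i ^+ 2| <=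
  th * (\sum_(i < N) a i ^+ 2) + (th^-1 + 1) * (\sum_(i < N) b i ^+ 2).
Proof.
move=> th0; rewrite -sumrB !mulr_sumr -big_split/=.
apply: le_trans (ler_norm_sum _ _ _) _; apply: ler_sum => i _.
move: (a i) (b i) => x y.
have -> : (x + y) ^+ 2 - x ^+ 2 = 2 * (x * y) + y ^+ 2 by ring.
have h1 := ler_normD (2 * (x * y)) (y ^+ 2).
rewrite [`|y ^+ 2|]ger0_norm ?sqr_ge0// in h1.
apply: le_trans h1 _; rewrite [(th^-1 + 1) * _]mulrDl mul1r addrA lerD2r.
rewrite !normrM ger0_norm// -[x ^+ 2]real_normK ?num_real// -[y ^+ 2]real_normK ?num_real//.
move: `|x| `|y| => r s.
have : 0 <= th^-1 * (th * r - s) ^+ 2 by rewrite mulr_ge0 ?sqr_ge0// invr_ge0 ltW.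
have -> : th^-1 * (th * r - s) ^+ 2 = th * r ^+ 2 + th^-1 * s ^+ 2 - 2 * (r * s).
  by field; rewrite gt_eqF.
by rewrite subr_ge0.
Qed.

Lemma cvg_sqr_sum_perturb (a b : nat -> nat -> R) (c : R) :
  (\sum_(i < N) a N i ^+ 2) @[N --> \oo] --> c ->
  (\sum_(i < N) b N i ^+ 2) @[N --> \oo] --> (0 : R) ->
  (\sum_(i < N) (a N i + b N i) ^+ 2) @[N --> \oo] --> c.
Proof.
set A := fun N : nat => \sum_(i < N) a N i ^+ 2.
set B := fun N : nat => \sum_(i < N) b N i ^+ 2.
rewrite -/(A _) -/(B _) => Ac B0.
(* The added 1 / (N + 1) keeps the weight positive when B N = 0. *)
pose th N : R := Num.sqrt (B N) + N.+1%:R^-1.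
have Bge0 N : 0 <= B N by apply: sumr_ge0 => i _; exact: sqr_ge0.
have th0 N : 0 < th N by rewrite ltr_wpDl ?sqrtr_ge0// invr_gt0.
have sB : Num.sqrt (B N) @[N --> \oo] --> (0 : R).
  by have := cvg_comp B Num.sqrt B0 (@sqrt_continuous R 0); rewrite sqrtr0.
pose r N := th N * A N + (Num.sqrt (B N) + B N).
have r0 : r N @[N --> \oo] --> (0 : R).
  rewrite (_ : 0 = (0 + 0) * c + (0 + 0)); last by ring.
  apply: cvgD; last exact: cvgD.
  by apply: cvgM => //; apply: cvgD => //; exact: cvg_harmonic.
have key N : `|\sum_(i < N) (a N i + b N i) ^+ 2 - A N| <= r N.
  apply: le_trans (sqr_sum_perturb _ _ _ (th0 N)) _.
  have e : (th N)^-1 * B N <= Num.sqrt (B N).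
    rewrite mulrC ler_pdivrMr// -[leLHS](sqr_sqrtr (Bge0 N)) expr2.
    by rewrite ler_wpM2l ?sqrtr_ge0// /th lerDl.
  by rewrite /r lerD2l [(_ + 1) * _]mulrDl mul1r lerD2r.
apply: (@squeeze_cvgr _ _ _ _ (fun N => A N - r N) (fun N => A N + r N)).
- apply: nearW => N; have := key N; rewrite ler_norml => /andP[h1 h2].
  by apply/andP; split; lra.
- by rewrite -[X in _ --> X]subr0; exact: cvgB.
- by rewrite -[X in _ --> X]addr0; exact: cvgD.
Qed.

Lemma cvg0_pow4 (f : nat -> R) : f N ^+ 4 @[N --> \oo] --> (0 : R) -> f N @[N --> \oo] --> (0 : R).
Proof.
move=> f4.
have s1 : Num.sqrt (f N ^+ 4) @[N --> \oo] --> (0 : R).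
  by have := cvg_comp _ Num.sqrt f4 (@sqrt_continuous R 0); rewrite sqrtr0.
have s0 : Num.sqrt (Num.sqrt (f N ^+ 4)) @[N --> \oo] --> (0 : R).
  by have := cvg_comp _ Num.sqrt s1 (@sqrt_continuous R 0); rewrite sqrtr0.
have E N : Num.sqrt (Num.sqrt (f N ^+ 4)) = `|f N|.
  by rewrite (exprM _ 2 2) sqrtr_sqr ger0_norm ?sqr_ge0// sqrtr_sqr.
by apply/norm_cvg0P; rewrite (funext E : (fun N => _) = _) in s0.
Qed.

Lemma ereal_cvg0_near (f : nat -> \bar R) (delta : R) : 0 < delta ->
  f n @[n --> \oo] --> 0%E -> \forall n \near \oo, (f n <= delta%:E)%E.
Proof.
move=> d0 /fine_cvgP[ff f0].
move/cvgrPdist_le: f0 => /(_ _ d0) f0.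
move: ff f0; apply: filterS2 => n fn /=; rewrite sub0r normrN => le.
by rewrite -(fineK fn) lee_fin (le_trans (ler_norm _) le).
Qed.

End limits.

(** * The grid *)

Section grid.
Variables (R : realType) (A1 A2 : R).
Hypotheses (A12 : A1 < A2) (A12_torus : `[A1, A2]%classic `<=` torus R).

Definition mesh (N : nat) : R := (A2 - A1) / N%:R.

(** Clamped at the last point, so that [grid N i] lies in [[A1, A2]] for every
[i] and families over the grid can be indexed by all naturals. *)
Definition grid (N i : nat) : R := A1 + (minn i N)%:R * mesh N.

Let A1_ge0 : 0 <= A1.
Proof.
have : torus R A1 by apply: A12_torus; rewrite /= in_itv/= lexx ltW.
by rewrite /torus/= in_itv/= => /andP[].
Qed.

Let A2_lt1 : A2 < 1.
Proof.
have : torus R A2 by apply: A12_torus; rewrite /= in_itv/= lexx ltW.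
by rewrite /torus/= in_itv/= => /andP[].
Qed.

Lemma length_gt0 : 0 < A2 - A1. Proof. by rewrite subr_gt0. Qed.

Lemma length_lt1 : A2 - A1 < 1. Proof. by move: A1_ge0 A2_lt1; lra. Qed.

Lemma mesh_ge0 N : 0 <= mesh N.
Proof. by rewrite divr_ge0// ltW// length_gt0. Qed.

Lemma mesh_gt0 N : (0 < N)%N -> 0 < mesh N.
Proof. by move=> N0; rewrite divr_gt0 ?length_gt0// ltr0n. Qed.

Lemma mesh_mul N : (0 < N)%N -> N%:R * mesh N = A2 - A1.
Proof. by move=> N0; rewrite /mesh mulrC divfK// pnatr_eq0 -lt0n. Qed.

Lemma mesh_le1 N : (0 < N)%N -> mesh N <= 1.
Proof.
move=> N0; rewrite /mesh ler_pdivrMr ?ltr0n// mul1r.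
by rewrite (le_trans (ltW length_lt1))// ler1n.
Qed.

(** Errors are compared with powers of [N + 1], which never vanishes. *)
Lemma mesh_le_inv N : (0 < N)%N -> mesh N <= 2 / N.+1%:R.
Proof.
move=> N0; rewrite /mesh ler_pdivrMr ?ltr0n// mulrAC ler_pdivlMr ?ltr0n//.
have := length_lt1; have := length_gt0; move: (A2 - A1) => L L0 L1.
have N1 : 1 <= N%:R :> R by rewrite ler1n.
rewrite -[N.+1%:R]natr1; nra.
Qed.

Lemma grid_torus N i : torus R (grid N i).
Proof.
apply: A12_torus; rewrite /= in_itv/= /grid lerDl mulr_ge0 ?mesh_ge0//=.
case: N => [|N]; first by rewrite minn0 mul0r addr0 ltW.
rewrite -lerBrDl -(@mesh_mul N.+1)// ler_wpM2r ?mesh_ge0// ler_nat.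
exact: geq_minr.
Qed.

Lemma gridS N i : (i < N)%N -> grid N i.+1 = grid N i + mesh N.
Proof.
move=> iN; rewrite /grid (minn_idPl iN) (minn_idPl (ltnW iN)).
by rewrite -[i.+1%:R]natr1; ring.
Qed.

(** Distinct left end points are at distance at least one mesh on the torus:
going around from the last interval to the first is no shorter because
[A2 - A1 < 1]. *)
Lemma grid_sep N i j (k : int) : (i < N)%N -> (j < N)%N -> i != j ->
  mesh N <= `|grid N i - grid N j - k%:~R|.
Proof.
wlog ij : i j k / (i <= j)%N.
  move=> H iN jN ij; have [le|/ltnW le] := leqP i j; first exact: H.
  have -> : `|grid N i - grid N j - k%:~R| = `|grid N j - grid N i - (- k)%:~R|.
    by rewrite -normrN intrN; congr (`|_|); ring.
  by apply: (H j i (- k)) => //; rewrite eq_sym.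
move=> iN jN inj; have {}ij : (i < j)%N by rewrite ltn_neqAle inj.
have N0 : (0 < N)%N by exact: leq_ltn_trans iN.
rewrite /grid (minn_idPl (ltnW iN)) (minn_idPl (ltnW jN)).
have -> : A1 + i%:R * mesh N - (A1 + j%:R * mesh N) - k%:~R = - ((j - i)%N%:R * mesh N + k%:~R).
  by rewrite natrB ?(ltnW ij)//; ring.
rewrite normrN.
have h0 := mesh_gt0 N0; have hL := mesh_mul N0; have L1 := length_lt1.
have d1 : 1 <= (j - i)%N%:R :> R by rewrite ler1n subn_gt0.
have d2 : (j - i)%N%:R + 1 <= N%:R :> R.
  by rewrite natr1 ler_nat (leq_ltn_trans (leq_subr i j)).
have [k0|k0|->] := ltgtP k 0.
- have k1 : k%:~R <= -1 :> R.
    by rewrite -[-1]/((-1)%:~R) ler_int; lia.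
  rewrite ler0_norm; last by nra.
  by nra.
- have k1 : 1 <= k%:~R :> R by rewrite ler1z -gtz0_ge1.
  by rewrite ger0_norm; nra.
- by rewrite addr0 ger0_norm; nra.
Qed.

Lemma quad_var_grid (Omega : Type) N t (Z : R -> R -> Omega -> R) w :
  quad_var A1 A2 N t Z w =
  \sum_(i < N) (Z t (grid N i.+1) w - Z t (grid N i) w) ^+ 2.
Proof.
rewrite /quad_var big_mkord; apply: eq_bigr => i _.
rewrite /grid /mesh (minn_idPl (ltn_ord i)).
by rewrite (minn_idPl (ltnW (ltn_ord i))).
Qed.

End grid.

(** * Square integrals of differences *)

Section wiener.
Context d (T : measurableType d) (R : realType) (mu : {measure set T -> \bar R}).
Variable D : set T.
Hypothesis mD : measurable D.
Local Notation L1 f := (mu.-integrable D (EFin \o f)).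

Lemma integral_sqrB_le (f g : T -> R) : measurable_fun D f -> measurable_fun D g ->
  (\int[mu]_(z in D) ((f z - g z) ^+ 2)%:E <=
   2%:E * \int[mu]_(z in D) (f z ^+ 2)%:E + 2%:E * \int[mu]_(z in D) (g z ^+ 2)%:E)%E.
Proof.
move=> mf mg.
have m2 (h : T -> R) : measurable_fun D h -> measurable_fun D (fun z => (h z ^+ 2)%:E).
  by move=> mh; apply/measurable_EFinP; exact: measurable_funX.
have m22 (h : T -> R) : measurable_fun D h -> measurable_fun D (fun z => 2%:E * (h z ^+ 2)%:E)%E.
  by move=> mh; apply: emeasurable_funM => //; exact: m2.
have p2 (h : T -> R) z : D z -> (0 <= (h z ^+ 2)%:E)%E by move=> _; rewrite lee_fin sqr_ge0.
have p22 (h : T -> R) z : D z -> (0 <= 2%:E * (h z ^+ 2)%:E)%E.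
  by move=> Dz; rewrite mule_ge0// p2.
rewrite -(ge0_integralZl mu mD (m2 f mf) (p2 f))// -(ge0_integralZl mu mD (m2 g mg) (p2 g))//.
rewrite -(ge0_integralD mu mD (p22 f) (m22 f mf) (p22 g) (m22 g mg)).
apply: ge0_le_integral => //.
- by move=> z _; rewrite lee_fin sqr_ge0.
- by apply: (m2 (fun z => f z - g z)); exact: measurable_funB.
- by apply: emeasurable_funD; exact: m22.
- move=> z _; rewrite -!EFinM -EFinD lee_fin.
  by have := sqr_ge0 (f z + g z); lra.
Qed.

Lemma integral_sqrB_cvg0 (f g : nat -> T -> R) :
  (forall n, measurable_fun D (f n)) -> (forall n, measurable_fun D (g n)) ->
  (\int[mu]_(z in D) (f n z ^+ 2)%:E)%E @[n --> \oo] --> 0%E ->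
  (\int[mu]_(z in D) (g n z ^+ 2)%:E)%E @[n --> \oo] --> 0%E ->
  (\int[mu]_(z in D) ((f n z - g n z) ^+ 2)%:E)%E @[n --> \oo] --> 0%E.
Proof.
move=> mf mg f0 g0.
apply: (@squeeze_cvge _ _ _ _ (fun=> 0%E) _ (fun n => 2%:E * \int[mu]_(z in D) (f n z ^+ 2)%:E +
  2%:E * \int[mu]_(z in D) (g n z ^+ 2)%:E)%E).
- apply: nearW => n; apply/andP; split; last exact: integral_sqrB_le.
  by apply: integral_ge0 => z _; rewrite lee_fin sqr_ge0.
- exact: cvg_cst.
- have -> : (0 = 2%:E * 0 + 2%:E * 0 :> \bar R)%E by rewrite mule0 adde0.
  by apply: cvgeD; [rewrite mule0|apply: cvgeZl|apply: cvgeZl].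
Qed.

Lemma integrable_sqrP (f : T -> R) (a : R) : measurable_fun D f ->
  (\int[mu]_(z in D) (f z ^+ 2)%:E <= a%:E)%E -> L1 (fun z => f z ^+ 2).
Proof.
move=> mf fa; apply/integrableP; split.
  by apply/measurable_EFinP; exact: measurable_funX.
under eq_integral do rewrite gee0_abs ?lee_fin ?sqr_ge0//.
by rewrite (le_lt_trans fa)// ltry.
Qed.

Lemma Rintegral_sqr_le (f : T -> R) (a : R) : measurable_fun D f ->
  (\int[mu]_(z in D) (f z ^+ 2)%:E <= a%:E)%E -> \int[mu]_(z in D) (f z ^+ 2) <= a.
Proof.
move=> mf fa; rewrite -lee_fin /Rintegral fineK//.
by apply: integrable_fin_num => //; exact: integrable_sqrP fa.
Qed.

End wiener.

(** * Wiener integrals *)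

Section wiener_integral.
Context d (Omega : measurableType d) (R : realType) (P : probability Omega R).
Variables (W : set (plane R) -> Omega -> R) (D : set (plane R)).
Hypotheses (mD : measurable D) (D_fin : (lambda2 R D < +oo)%E).
Hypothesis W_noise : white_noise P D W.
Local Notation L1 f := ((lambda2 R).-integrable D (EFin \o f)).
Local Notation inner f g := (\int[lambda2 R]_(z in D) (f z * g z)).

Lemma wiener_integral_L2 h Z : wiener_integral P W D h Z -> L1 (fun z => h z ^+ 2).
Proof.
case=> mh mZ [l [lD h0 _]].
have [n hn] := filter_ex (ereal_cvg0_near ltr01 h0).
have ms := measurable_funTS (D := D) (step_fun_measurable (lD n)).
have i1 := integrable_sqrP (measurable_funB mh ms) hn.
have := integrable_sqr_comb mD 1 (measurable_funB mh ms) ms i1 (step_fun_L2 mD D_fin (lD n)).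
by under eq_fun do rewrite mul1r /= subrK.
Qed.

Lemma wiener_integralB h h' Z Z' : wiener_integral P W D h Z -> wiener_integral P W D h' Z' ->
  wiener_integral P W D (fun z => h z - h' z) (fun w => Z w - Z' w).
Proof.
case=> mh mZ [l [lD h0 Z0]] [mh' mZ' [l' [l'D h'0 Z'0]]].
split; [exact: measurable_funB|exact: measurable_funB|].
have ms n := measurable_funTS (D := D) (step_fun_measurable (lD n)).
have ms' n := measurable_funTS (D := D) (step_fun_measurable (l'D n)).
have mS n := step_integral_measurable W_noise (lD n).
have mS' n := step_integral_measurable W_noise (l'D n).
exists (fun n => diff_step (l n) (l' n)); split.
- by move=> n; exact: diff_step_on.
- have := integral_sqrB_cvg0 mD (fun n => measurable_funB mh (ms n))
    (fun n => measurable_funB mh' (ms' n)) h0 h'0.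
  apply: cvg_trans; apply: near_eq_cvg; apply: nearW => n.
  apply: eq_integral => z _; congr (_ ^+ 2)%:E.
  by rewrite diff_step_fun /=; ring.
- rewrite expectation.unlock in Z0 Z'0 *.
  have := integral_sqrB_cvg0 measurableT (fun n => measurable_funB mZ (mS n))
    (fun n => measurable_funB mZ' (mS' n)) Z0 Z'0.
  apply: cvg_trans; apply: near_eq_cvg; apply: nearW => n.
  apply: eq_integral => w _; congr (_ ^+ 2)%:E.
  by rewrite diff_step_integral /=; ring.
Qed.

(** Finitely many Wiener integrals are close in L2 to step integrals with almost
the same Gram matrix: the inner product is continuous on bounded sets, and each
[i] may use its own approximating step function. *)
Lemma wiener_step_approx n (e : nat -> plane R -> R) (Y : nat -> Omega -> R) (B tol : R) :
  0 < tol -> 0 <= B -> (forall i, wiener_integral P W D (e i) (Y i)) ->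
  (forall i, (i < n)%N -> inner (e i) (e i) <= B) ->
  exists L : nat -> seq (R * set (plane R)),
  [/\ forall i, step_on D (L i),
      forall i j, (i < n)%N -> (j < n)%N ->
        `|step_gram D L i j - inner (e i) (e j)| <= tol &
      forall i, (i < n)%N ->
        (\int[P]_w ((Y i w - step_integral W (L i) w) ^+ 2)%:E <= tol%:E)%E].
Proof.
move=> tol0 B0 WI eB.
have [delta d0 Hd] := @L2_approx_inner _ _ _ (lambda2 R) D mD tol B tol0 B0.
have step i : exists l : seq (R * set (plane R)), [/\ step_on D l,
    (\int[lambda2 R]_(z in D) ((e i z - step_fun l z) ^+ 2)%:E <= delta%:E)%E &
    (\int[P]_w ((Y i w - step_integral W l w) ^+ 2)%:E <= tol%:E)%E].
  have [me mY [l [lD e0 Y0]]] := WI i.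
  rewrite expectation.unlock in Y0.
  have [k [h1 h2]] := filter_ex (filterI (ereal_cvg0_near d0 e0) (ereal_cvg0_near tol0 Y0)).
  by exists (l k); split.
have [L HL] := choice step.
exists L; split; [by move=> i; have [] := HL i| |by move=> i _; have [] := HL i].
move=> i j iN jN.
have L2e k : measurable_fun D (e k) /\ L1 (fun z => e k z ^+ 2).
  by split; [have [] := WI k|exact: wiener_integral_L2 (WI k)].
have L2s k : measurable_fun D (step_fun (L k)) /\ L1 (fun z => step_fun (L k) z ^+ 2).
  have [lD _ _] := HL k; split; last exact: step_fun_L2.
  exact: measurable_funTS (step_fun_measurable lD).
have eB' k : (k < n)%N -> \int[lambda2 R]_(z in D) (e k z ^+ 2) <= B.
  by move=> kn; under eq_Rintegral do rewrite expr2; exact: eB.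
have ed k : \int[lambda2 R]_(z in D) ((e k z - step_fun (L k) z) ^+ 2) <= delta.
  have [_ h _] := HL k; apply: Rintegral_sqr_le h => //.
  by apply: measurable_funB; [exact: (L2e k).1|exact: (L2s k).1].
by apply: (Hd (e i) (e j)) => //; [exact: eB'|exact: eB'].
Qed.

End wiener_integral.

(** * Quadratic variation of an array of Wiener integrals *)

Section wiener_quadratic_variation.
Context d (Omega : measurableType d) (R : realType) (P : probability Omega R).
Variables (W : set (plane R) -> Omega -> R) (D : set (plane R)).
Hypotheses (mD : measurable D) (D_fin : (lambda2 R D < +oo)%E).
Hypothesis W_noise : white_noise P D W.
Local Notation inner f g := (\int[lambda2 R]_(z in D) (f z * g z)).

(** An array whose [N]th row is almost orthogonal with almost constant variances
[v N] of order [1 / N].  Row [N] is approximated by step integrals [X N] within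
[k ^ 3], where [k = 1 / (N + 1)]: then the sum [E1] of the squared errors is of
order [k ^ 2] in mean.  So is [E2], the fourth power of the centered sum of the
[X N i ^ 2]; both are summable. *)
Lemma wiener_quadratic_variation (e : nat -> nat -> plane R -> R)
    (Y : nat -> nat -> Omega -> R) (v : nat -> R) (C V : R) :
  0 <= C ->
  (forall N i, wiener_integral P W D (e N i) (Y N i)) ->
  (forall N i, (i < N)%N -> `|inner (e N i) (e N i) - v N| <= C / N.+1%:R ^+ 2) ->
  (forall N i j, (i < N)%N -> (j < N)%N -> i != j ->
    `|inner (e N i) (e N j)| <= C / N.+1%:R ^+ 2) ->
  (forall N, (0 < N)%N -> `|v N| <= C / N.+1%:R) ->
  N%:R * v N @[N --> \oo] --> V ->
  {ae P, forall w, (\sum_(i < N) Y N i w ^+ 2) @[N --> \oo] --> V}.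
Proof.
move=> C0 WI diag off vC vV.
pose k (N : nat) : R := N.+1%:R^-1.
have k0 N : 0 < k N by rewrite invr_gt0.
have k1 N : k N <= 1 by rewrite invf_le1// ler1n.
have Nk N : N%:R * k N <= 1 by rewrite ler_pdivrMr// mul1r ler_nat.
have sumc N (x : R) : \sum_(i < N) x = N%:R * x by rewrite sumr_const card_ord mulr_natl.
have kk N : C / N.+1%:R ^+ 2 = C * k N ^+ 2 by rewrite exprVn.
have L0 N : exists L : nat -> seq (R * set (plane R)),
  [/\ forall i, step_on D (L i),
      forall i j, (i < N)%N -> (j < N)%N ->
        `|step_gram D L i j - inner (e N i) (e N j)| <= k N ^+ 3 &
      forall i, (i < N)%N ->
        (\int[P]_w ((Y N i w - step_integral W (L i) w) ^+ 2)%:E <= (k N ^+ 3)%:E)%E].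
  apply: (@wiener_step_approx _ _ _ P W D mD D_fin N (e N) (Y N) (2 * C)).
  - by rewrite exprn_gt0.
  - by rewrite mulr_ge0.
  - exact: WI.
  - move=> i iN; have N0 : (0 < N)%N by exact: leq_ltn_trans iN.
    move: (diag N i iN) (vC N N0); rewrite kk -/(k N).
    move: (inner _ _) (v N) (k N) (k0 N) (k1 N) => g s q q0 q1.
    rewrite !ler_norml => /andP[_ h1] /andP[_ h2].
    have h3 : C * q ^+ 2 <= C by rewrite ler_piMr// exprn_ile1 ?(ltW q0).
    have h4 : C * q <= C by rewrite ler_piMr.
    by lra.
have [L HL] := choice L0.
pose X N i w := step_integral W (L N i) w.
pose c N := \sum_(i < N) step_gram D (L N) i i.
have LD N i : step_on D (L N i) by have [] := HL N.
have mX N i : measurable_fun setT (X N i) := step_integral_measurable W_noise (LD N i).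
have mY N i : measurable_fun setT (Y N i) by have [] := WI N i.
have cdiag N i : (i < N)%N -> `|step_gram D (L N) i i - v N| <= (C + 1) * k N ^+ 2.
  move=> iN; have [_ /(_ i i iN iN) h _] := HL N; move: h (diag N i iN).
  rewrite kk; move: (step_gram _ _ _ _) (inner _ _) (v N) (k N) (k0 N) (k1 N).
  move=> a g s q q0 q1 h1 h2.
  have -> : a - s = (a - g) + (g - s) by ring.
  apply: le_trans (ler_normD _ _) _.
  have : q ^+ 3 <= q ^+ 2 by rewrite exprSr ler_piMr ?sqr_ge0.
  by lra.
have coff N i j : (j < i < N)%N -> `|step_gram D (L N) i j| <= (C + 1) * k N ^+ 2.
  move=> /andP[ji iN]; have jN := ltn_trans ji iN.
  have ij : i != j by rewrite gtn_eqF.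
  have [_ /(_ i j iN jN) h _] := HL N; move: h (off N i j iN jN ij).
  rewrite kk; move: (step_gram _ _ _ _) (inner _ _) (k N) (k0 N) (k1 N).
  move=> a g q q0 q1 h1 h2.
  rewrite -(subrK g a); apply: le_trans (ler_normD _ _) _.
  have : q ^+ 3 <= q ^+ 2 by rewrite exprSr ler_piMr ?sqr_ge0.
  by lra.
have cbound N i : (i < N)%N -> `|step_gram D (L N) i i| <= (2 * C + 1) * k N.
  move=> iN; have N0 : (0 < N)%N by exact: leq_ltn_trans iN.
  move: (cdiag N i iN) (vC N N0); rewrite -/(k N).
  move: (step_gram _ _ _ _) (v N) (k N) (k0 N) (k1 N) => a s q q0 q1 h1 h2.
  rewrite -(subrK s a); apply: le_trans (ler_normD _ _) _.
  have : (C + 1) * q ^+ 2 <= (C + 1) * q.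
    by rewrite expr2 ler_wpM2l ?addr_ge0// ler_piMr// ltW.
  by lra.
have cV : c N @[N --> \oo] --> V.
  have z0 : (C + 1) * k N @[N --> \oo] --> (0 : R).
    have <- : (C + 1) * 0 = 0 :> R by rewrite mulr0.
    by apply: cvgMr; exact: cvg_harmonic.
  have key N : `|c N - N%:R * v N| <= (C + 1) * k N.
    have -> : N%:R * v N = \sum_(i < N) v N by rewrite sumc.
    rewrite /c -sumrB; apply: le_trans (ler_norm_sum _ _ _) _.
    apply: (@le_trans _ _ (\sum_(i < N) (C + 1) * k N ^+ 2)).
      by apply: ler_sum => i _; exact: cdiag.
    rewrite sumc.
    have -> : N%:R * ((C + 1) * k N ^+ 2) = (C + 1) * k N * (N%:R * k N) by ring.
    by rewrite ler_piMr// mulr_ge0 ?addr_ge0// ltW.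
  apply: (@squeeze_cvgr _ _ _ _ (fun N => N%:R * v N - (C + 1) * k N)
    (fun N => N%:R * v N + (C + 1) * k N)).
  - apply: nearW => N; have := key N; rewrite ler_norml => /andP[h1 h2].
    by apply/andP; split; lra.
  - by rewrite -[X in _ --> X]subr0; exact: cvgB.
  - by rewrite -[X in _ --> X]addr0; exact: cvgD.
pose E1 N w := \sum_(i < N) (Y N i w - X N i w) ^+ 2.
have E10 : {ae P, forall w, E1 N w @[N --> \oo] --> (0 : R)}.
  apply: (@ae_cvg0_summable _ _ _ P _ 1) => //.
  - move=> N; apply: measurable_sum => i; apply: measurable_funX.
    exact: measurable_funB.
  - by move=> N w; apply: sumr_ge0 => i _; exact: sqr_ge0.
  move=> N; rewrite mul1r.
  under eq_integral do rewrite /E1 -sumEFin.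
  rewrite ge0_integral_sum//; last first.
    by move=> i w _; rewrite lee_fin sqr_ge0.
    move=> i; apply/measurable_EFinP; apply: measurable_funX; exact: measurable_funB.
  apply: (@le_trans _ _ (\sum_(i < N) (k N ^+ 3)%:E)%E).
    by apply: lee_sum => i _; have [_ _] := HL N; apply.
  rewrite sumEFin lee_fin -exprVn -/(k N) sumc.
  have -> : N%:R * k N ^+ 3 = k N ^+ 2 * (N%:R * k N) by ring.
  by rewrite ler_piMr// sqr_ge0.
pose E2 N w := (\sum_(i < N) X N i w ^+ 2 - c N) ^+ 4.
pose K := 480 * (2 * C + 1) ^+ 4 + 2304 * (C + 1) ^+ 4.
have E20 : {ae P, forall w, E2 N w @[N --> \oo] --> (0 : R)}.
  apply: (@ae_cvg0_summable _ _ _ P _ K) => //.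
  - move=> N; apply: measurable_funX; apply: measurable_funB => //.
    by apply: measurable_sum => i; exact: measurable_funX.
  - by move=> N w; apply: exprn_even_ge0.
  - have p (q : nat) x : 0 <= x -> 0 <= q%:R * x ^+ 4 :> R.
      by move=> x0; apply: mulr_ge0; [exact: ler0n|exact: exprn_ge0].
    apply: addr_ge0; apply: p; rewrite addr_ge0//.
    by rewrite mulr_ge0.
  move=> N; have [i4 le4] := step_quadratic_variation4 mD D_fin W_noise (LD N) (coff N).
  have -> : (\int[P]_w (E2 N w)%:E = (\int[P]_w (E2 N w))%:E)%E.
    by rewrite /Rintegral fineK//; exact: integrable_fin_num.
  rewrite lee_fin; apply: le_trans le4 _.
  have s2 : \sum_(i < N) step_gram D (L N) i i ^+ 2 <= (2 * C + 1) ^+ 2 * k N.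
    apply: (@le_trans _ _ (\sum_(i < N) ((2 * C + 1) * k N) ^+ 2)).
      apply: ler_sum => i _; rewrite -[leLHS]real_normK ?num_real//.
      by rewrite lerXn2r ?nnegrE// ?cbound// mulr_ge0 ?addr_ge0 ?mulr_ge0// ltW.
    rewrite sumc.
    have -> : N%:R * ((2 * C + 1) * k N) ^+ 2 = (2 * C + 1) ^+ 2 * k N * (N%:R * k N) by ring.
    by rewrite ler_piMr// mulr_ge0 ?sqr_ge0// ltW.
  have s20 : 0 <= \sum_(i < N) step_gram D (L N) i i ^+ 2.
    by apply: sumr_ge0 => i _; exact: sqr_ge0.
  have t1 : (\sum_(i < N) step_gram D (L N) i i ^+ 2) ^+ 2 <= (2 * C + 1) ^+ 4 * k N ^+ 2.
    have -> : (2 * C + 1) ^+ 4 * k N ^+ 2 = ((2 * C + 1) ^+ 2 * k N) ^+ 2 by ring.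
    by rewrite lerXn2r ?nnegrE// mulr_ge0 ?sqr_ge0// ltW.
  have t2 : ((C + 1) * k N ^+ 2) ^+ 4 * N%:R ^+ 4 <= (C + 1) ^+ 4 * k N ^+ 2.
    have -> : ((C + 1) * k N ^+ 2) ^+ 4 * N%:R ^+ 4 =
      (C + 1) ^+ 4 * k N ^+ 2 * (k N ^+ 2 * (N%:R * k N) ^+ 4) by ring.
    have p : 0 <= (C + 1) ^+ 4 * k N ^+ 2 by rewrite mulr_ge0 ?sqr_ge0// exprn_ge0// addr_ge0.
    rewrite ler_piMr// mulr_ile1 ?sqr_ge0 ?exprn_ge0 ?mulr_ge0 ?(ltW (k0 N))//.
      by rewrite exprn_ile1 ?(ltW (k0 N)).
    by rewrite exprn_ile1 ?mulr_ge0 ?(ltW (k0 N)).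
  rewrite -exprVn -/(k N) /K [leRHS](mulrDl (480 * _)) -(mulrA 480) -2!(mulrA 2304).
  by apply: lerD; (apply: ler_wpM2l; first exact: ler0n).
move: E10 E20; apply: filterS2 => w E1w /cvg0_pow4 E2w.
have XV : (\sum_(i < N) X N i w ^+ 2) @[N --> \oo] --> V.
  have -> : (fun N => \sum_(i < N) X N i w ^+ 2) =
      (fun N => (\sum_(i < N) X N i w ^+ 2 - c N) + c N).
    by apply: funext => N; rewrite subrK.
  by rewrite -[V]add0r; exact: cvgD.
have -> : (fun N => \sum_(i < N) Y N i w ^+ 2) =
    (fun N => \sum_(i < N) (X N i w + (Y N i w - X N i w)) ^+ 2).
  by apply: funext => N; apply: eq_bigr => i _; rewrite addrC subrK.
exact: (@cvg_sqr_sum_perturb _ (fun N i => X N i w) (fun N i => Y N i w - X N i w)).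
Qed.

End wiener_quadratic_variation.

(** * Kernel increments along the grid *)

Section grid_increments.
Variables (R : realType) (A1 A2 eps t : R).
Hypotheses (A12 : A1 < A2) (A12_torus : `[A1, A2]%classic `<=` torus R).
Hypotheses (eps0 : 0 < eps) (t0 : 0 < t).
Local Notation D := (spacetime t).
Local Notation K := (mild_kernel eps t).
Local Notation L1 f := ((lambda2 R).-integrable D (EFin \o f)).
Local Notation inner f g := (\int[lambda2 R]_(z in D) (f z * g z)).
Hypothesis K_meas : forall x, torus R x -> measurable_fun D (K x).
Hypothesis K_L2 : forall x, torus R x -> L1 (fun z => K x z ^+ 2).

Let mD : measurable D. Proof. exact: measurable_spacetime. Qed.

Definition grid_increment N i (z : plane R) : R :=
  K (grid A1 A2 N i.+1) z - K (grid A1 A2 N i) z.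

Let h N := mesh A1 A2 N.

Lemma grid_increment_measurable N i : measurable_fun D (grid_increment N i).
Proof. by apply: measurable_funB; apply: K_meas; exact: grid_torus. Qed.

Lemma grid_increment_L2 N i : L1 (fun z => grid_increment N i z ^+ 2).
Proof.
have := integrable_sqr_comb mD (- 1) (K_meas (grid_torus A12 A12_torus N i))
  (K_meas (grid_torus A12 A12_torus N i.+1)) (K_L2 (grid_torus A12 A12_torus N i))
  (K_L2 (grid_torus A12 A12_torus N i.+1)).
by under eq_fun do rewrite mulN1r addrC.
Qed.

Lemma grid_increment_gram : exists2 C, 0 <= C & forall N i j, (i < N)%N -> (j < N)%N ->
  `|inner (grid_increment N i) (grid_increment N j) - (i == j)%:R * (h N / (2 * eps))| <= C * h N ^+ 2.
Proof.
have [C C0 HC] := increment_gram_bound eps0 t0 K_meas K_L2.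
exists C => // N i j iN jN; have N0 : (0 < N)%N by exact: leq_ltn_trans iN.
have gT k : torus R (grid A1 A2 N k) by exact: grid_torus.
have gTS k : (k < N)%N -> torus R (grid A1 A2 N k + h N) by move=> kN; rewrite /h -gridS.
have iE k : (k < N)%N -> kernel_increment eps t (h N) (grid A1 A2 N k) = grid_increment N k.
  by move=> kN; apply: funext => z; rewrite /kernel_increment /grid_increment /h -gridS.
have [H1 H2] := HC (h N) (grid A1 A2 N i) (grid A1 A2 N j) (mesh_gt0 A12 N0)
  (mesh_le1 A12 A12_torus N0) (gT i) (gTS i iN) (gT j) (gTS j jN).
rewrite (iE _ iN) (iE _ jN) in H1 H2.
have [ij|ij] := eqVneq i j.
  by rewrite mul1r; apply: H1; rewrite ij.
by rewrite mul0r subr0; apply: H2 => k; exact: grid_sep.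
Qed.

(** Each row of the Gram matrix has one entry of size [h / (2 eps)] and [N]
entries of size [C h ^ 2], and [N h] is the length of the interval: row sums
are of order [h]. *)
Lemma drift_quadratic_variation (F : plane R -> R) : measurable_fun D F -> L1 (fun z => F z ^+ 2) ->
  (\sum_(i < N) (inner (grid_increment N i) F) ^+ 2) @[N --> \oo] --> (0 : R).
Proof.
move=> mF F2; have [C C0 HC] := grid_increment_gram.
have e20 : 0 < 2 * eps by rewrite mulr_gt0.
pose r := (2 * eps)^-1 + C * (A2 - A1).
have L0 := length_gt0 A12.
have r0 : 0 < r by rewrite ltr_wpDr ?invr_gt0// mulr_ge0// ltW.
pose I := \int[lambda2 R]_(z in D) (F z ^+ 2).
have key N : (0 < N)%N -> \sum_(i < N) (inner (grid_increment N i) F) ^+ 2 <= h N * r * I.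
  move=> N0; have h0 := mesh_gt0 A12 N0.
  apply: (bessel_row_sum mD) => //.
  - by rewrite mulr_gt0.
  - exact: grid_increment_measurable.
  - exact: grid_increment_L2.
  move=> i iN.
  apply: (@le_trans _ _ (\sum_(j < N) ((i == j)%:R * (h N / (2 * eps)) + C * h N ^+ 2))).
    apply: ler_sum => j _; have := HC N i j iN (ltn_ord j).
    move: (inner _ _) => g; set s := (_%:R * _) => Hg.
    have s0 : 0 <= s by rewrite mulr_ge0// divr_ge0// ltW.
    rewrite -[g](subrK s) (le_trans (ler_normD _ _))// (ger0_norm s0) addrC lerD2l//.
  rewrite big_split/= sumr_const card_ord -[X in _ + X]mulr_natl.
  rewrite (bigD1 (Ordinal iN))//= eqxx mul1r big1 ?addr0; last first.
    by move=> j ji; rewrite -(inj_eq val_inj) /= in ji; rewrite eq_sym (negbTE ji) mul0r.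
  have hN := mesh_mul A1 A2 N0; rewrite -/(h N) in hN.
  by rewrite /r -hN le_eqVlt; apply/orP; left; apply/eqP; ring.
apply: (@squeeze_cvgr _ _ _ _ (fun=> 0) (fun N : nat => (2 * r * I) * N.+1%:R^-1)).
- apply: (@filterS _ _ _ (fun N => (0 < N)%N)); last exact: nbhs_infty_gt.
  move=> N N0; apply/andP; split; first by apply: sumr_ge0 => i _; exact: sqr_ge0.
  apply: le_trans (key N N0) _.
  have hle := mesh_le_inv A12 A12_torus N0.
  have I0 : 0 <= I by apply: Rintegral_ge0 => z _; exact: sqr_ge0.
  have rI0 : 0 <= r * I by rewrite mulr_ge0// ltW.
  rewrite -mulrA; apply: le_trans (ler_wpM2r rI0 hle) _.
  by rewrite le_eqVlt; apply/orP; left; apply/eqP; ring.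
- exact: cvg_cst.
- have <- : (2 * r * I) * 0 = 0 :> R by rewrite mulr0.
  by apply: cvgMr; exact: cvg_harmonic.
Qed.

End grid_increments.

(** The kernels live on [[0, t]] times the torus, the noise on a larger
domain. *)
Lemma white_noiseS d (Omega : measurableType d) (R : realType) (P : probability Omega R)
    (W : set (plane R) -> Omega -> R) (D D' : set (plane R)) :
  D `<=` D' -> white_noise P D' W -> white_noise P D W.
Proof.
move=> DD' [gauss cov]; split.
  by move=> l lD; apply: gauss => c /lD [mc cD]; split=> //; exact: subset_trans DD'.
by move=> A B mA AD mB BD; apply: cov => //; exact: subset_trans DD'.
Qed.

(** * Quadratic variation of the solution *)

Theorem proposition4p5 (R : realType) (d : measure_display)
    (Omega : measurableType d) (P : probability Omega R)
    (T : R) (T_gt0 : 0 < T)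
    (W : set (plane R) -> Omega -> R) (W_noise : white_noise P (spacetime T) W)
    (A1 A2 : R) (A1_lt_A2 : A1 < A2) (A12_torus : `[A1, A2]%classic `<=` torus R)
    (eps : R) (eps_gt0 : 0 < eps)
    (u : R -> R -> Omega -> R) (u_mild : mild_solution P T eps W u)
    (t : R) (t_gt0 : 0 < t) (t_le_T : t <= T) :
  {ae P, forall w : Omega,
    quad_var A1 A2 N t u w @[N --> \oo] --> 2^-1 * (A2 - A1) * eps^-1}.
Proof.
have [u_meas u_eq u_moments] := u_mild.
have DT : spacetime t `<=` spacetime T.
  move=> z [/= zt zx]; split => //=; move: zt; rewrite /= !in_itv/= => /andP[-> zt].
  exact: le_trans t_le_T.
have Wt : white_noise P (spacetime t) W by exact: white_noiseS W_noise.
have mD : measurable (spacetime t) := measurable_spacetime t.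
have D_fin := spacetime_fin t_gt0.
pose F w (z : plane R) := reaction (u z.1 z.2 w).
pose K := mild_kernel eps t.
have Zx (x : R) : exists Z : Omega -> R, torus R x ->
    wiener_integral P W (spacetime t) (K x) Z /\
    {ae P, forall w,
      (lambda2 R).-integrable (spacetime t) (EFin \o (fun z => K x z * F w z)) /\
      u t x w = \int[lambda2 R]_(z in spacetime t) (K x z * F w z) + Z w}.
  have [xT|xT] := pselect (torus R x); last by exists (fun=> 0).
  have tT : `[0, T]%classic t by rewrite /= in_itv/= (ltW t_gt0).
  have [Z WZ uZ] := u_eq t x tT xT; exists Z => _; split => //.
  move: uZ; apply: filterS => w [Iw uw]; split => //.
  by rewrite -(iterated_Rintegral Iw).
(* Points outside the torus get the value 0, so that Z is defined for all x. *)
have [Z HZ] := choice Zx.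
have K_meas x : torus R x -> measurable_fun (spacetime t) (K x).
  by move=> /HZ [[]].
have K_L2 x : torus R x ->
    (lambda2 R).-integrable (spacetime t) (EFin \o (fun z => K x z ^+ 2)).
  by move=> /HZ [/(wiener_integral_L2 mD D_fin)].
have gT N i : torus R (grid A1 A2 N i) by exact: grid_torus.
pose Y N i w := Z (grid A1 A2 N i.+1) w - Z (grid A1 A2 N i) w.
pose h N := mesh A1 A2 N.
have noise : {ae P, forall w, (\sum_(i < N) Y N i w ^+ 2) @[N --> \oo] --> 2^-1 * (A2 - A1) * eps^-1}.
  have [C C0 HC] := grid_increment_gram A1_lt_A2 A12_torus eps_gt0 t_gt0 K_meas K_L2.
  have h2 N : (0 < N)%N -> h N ^+ 2 <= 4 / N.+1%:R ^+ 2.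
    move=> N0; have := mesh_le_inv A1_lt_A2 A12_torus N0; rewrite -/(h N) => hle.
    have -> : 4 / N.+1%:R ^+ 2 = (2 / N.+1%:R) ^+ 2 :> R by rewrite exprMn exprVn; congr (_ * _); ring.
    by apply: lerXn2r => //; rewrite nnegrE; [exact: mesh_ge0|exact: divr_ge0].
  have Ch2 N : (0 < N)%N -> C * h N ^+ 2 <= (4 * C + eps^-1) / N.+1%:R ^+ 2.
    move=> N0; apply: le_trans (ler_wpM2l C0 (h2 N N0)) _.
    rewrite mulrA ler_wpM2r ?invr_ge0 ?exprn_ge0// [C * 4]mulrC lerDl.
    by rewrite invr_ge0 ltW.
  apply: (@wiener_quadratic_variation _ _ _ _ _ _ mD D_fin Wt
    (grid_increment A1 A2 eps t) Y (fun N => h N / (2 * eps)) (4 * C + eps^-1)).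
  - by rewrite addr_ge0 ?mulr_ge0// invr_ge0 ltW.
  - move=> N i.
    exact: (wiener_integralB mD Wt (HZ _ (gT N i.+1)).1 (HZ _ (gT N i)).1).
  - move=> N i iN; have N0 : (0 < N)%N by exact: leq_ltn_trans iN.
    by apply: le_trans (Ch2 N N0); have := HC N i i iN iN; rewrite eqxx mul1r.
  - move=> N i j iN jN ij; have N0 : (0 < N)%N by exact: leq_ltn_trans iN.
    apply: le_trans (Ch2 N N0); have := HC N i j iN jN.
    by rewrite (negbTE ij) mul0r subr0.
  - move=> N N0; rewrite ger0_norm; last by rewrite divr_ge0 ?(mesh_ge0 A1_lt_A2)// mulr_ge0// ltW.
    have hle := mesh_le_inv A1_lt_A2 A12_torus N0.
    have e0 : 0 <= (2 * eps)^-1 by rewrite invr_ge0 mulr_ge0 ?(ltW eps_gt0).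
    apply: le_trans (ler_wpM2r e0 hle) _.
    have -> : 2 / N.+1%:R / (2 * eps) = eps^-1 / N.+1%:R :> R.
      by move: N.+1%:R => q; rewrite invfM; move: q^-1 => q'; field; rewrite gt_eqF.
    by rewrite ler_wpM2r ?invr_ge0// lerDr mulr_ge0.
  - apply: cvg_near_cst; apply: filterS (nbhs_infty_gt 0) => N N0.
    by rewrite mulrA mesh_mul//; field; rewrite gt_eqF.
have eq_u : {ae P, forall w, forall N i,
    (lambda2 R).-integrable (spacetime t) (EFin \o (fun z => K (grid A1 A2 N i) z * F w z)) /\
    u t (grid A1 A2 N i) w =
      \int[lambda2 R]_(z in spacetime t) (K (grid A1 A2 N i) z * F w z) + Z (grid A1 A2 N i) w}.
  by apply: ae_foralln => N; apply: ae_foralln => i; exact: (HZ _ (gT N i)).2.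
have F_L2 := reaction_L2 T_gt0 u_meas u_moments.
move: noise eq_u F_L2; apply: filterS3 => w noise eq_u F_L2.
have mF : measurable_fun (spacetime t) (F w).
  have mu : measurable_fun (spacetime t) (fun z : plane R => u z.1 z.2 w).
    exact: (measurable_funS (measurable_spacetime T) DT (time_space_section_measurable u_meas w)).
  by apply: measurable_funB => //; exact: measurable_funX.
have F2 : (lambda2 R).-integrable (spacetime t) (EFin \o (fun z => F w z ^+ 2)).
  exact: (integrableS (measurable_spacetime T) mD DT F_L2).
have drift := drift_quadratic_variation A1_lt_A2 A12_torus eps_gt0 t_gt0 K_meas K_L2 mF F2.
have -> : (fun N => quad_var A1 A2 N t u w) = (fun N => \sum_(i < N) (Y N i w +
    \int[lambda2 R]_(z in spacetime t) (grid_increment A1 A2 eps t N i z * F w z)) ^+ 2).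
  apply: funext => N; rewrite quad_var_grid; apply: eq_bigr => i _; congr (_ ^+ 2).
  have [I1 ->] := eq_u N i.+1; have [I0 ->] := eq_u N i.
  have -> : \int[lambda2 R]_(z in spacetime t) (grid_increment A1 A2 eps t N i z * F w z) =
      \int[lambda2 R]_(z in spacetime t) (K (grid A1 A2 N i.+1) z * F w z) -
      \int[lambda2 R]_(z in spacetime t) (K (grid A1 A2 N i) z * F w z).
    rewrite -RintegralB//; apply: eq_Rintegral => z _.
    by rewrite /grid_increment mulrBl.
  rewrite /Y; move: (\int[_]_(_ in _) _) (\int[_]_(_ in _) _) => a b.
  by move: (Z _ w) (Z _ w) => c c'; ring.
exact: (@cvg_sqr_sum_perturb _ (fun N i => Y N i w) (fun N i =>
  \int[lambda2 R]_(z in spacetime t) (grid_increment A1 A2 eps t N i z * F w z))).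
Qed.
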